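(* Let $(\mathcal N;S,T)$ be a unitary modular symbol of rank $4$ and let $\tilde S=S/s_{00}$. Then, up to a permutation of the labels (fixing the label $0$), $\tilde S$ is one of the following: (1) $\begin{pmatrix}1&1&1&1\\1&1&-1&-1\\1&-1&\omega&\bar\omega\\1&-1&\bar\omega&\omega\end{pmatrix}$, where $\omega=\pm i$; (2) $\begin{pmatrix}1&1&1&1\\1&1&-1&-1\\1&-1&1&-1\\1&-1&-1&1\end{pmatrix}$; (3) $\begin{pmatrix}1&1&1&1\\1&-1&1&-1\\1&1&-1&-1\\1&-1&-1&1\end{pmatrix}$; (4) $\begin{pmatrix}1&\varphi&1&\varphi\\ \varphi&-1&\varphi&-1\\1&\varphi&-1&-\varphi\\ \varphi&-1&-\varphi&1\end{pmatrix}$, where $\varphi=\frac{1+\sqrt5}{2}$; (5) $\begin{pmatrix}1&\varphi&\varphi&\varphi^2\\ \varphi&-1&\varphi^2&-\varphi\\ \varphi&\varphi^2&-1&-\varphi\\ \varphi^2&-\varphi&-\varphi&1\end{pmatrix}$, where $\varphi=\frac{1+\sqrt5}{2}$; (6) $\begin{pmatrix}1&d^2-1&d+1&d\\ d^2-1&0&-d^2+1&d^2-1\\ d+1&-d^2+1&d&-1\\ d&d^2-1&-1&-d-1\end{pmatrix}$, where $d$ is the largest real root of $x^3-3x-1$.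
   Context: A rank $n$ label set is a set $\mathcal L=\{0,1,\dots,n-1\}$ with an involution $i\mapsto\hat i$ such that $\hat 0=0$; the charge conjugation matrix is $C=(\delta_{i\hat j})$. A rank $n$ modular fusion rule is a pair $(\mathcal N;\tilde S)$ where $\mathcal N=\{N_i\}_{i\in\mathcal L}$, $N_i=(n_{i,j}^k)_{0\le j,k\le n-1}$ has rational entries, and $\tilde S=(\tilde s_{ij})$ is a complex $n\times n$ matrix with $\tilde s_{00}=1$, $\tilde s_{i,\hat j}=\overline{\tilde s_{i,j}}$, all $\tilde s_{i,0}\ne0$, such that, with $D=\sqrt{\sum_i \tilde s_{i,0}^2}>0$, the matrix $\tilde S/D$ is symmetric and unitary, and $N_i\tilde S=\tilde S\Lambda_i$ for all $i$, where $\Lambda_i$ is diagonal with $(a,a)$ entry $\lambda_{ia}=\tilde s_{ia}/\tilde s_{0a}$. Put $d_i=\tilde s_{i0}$ (quantum dimensions). A rank $n$ modular symbol is a triple $(\mathcal N;S,T)$ such that $S=(s_{ij})$ is unitary, $(\mathcal N;S/s_{00})$ is a rank $n$ modular fusion rule with all $n_{i,j}^k\in\{0,1,2,\dots\}$, $T=\mathrm{diag}(\theta_0,\dots,\theta_{n-1})$ is diagonal with $\theta_0=1$, and: (i) $(ST)^3=(D_+s_{00})S^2$; (ii) $S^2=C$; (iii) $|\theta_i|=1$ and $\theta_{\hat i}=\theta_i$ for each $i$; here $D_{\pm}=\sum_i\theta_i^{\pm1}d_i^2$. A modular symbol is unitary if each quantum dimension $d_i$ is the Frobenius–Perron eigenvalue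 (largest non-negative real eigenvalue) of the fusion matrix $N_i$; in particular all $d_i$ are real numbers $\ge1$. *)

(* Defs.v *)
From HB Require Import structures.
From mathcomp Require Import all_boot all_order all_fingroup all_algebra.
From mathcomp Require Import spectral.
From mathcomp Require Import reals complex.

Set Implicit Arguments.
Unset Strict Implicit.
Unset Printing Implicit Defensive.

Import Order.TTheory GRing.Theory Num.Theory.
Local Open Scope ring_scope.

(* Everything below is written over a numClosedFieldType C; the intended       *)
(* instance is the field R[i] of complex numbers over R : realType.  On such   *)
(* a C, [0 <= x] and [0 < x] include the assertion that x is real.             *)
(* A rank n.+1 label set is 'I_n.+1 = {0, ..., n}, so that the label 0 exists. *)

Record label_involution (n : nat) (hat : 'I_n.+1 -> 'I_n.+1) : Prop := {
  hat_involutive : involutive hat;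
  hat_ord0 : hat ord0 = ord0 }.

Definition charge_conj (C : numClosedFieldType) (n : nat)
    (hat : 'I_n.+1 -> 'I_n.+1) : 'M[C]_n.+1 :=
  \matrix_(i, j) (i == hat j)%:R.

Definition qdim (C : numClosedFieldType) (n : nat) (St : 'M[C]_n.+1)
    (i : 'I_n.+1) : C := St i ord0.

(* sqrtC z is nonnegative only when z is a nonnegative real, so 0 < Dtot St    *)
(* says that the sum of the squared dimensions is a positive real.             *)
Definition Dtot (C : numClosedFieldType) (n : nat) (St : 'M[C]_n.+1) : C :=
  sqrtC (\sum_i St i ord0 ^+ 2).

(* Fusion coefficients are stored as N i j k = n_{i,j}^k, in rat, and embedded *)
(* in C by ratr.                                                               *)
Definition fusion_mx (C : numClosedFieldType) (n : nat)
    (N : 'I_n.+1 -> 'M[rat]_n.+1) (i : 'I_n.+1) : 'M[C]_n.+1 :=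
  map_mx ratr (N i).

Definition Lambda (C : numClosedFieldType) (n : nat) (St : 'M[C]_n.+1)
    (i : 'I_n.+1) : 'M[C]_n.+1 :=
  diag_mx (\row_a (St i a / St ord0 a)).

Record modular_fusion_rule (C : numClosedFieldType) (n : nat)
    (hat : 'I_n.+1 -> 'I_n.+1) (N : 'I_n.+1 -> 'M[rat]_n.+1)
    (St : 'M[C]_n.+1) : Prop := {
  mfr_St00 : St ord0 ord0 = 1;
  mfr_hat : forall i j, St i (hat j) = (St i j)^*;
  mfr_qdim_neq0 : forall i, St i ord0 != 0;
  mfr_Dtot_gt0 : 0 < Dtot St;
  mfr_sym : ((Dtot St)^-1 *: St)^T = (Dtot St)^-1 *: St;
  mfr_unitary : (Dtot St)^-1 *: St \is unitarymx;
  mfr_diag : forall i, fusion_mx C N i *m St = St *m Lambda St i }.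

Definition normalized_S (C : numClosedFieldType) (n : nat) (S : 'M[C]_n.+1) :
    'M[C]_n.+1 := (S ord0 ord0)^-1 *: S.

Definition Dplus (C : numClosedFieldType) (n : nat) (S T : 'M[C]_n.+1) : C :=
  \sum_i T i i * qdim (normalized_S S) i ^+ 2.

(* S 0 0 is nonzero in a modular symbol: otherwise normalized_S S would be 0,  *)
(* contradicting mfr_St00.                                                     *)
Record modular_symbol (C : numClosedFieldType) (n : nat)
    (hat : 'I_n.+1 -> 'I_n.+1) (N : 'I_n.+1 -> 'M[rat]_n.+1)
    (S T : 'M[C]_n.+1) : Prop := {
  ms_unitary : S \is unitarymx;
  ms_fusion : modular_fusion_rule hat N (normalized_S S);
  ms_nat : forall i j k, N i j k \is a Num.nat;
  ms_diag : is_diag_mx T;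
  ms_theta0 : T ord0 ord0 = 1;
  ms_ST3 : (S *m T) ^+ 3 = (Dplus S T * S ord0 ord0) *: S ^+ 2;
  ms_S2 : S ^+ 2 = charge_conj C hat;
  ms_theta_norm : forall i, `|T i i| = 1;
  ms_theta_hat : forall i, T (hat i) (hat i) = T i i }.

Definition is_FP_eigenvalue (C : numClosedFieldType) (n : nat)
    (A : 'M[C]_n) (x : C) : Prop :=
  [/\ eigenvalue A x, 0 <= x &
      forall y : C, eigenvalue A y -> 0 <= y -> y <= x].

Definition unitary_modular_symbol (C : numClosedFieldType) (n : nat)
    (hat : 'I_n.+1 -> 'I_n.+1) (N : 'I_n.+1 -> 'M[rat]_n.+1)
    (S T : 'M[C]_n.+1) : Prop :=
  modular_symbol hat N S T /\
  forall i, is_FP_eigenvalue (fusion_mx C N i) (qdim (normalized_S S) i).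

Definition mx4 (C : numClosedFieldType) (rows : seq (seq C)) : 'M[C]_4 :=
  \matrix_(i, j) nth 0 (nth [::] rows i) j.

Definition golden (C : numClosedFieldType) : C := (1 + sqrtC 5) / 2.

Definition largest_real_root (R : realType) (p : {poly R}) (d : R) : Prop :=
  root p d /\ forall x : R, root p x -> x <= d.

Definition St1 (C : numClosedFieldType) (w : C) : 'M[C]_4 := mx4
  [:: [:: 1;  1;    1;    1];
      [:: 1;  1;  - 1;  - 1];
      [:: 1; - 1;   w; w^* ];
      [:: 1; - 1; w^*;   w ]].

Definition St2 (C : numClosedFieldType) : 'M[C]_4 := mx4
  [:: [:: 1;   1;   1;   1];
      [:: 1;   1; - 1; - 1];
      [:: 1; - 1;   1; - 1];
      [:: 1; - 1; - 1;   1]].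

Definition St3 (C : numClosedFieldType) : 'M[C]_4 := mx4
  [:: [:: 1;   1;   1;   1];
      [:: 1; - 1;   1; - 1];
      [:: 1;   1; - 1; - 1];
      [:: 1; - 1; - 1;   1]].

Definition St4 (C : numClosedFieldType) : 'M[C]_4 :=
  let phi := golden C in mx4
  [:: [:: 1;   phi;     1;   phi];
      [:: phi; - 1;   phi;   - 1];
      [:: 1;   phi;   - 1; - phi];
      [:: phi; - 1; - phi;     1]].

Definition St5 (C : numClosedFieldType) : 'M[C]_4 :=
  let phi := golden C in mx4
  [:: [:: 1;        phi;      phi;      phi ^+ 2];
      [:: phi;      - 1;      phi ^+ 2; - phi   ];
      [:: phi;      phi ^+ 2; - 1;      - phi   ];
      [:: phi ^+ 2; - phi;    - phi;    1       ]].

Definition St6 (C : numClosedFieldType) (d : C) : 'M[C]_4 := mx4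
  [:: [:: 1;          d ^+ 2 - 1;     d + 1;          d         ];
      [:: d ^+ 2 - 1; 0;              - d ^+ 2 + 1;   d ^+ 2 - 1];
      [:: d + 1;      - d ^+ 2 + 1;   d;              - 1       ];
      [:: d;          d ^+ 2 - 1;     - 1;            - d - 1   ]].

(* Main.v *)
(* Write the S-matrix columns divided by the dimensions as the characters
   lam i a = S i a / S a 0 of the fusion ring.  An integral expression in the lam i a
   is an integer as soon as it is fixed by all permutations of the columns that
   preserve the integral relations between the lam i a; for such a permutation t,
   S i (t j) ^ 2 = S (t i) j ^ 2.  If all of them fix 0, the dimensions are integers
   whose squares divide their sum of squares, hence are all 1.  Otherwise some t moves 0,
   and up to relabelling t is (0 1), (0 1)(2 3), (0 1 2) or (0 1 2 3).  In each case the
   squares above fix S up to signs, orthogonality fixes the signs, and the relations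
   sum_k S i k * S j k * theta k = p * S i j / (theta i * theta j), where |p| ^ 2 is the
   sum of the squared dimensions, together with integrality of fusion coefficients and of
   invariant expressions determine the dimensions. *)

Require Import Defs.
From HB Require Import structures.
From mathcomp Require Import all_boot all_order all_fingroup all_algebra all_field.
From mathcomp Require Import spectral.
From mathcomp Require Import boolp reals complex.
From mathcomp Require Import ring lra zify.

Set Implicit Arguments.
Unset Strict Implicit.
Unset Printing Implicit Defensive.

Import Order.TTheory GRing.Theory Num.Theory.
Local Open Scope ring_scope.

(** * Permutations of the characters of a fusion ring *)

(** No Galois group is constructed. A Galois permutation is any permutation of the columns under
    which integral relations persist; such permutations compose, and can be conjugated by
    relabellings, without reference to a field. The number field enters only in the proof of
    [galois_invariant_int]. The obstacle is that invariance must be checked against all Galois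
    permutations, not only the chosen [t], so each cycle type needs an argument confining the
    others. Transpositions and four-cycles turn out to be contradictory, a three-cycle leads to
    [St6], and a double transposition to a Kronecker product of two matrices of rank 2, hence to
    [St3], [St4] or [St5]. The comparison of signs and sizes needs real entries, that is, self-dual
    labels. Otherwise duality fixes 0 and one more label and swaps the other two; this case is
    treated directly and yields only [St1]. *)

Section NumberField.
Variable C : numClosedFieldType.
Local Notation QtoC := (ratr : rat -> C).
Local Notation pQtoC := (map_poly (ratr : rat -> C)).

(** The primitive element theorem for two elements, iterated along the list: the polynomials found
    so far are composed with the one that recovers the previous generator from the new one. *)
Lemma rat_primitive_element (s : seq C) :
  {in s, forall x, algebraicOver QtoC x} ->
  exists2 z : C, algebraicOver QtoC z &
    exists ps : seq {poly rat}, s = [seq (pQtoC p).[z] | p <- ps].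
Proof.
elim: s => [|x s IHs] alg_s.
  by exists 0; [apply: algebraic0 | exists nil].
have [y sy|z alg_z [ps Ds]] := IHs; first by apply: alg_s; rewrite inE sy orbT.
have [rx nz_rx rx0] : algebraicOver QtoC x by apply: alg_s; rewrite inE eqxx.
have [rz nz_rz rz0] : algebraicOver QtoC (- z) by apply: algebraic_opp.
have pchar0_Q: [pchar rat] =i pred0 by apply: pchar_num.
have [n [[pz Dpz] [px Dpx]]] := pchar0_PET nz_rz rz0 nz_rx rx0 pchar0_Q.
exists (x *+ n - (- z)).
  rewrite opprK; apply: algebraic_add => //; rewrite -mulr_natr.
  apply: algebraic_mul; first by apply: alg_s; rewrite inE eqxx.
  by rewrite -(ratr_nat C); apply: algebraic_id.
exists (px :: [seq p \Po (- pz) | p <- ps]); rewrite /=; congr (_ :: _).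
  exact: esym Dpx.
rewrite -map_comp Ds; apply: eq_map => p /=.
by rewrite map_comp_poly horner_comp rmorphN hornerN Dpz opprK.
Qed.

(** [m] is a nonzero rational polynomial of least size vanishing at [z]. Any [q] vanishing at [z]
    has a nontrivial common factor with [m], which by irreducibility is [m] itself. *)
Lemma rat_minpoly_exists (z : C) : algebraicOver QtoC z ->
  exists2 m : {poly rat}, irreducible_poly m &
    forall q, root (pQtoC q) z = (m %| q).
Proof.
move=> [p0 nz_p0 p0z].
pose P n := `[< exists q : {poly rat}, [/\ q != 0, root (pQtoC q) z & size q = n] >].
have exP : exists n, P n by exists (size p0); apply/asboolP; exists p0.
case: (ex_minnP exP) => n /asboolP[m [nz_m mz Dn]] min_n.
have irr_m : irreducible_poly m.
  apply/(subfx_irreducibleP mz nz_m) => q qz nz_q.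
  by rewrite Dn; apply: min_n; apply/asboolP; exists q.
exists m => // q; apply/idP/idP => [qz | /dvdpP[r ->]]; last first.
  by rewrite rmorphM rootM mz orbT.
suffices /eqp_dvdl <-: gcdp m q %= m by apply: dvdp_gcdr.
case: irr_m => _ irr_m; rewrite irr_m ?dvdp_gcdl ?gtn_eqF //.
rewrite -(size_map_poly QtoC) gcdp_map /=.
by rewrite (@root_size_gt1 _ z) ?root_gcd ?mz // gcdp_eq0 !map_poly_eq0 negb_and nz_m.
Qed.

(* In characteristic zero an irreducible polynomial has as many roots as its
   degree, so a lower-degree polynomial cannot be constant on all of them. *)
Lemma const_on_roots (m p : {poly rat}) (x : C) :
  irreducible_poly m -> (size p < size m)%N ->
  (forall y, root (pQtoC m) y -> (pQtoC p).[y] = x) ->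
  exists a : rat, x = QtoC a.
Proof.
move=> irr_m lt_pm px; have nz_m := irredp_neq0 irr_m.
have sep_m : separable_poly m.
  rewrite unlock; apply/negbNE/negP => ncop.
  case: irr_m => m_gt1 irr_m.
  have := irr_m (gcdp m m^`()) ncop (dvdp_gcdl _ _).
  move/eqp_dvdl => dv; have : m %| m^`() by rewrite -dv dvdp_gcdr.
  have m'0 : m^`() != 0.
    apply/eqP => /(congr1 (fun q : {poly rat} => q`_(size m).-2)) /eqP.
    rewrite coef_deriv coef0 mulrn_eq0 /= prednK; last by case: (size m) m_gt1 => [|[]].
    by rewrite -lead_coefE lead_coef_eq0 (negPf nz_m).
  by move/(dvdp_leq m'0); rewrite leqNgt lt_size_deriv.
have [rs Drs] := closed_field_poly_normal (pQtoC m).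
have nz_lead : lead_coef (pQtoC m) != 0 by rewrite lead_coef_eq0 map_poly_eq0.
have uniq_rs : uniq rs.
  rewrite -separable_prod_XsubC -(separable_map QtoC) in sep_m *.
  move: sep_m; rewrite Drs; set q := \prod_(z <- _) _.
  by apply: dvdp_separable; rewrite dvdpZr.
have sz_rs : size m = (size rs).+1.
  by rewrite -(size_map_poly QtoC) Drs size_scale // size_prod_XsubC.
have rs_root y : y \in rs -> root (pQtoC m) y.
  by rewrite Drs rootZ // root_prod_XsubC.
have q0 : pQtoC p - x%:P = 0.
  apply/eqP/negbNE/negP => nz_q.
  have := max_poly_roots nz_q _ uniq_rs.
  rewrite ltnNge => /(_ _)/negP; apply; last first.
    rewrite -ltnS -sz_rs (leq_ltn_trans (size_polyD _ _)) // size_polyN gtn_max.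
    rewrite size_map_poly lt_pm (leq_ltn_trans (size_polyC_leq1 _)) //.
    by case: irr_m.
  apply/allP => y /rs_root my.
  by rewrite /root !hornerE px // subrr.
exists p`_0; have := congr1 (fun q : {poly C} => q`_0) q0.
by rewrite coefB coef_map coefC coef0 /= => /eqP; rewrite subr_eq0 => /eqP.
Qed.

End NumberField.
(** Whether a rational number is a root of an integral polynomial does not depend on the ambient
    field, so the question can be moved to [algC], where rational algebraic integers are known to be
    integers. *)
Lemma rat_integral_int (C : numFieldType) (r : rat) :
  integralOver (intr : int -> C) (ratr r) -> exists z : int, r = z%:~R.
Proof.
case=> p mon_p pr0.
have root_morph (K : numFieldType) :
    root (map_poly (intr : int -> K) p) (ratr r) = root (map_poly (intr : int -> rat) p) r.
  rewrite -(fmorph_root (ratr : {rmorphism rat -> K})) -map_poly_comp.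
  by congr root; apply: eq_map_poly => z /=; rewrite ratr_int.
suffices: (ratr r : algC) \is a Num.int by rewrite Cint_rat => /intrP.
apply: Cint_rat_Aint; first exact: Crat_rat.
apply: (@root_monic_Aint (map_poly intr p)); first by rewrite root_morph -(root_morph C).
  exact: monic_map.
by apply/polyOverP => i; rewrite coef_map /= intr_int.
Qed.

(** Relations are kept as syntax so that the same expression can be evaluated at the characters, at
    permuted characters and at the polynomials that represent them. *)
Inductive intexpr (n : nat) :=
  | Var of 'I_n & 'I_n
  | Cst of int
  | Add of intexpr n & intexpr n
  | Mul of intexpr n & intexpr n.

Arguments Var {n}.
Arguments Cst {n}.

Fixpoint eval (A : pzRingType) (n : nat) (v : 'I_n -> 'I_n -> A) (e : intexpr n) : A :=
  match e with
  | Var i a => v i a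
  | Cst z => z%:~R
  | Add e1 e2 => eval v e1 + eval v e2
  | Mul e1 e2 => eval v e1 * eval v e2
  end.

Lemma eval_morph (A B : pzRingType) (f : {rmorphism A -> B}) n (v : 'I_n -> 'I_n -> A) e :
  f (eval v e) = eval (fun i a => f (v i a)) e.
Proof.
by elim: e => [i a|z|e1 IH1 e2 IH2|e1 IH1 e2 IH2] /=;
  rewrite ?rmorph_int ?rmorphD ?rmorphM ?IH1 ?IH2.
Qed.

Lemma eq_eval (A : pzRingType) n (v w : 'I_n -> 'I_n -> A) e :
  (forall i a, v i a = w i a) -> eval v e = eval w e.
Proof.
by move=> vw; elim: e => [i a|z|e1 IH1 e2 IH2|e1 IH1 e2 IH2] /=; rewrite ?vw ?IH1 ?IH2.
Qed.

Lemma eval_sum (A : pzRingType) n (v : 'I_n -> 'I_n -> A) (I : Type) (r : seq I)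
    (F : I -> intexpr n) :
  eval v (\big[@Add n/Cst 0]_(k <- r) F k) = \sum_(k <- r) eval v (F k).
Proof. by apply: big_morph. Qed.

(** Rows and columns are renamed independently: composing permutations moves columns only,
    relabelling moves both. *)
Fixpoint rename_expr (n : nat) (f g : 'I_n -> 'I_n) (e : intexpr n) : intexpr n :=
  match e with
  | Var i a => Var (f i) (g a)
  | Cst z => Cst z
  | Add e1 e2 => Add (rename_expr f g e1) (rename_expr f g e2)
  | Mul e1 e2 => Mul (rename_expr f g e1) (rename_expr f g e2)
  end.

Lemma eval_rename (A : pzRingType) n (v : 'I_n -> 'I_n -> A) f g e :
  eval v (rename_expr f g e) = eval (fun i a => v (f i) (g a)) e.
Proof. by elim: e => [i a|z|e1 IH1 e2 IH2|e1 IH1 e2 IH2] //=; rewrite IH1 IH2. Qed.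

(* When the columns of v are all the characters of a fusion ring, these are the
   permutations of the columns induced by field automorphisms. *)
Definition galois_perm (A : pzRingType) (n : nat) (v : 'I_n -> 'I_n -> A)
    (s : {perm 'I_n}) :=
  forall e, eval v e = 0 -> eval (fun i a => v i (s a)) e = 0.

Lemma galois_perm_eq (A : pzRingType) n (v : 'I_n -> 'I_n -> A) s e1 e2 :
  galois_perm v s -> eval v e1 = eval v e2 ->
  eval (fun i a => v i (s a)) e1 = eval (fun i a => v i (s a)) e2.
Proof.
move=> gal_s eq12; have /= := gal_s (Add e1 (Mul (Cst (-1)) e2)).
by rewrite mulN1r eq12 subrr => /(_ erefl)/eqP; rewrite mulN1r subr_eq0 => /eqP.
Qed.

Lemma galois_permM (A : pzRingType) n (v : 'I_n -> 'I_n -> A) s t :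
  galois_perm v s -> galois_perm v t -> galois_perm v (t * s).
Proof.
move=> gal_s gal_t e e0; have := gal_s (rename_expr id t e).
rewrite !eval_rename => /(_ (gal_t _ e0)) <-.
by apply: eq_eval => i a; rewrite permM.
Qed.

(** * Galois-invariant expressions in the characters of a fusion ring *)

Section FusionCharacters.
Variables (C : numClosedFieldType) (n : nat) (M : 'I_n.+1 -> 'M[int]_n.+1).
Variable lam : 'I_n.+1 -> 'I_n.+1 -> C.

Definition fusion_character (A : pzRingType) (v : 'I_n.+1 -> A) :=
  v ord0 = 1 /\ forall i j, v i * v j = \sum_k (M i j k)%:~R * v k.

Hypothesis lam_char : forall a, fusion_character (lam^~ a).
Hypothesis lam_unit : (\matrix_(i, a) lam i a) \in unitmx.

(** Expand [v] over the columns with coefficients [c]. Since [v] and all columns are multiplicative,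
    the invertible matrix of characters kills the vector of the [c a * (lam i a - v i)], so [v]
    equals any column whose coefficient is nonzero. *)
Lemma fusion_character_column (v : 'I_n.+1 -> C) :
  fusion_character v -> exists a, forall i, v i = lam i a.
Proof.
move=> [v0 vM]; pose L := \matrix_(i, a) lam i a.
have [c Lc] : exists c : 'cV[C]_n.+1, L *m c = \col_i v i.
  by exists (invmx L *m \col_i v i); rewrite mulKVmx.
have cE i a : c a 0 * (lam i a - v i) = 0.
  pose w := \col_b (c b 0 * (lam i b - v i)).
  suffices w0 : w = 0 by have /matrixP/(_ a 0) := w0; rewrite !mxE.
  rewrite -[w](mulKmx lam_unit); apply/(canLR (mulKmx lam_unit)); rewrite mulmx0.
  apply/colP => j; rewrite !mxE.
  under eq_bigr => b _ do rewrite !mxE mulrBr mulrBr mulrCA [lam j b * lam i b]mulrC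
     (lam_char b).2 mulr_sumr mulrA.
  rewrite sumrB -mulr_suml exchange_big /=.
  have vE k : \sum_b lam k b * c b 0 = v k.
    have /colP/(_ k) := Lc; rewrite mxE [X in _ = X -> _]mxE => <-.
    by apply: eq_bigr => b _; rewrite [L _ _]mxE.
  rewrite vE [v j * _]mulrC vM; apply/eqP; rewrite subr_eq0; apply/eqP.
  apply: eq_bigr => k _; rewrite -vE mulr_sumr; apply: eq_bigr => b _.
  by rewrite mulrCA [c _ _ * _]mulrC.
have [a ca] : exists a, c a 0 != 0.
  apply/existsP; apply: contraT; rewrite negb_exists => /forallP c0.
  have : c = 0 by apply/colP => a; rewrite mxE; apply/eqP/negbNE.
  move=> c00; have /colP/(_ ord0) := Lc.
  by rewrite c00 mulmx0 !mxE v0 => /esym/eqP; rewrite oner_eq0.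
exists a => i; apply/esym/eqP; rewrite -subr_eq0.
by have /eqP := cE i a; rewrite mulf_eq0 (negPf ca).
Qed.

(** A character value is an eigenvalue of an integral fusion matrix, with the column of characters
    as eigenvector, and a characteristic polynomial is monic. *)
Lemma lam_integral i a : integralOver (intr : int -> C) (lam i a).
Proof.
exists (char_poly (M i)^T); first exact: char_poly_monic.
rewrite map_char_poly -eigenvalue_root_char; apply/eigenvalueP.
have [lam0 lamM] := lam_char a.
exists (\row_j lam j a); last first.
  by apply/eqP => /rowP/(_ ord0)/eqP; rewrite !mxE lam0 oner_eq0.
apply/rowP => j; rewrite !mxE lamM.
by apply: eq_bigr => k _; rewrite !mxE mulrC.
Qed.

Lemma eval_integral e : integralOver (intr : int -> C) (eval lam e).
Proof.
elim: e => [i a|z|e1 IH1 e2 IH2|e1 IH1 e2 IH2] /=.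
- exact: lam_integral.
- exact: integral_id.
- exact: integral_add.
- exact: integral_mul.
Qed.

(** Write each [lam i a] as a rational polynomial in a primitive element [z]. At another root [y] of
    the minimal polynomial of [z], these polynomials again form characters, so passing from [z] to
    [y] permutes the columns, and it preserves all integral relations. An invariant expression thus
    has the same value at all conjugates of [z]; it is rational, and being integral it is an
    integer. *)
Theorem galois_invariant_int e :
  (forall s, galois_perm lam s -> eval (fun i a => lam i (s a)) e = eval lam e) ->
  exists z : int, eval lam e = z%:~R.
Proof.
move=> inv_e.
suffices [r Dr] : exists r : rat, eval lam e = ratr r.
  have [z Dz] : exists z : int, r = z%:~R.
    by apply: (@rat_integral_int C); rewrite -Dr; apply: eval_integral.
  by exists z; rewrite Dr Dz ratr_int.
have alg_lam i a : algebraicOver (ratr : rat -> C) (lam i a).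
  have [p mon_p p0] := lam_integral i a.
  exists (map_poly intr p); first by rewrite monic_neq0 // monic_map.
  rewrite -map_poly_comp; rewrite (eq_map_poly (g := intr)) // => x /=.
  exact: ratr_int.
pose s := [seq lam ia.1 ia.2 | ia : 'I_n.+1 * 'I_n.+1].
have [|z alg_z [ps Ds]] := @rat_primitive_element C s.
  by move=> x /mapP[ia _ ->].
have [P DP] : exists P : 'I_n.+1 * 'I_n.+1 -> {poly rat},
    forall ia, lam ia.1 ia.2 = (map_poly ratr (P ia)).[z].
  apply: (@fin_all_exists _ (fun=> {poly rat})
            (fun ia p => lam ia.1 ia.2 = (map_poly ratr p).[z])) => ia.
  have : lam ia.1 ia.2 \in s by apply: map_f; rewrite mem_enum.
  by rewrite Ds => /mapP[p _ ->]; exists p.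
have [m irr_m m_dv] := rat_minpoly_exists alg_z.
pose E f := eval (fun i a => P (i, a)) f.
have evE y f : (map_poly (ratr : rat -> C) (E f)).[y] =
    eval (fun i a => (map_poly ratr (P (i, a))).[y]) f.
  exact: (eval_morph (horner_eval y \o map_poly (ratr : rat -> C))).
have evz f : (map_poly (ratr : rat -> C) (E f)).[z] = eval lam f.
  by rewrite evE; apply: eq_eval => i a; rewrite -DP.
have dvE f : eval lam f = 0 -> m %| E f by rewrite -m_dv /root evz => ->.
have root_ev (y : C) f : root (map_poly ratr m) y -> eval lam f = 0 ->
    eval (fun i a => (map_poly ratr (P (i, a))).[y]) f = 0.
  move=> my /dvE/dvdpP[q Dq]; have := evE y f.
  by rewrite Dq rmorphM hornerM (rootP my) mulr0 => <-.
have perm_of (y : C) : root (map_poly ratr m) y -> exists2 t : 'S_n.+1, galois_perm lam t &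
    forall i a, lam i (t a) = (map_poly ratr (P (i, a))).[y].
  move=> my; pose lam' i a := (map_poly (ratr : rat -> C) (P (i, a))).[y].
  have [f Df] : exists f : 'I_n.+1 -> 'I_n.+1, forall a, forall i, lam' i a = lam i (f a).
    apply: (@fin_all_exists _ (fun=> 'I_n.+1) (fun a b => forall i, lam' i a = lam i b)) => a.
    apply: fusion_character_column; split=> [|i j].
      have := root_ev y (Add (Var ord0 a) (Cst (-1))) my.
      rewrite /= (lam_char a).1 mulrN1z subrr => /(_ erefl)/eqP.
      by rewrite subr_eq0 => /eqP.
    pose F := \big[@Add _/Cst 0]_(k <- index_enum 'I_n.+1) (Mul (Cst (M i j k)) (Var k a)).
    have := root_ev y (Add (Mul (Var i a) (Var j a)) (Mul (Cst (-1)) F)) my.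
    rewrite /= !eval_sum /= (lam_char a).2 !mulrN1z !mulN1r subrr => /(_ erefl)/eqP.
    by rewrite subr_eq0 => /eqP.
  (* Distinct columns differ in some row. There the difference of the two polynomials is prime to
     [m], so it does not vanish at [y] either. *)
  have injf : injective f.
    move=> a b fab; apply/eqP/negbNE/negP => nab.
    have [i lamD] : exists i, lam i a != lam i b.
      apply/existsP; apply: contraT; rewrite negb_exists => /forallP eqab.
      have : (\matrix_(i, c) lam i c) *m (delta_mx a ord0 - delta_mx b ord0 : 'cV[C]_n.+1) = 0.
        rewrite mulmxBr -!colE; apply/colP => i; rewrite !mxE.
        by have /negbNE/eqP-> := eqab i; rewrite subrr.
      move/(canRL (mulKmx lam_unit)); rewrite mulmx0 => /colP/(_ a)/eqP.
      by rewrite !mxE !eqxx (negPf nab) subr0 oner_eq0.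
    have ndv : ~~ (m %| P (i, a) - P (i, b)).
      by rewrite -m_dv /root rmorphB hornerD hornerN -!(DP (i, _)) /= subr_eq0.
    have cop : coprimep (map_poly (ratr : rat -> C) m) (map_poly ratr (P (i, a) - P (i, b))).
      rewrite coprimep_map; apply: contraR ndv => ncop.
      by rewrite -(eqp_dvdl _ (irr_m.2 _ ncop (dvdp_gcdl _ _))) dvdp_gcdr.
    have := coprimep_root cop my; rewrite rmorphB hornerD hornerN.
    by rewrite -![(map_poly _ _).[y]]/(lam' _ _) !Df fab subrr eqxx.
  exists (perm injf) => [f' f'0|i a]; last by rewrite permE -Df.
  rewrite -(root_ev y f' my f'0); apply: eq_eval => i a.
  by rewrite permE -Df.
(* The remainder agrees with [E e] at the roots of [m] and has the smaller degree that
   [const_on_roots] requires. *)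
apply: (@const_on_roots _ m (E e %% m)) => // [|y my].
  by rewrite ltn_modp irredp_neq0.
have [t gal_t Dt] := perm_of y my.
rewrite -(inv_e _ gal_t) (eq_eval e Dt) -evE.
rewrite {2}(divp_eq (E e) m) rmorphD rmorphM hornerD hornerM (rootP my).
by rewrite mulr0 add0r.
Qed.

End FusionCharacters.

(** * Modular symbols *)

Lemma nat_of_int_ge1 (A : numDomainType) (x : A) (z : int) : 1 <= x -> x = z%:~R ->
  exists2 m : nat, (0 < m)%N & x = m%:R.
Proof.
move=> gx xz; rewrite xz in gx *; case: z gx {xz} => m; rewrite -?pmulrn.
  by rewrite ler1n => m0; exists m.
rewrite NegzE mulrNz -pmulrn => h.
have := lt_le_trans (lt_le_trans ltr01 h) (_ : - m.+1%:R <= 0).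
by rewrite oppr_le0 ler0n ltxx => /(_ isT).
Qed.

Section ModularSymbol.
Variables (C : numClosedFieldType) (n : nat).
Variables (hat : 'I_n.+1 -> 'I_n.+1) (N : 'I_n.+1 -> 'M[rat]_n.+1) (S T : 'M[C]_n.+1).
Hypothesis unitary_NST : unitary_modular_symbol hat N S T.

Local Notation st := (normalized_S S).
Local Notation d i := (st i ord0).
Local Notation D2 := (\sum_k st k ord0 ^+ 2).
Local Notation th i := (T i i).
Local Notation p := (Dplus S T).

Let symbol_NST : modular_symbol hat N S T := unitary_NST.1.
Let fusion_NS : modular_fusion_rule hat N st := ms_fusion symbol_NST.

Lemma Dtot_sqr : Dtot st ^+ 2 = D2.
Proof. by rewrite sqrtCK. Qed.

Lemma D2_gt0 : 0 < D2.
Proof. by rewrite -Dtot_sqr exprn_gt0 // (mfr_Dtot_gt0 fusion_NS). Qed.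

Lemma st_sym i j : st i j = st j i.
Proof.
have /matrixP/(_ j i) := mfr_sym fusion_NS; rewrite [LHS]mxE [LHS]mxE [RHS]mxE.
by apply: mulfI; rewrite invr_eq0 gt_eqF // (mfr_Dtot_gt0 fusion_NS).
Qed.

Lemma st0 i : st ord0 i = d i. Proof. exact: st_sym. Qed.

Lemma d0 : d ord0 = 1. Proof. exact: mfr_St00 fusion_NS. Qed.

Lemma dim_gt0 i : 0 < d i.
Proof.
rewrite lt0r (mfr_qdim_neq0 fusion_NS).
by case: (unitary_NST.2 i).
Qed.

Lemma dim_neq0 i : d i != 0. Proof. by rewrite gt_eqF ?dim_gt0. Qed.

Lemma dim_conj i : (d i)^* = d i.
Proof. by apply/CrealP; rewrite gtr0_real ?dim_gt0. Qed.

Lemma st_orth i j : \sum_k st i k * (st j k)^* = D2 * (i == j)%:R.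
Proof.
have /unitarymxP/matrixP/(_ i j) := mfr_unitary fusion_NS.
rewrite [LHS]mxE [RHS]mxE => <-.
have adjE (A : 'M[C]_n.+1) k : (A ^t* )%sesqui k j = (A j k)^* by rewrite !mxE.
have scE k l : ((Dtot st)^-1 *: st) k l = (Dtot st)^-1 * st k l by rewrite mxE.
have realD : (Dtot st)^* = Dtot st.
  by apply/CrealP; rewrite gtr0_real ?(mfr_Dtot_gt0 fusion_NS).
rewrite mulr_sumr; apply: eq_bigr => k _.
rewrite adjE !scE rmorphM fmorphV /=.
rewrite realD -Dtot_sqr; field.
exact: lt0r_neq0 (mfr_Dtot_gt0 fusion_NS).
Qed.

Lemma fusion_coef_nat : exists M : 'I_n.+1 -> 'I_n.+1 -> 'I_n.+1 -> nat,
  forall i j k, N i j k = (M i j k)%:R.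
Proof.
have coef (ijk : 'I_n.+1 * 'I_n.+1 * 'I_n.+1) :
    exists m : nat, N ijk.1.1 ijk.1.2 ijk.2 = m%:R.
  by have /natrP := ms_nat symbol_NST ijk.1.1 ijk.1.2 ijk.2.
have [M DM] := @fin_all_exists _ (fun=> nat) (fun ijk m => N ijk.1.1 ijk.1.2 ijk.2 = m%:R) coef.
by exists (fun i j k => M (i, j, k)) => i j k; rewrite -(DM (i, j, k)).
Qed.

Definition fusion_coef : 'I_n.+1 -> 'I_n.+1 -> 'I_n.+1 -> nat := sval (cid fusion_coef_nat).
Local Notation M := fusion_coef.

Lemma fusion_eq i j l : \sum_k (M i j k)%:R * st k l = st j l * (st i l / d l).
Proof.
have LambdaE k : Lambda st i k l = st i k / d k *+ (k == l).
  by rewrite mxE [X in X *+ _ = _]mxE st0.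
have fusionE k : fusion_mx C N i j k = ratr (N i j k) by rewrite mxE.
have /matrixP/(_ j l) := mfr_diag fusion_NS i.
rewrite [LHS]mxE [RHS]mxE [RHS](bigD1 l) //= [X in _ + X]big1 ?addr0 => [|k /negPf nkl]; last first.
  by rewrite LambdaE nkl mulr0.
rewrite LambdaE eqxx => <-; apply: eq_bigr => k _; rewrite fusionE.
by rewrite (svalP (cid fusion_coef_nat)) ratr_nat.
Qed.

(* At an index where |st k l| / d k is maximal, the triangle inequality in the
   fusion equation is a Perron-Frobenius bound. *)
Lemma st_bound i l : `|st i l| <= d i * d l.
Proof.
pose r k := `|st k l| / d k.
have r_real k : r k \is Num.real by rewrite ger0_real // divr_ge0 ?normr_ge0 ?ltW ?dim_gt0.
have [j max_j] : exists j, forall k, r k <= r j.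
  have [//||j _ max_j] := @real_arg_maxP C _ ord0 xpredT r.
    by move=> k _; apply: r_real.
  by exists j => k; apply: max_j.
have st_le k : `|st k l| <= r j * d k by rewrite -ler_pdivrMr ?dim_gt0 ?max_j.
have rj_gt0 : 0 < r j.
  by apply: lt_le_trans (max_j ord0); rewrite /r st0 divr_gt0 ?dim_gt0 // normr_gt0 dim_neq0.
have : `|st j l * (st i l / d l)| <= r j * (d j * d i).
  rewrite -fusion_eq; apply: le_trans (ler_norm_sum _ _ _) _.
  apply: le_trans (_ : \sum_k (M i j k)%:R * (r j * d k) <= _).
    by apply: ler_sum => k _; rewrite normrM normr_nat ler_wpM2l ?ler0n.
  under eq_bigr => k _ do rewrite mulrCA.
  by rewrite -mulr_sumr fusion_eq d0 divr1.
rewrite !normrM normfV (gtr0_norm (dim_gt0 l)).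
have -> : `|st j l| = r j * d j by rewrite /r divfK ?dim_neq0.
rewrite -mulrA (ler_pM2l rj_gt0) (ler_pM2l (dim_gt0 j)).
by rewrite ler_pdivrMr ?dim_gt0.
Qed.

(** Orthogonality gives row [i] the squared norm [D2], whereas [st_bound] bounds it by
    [d i ^+ 2 * D2]. *)
Lemma dim_ge1 i : 1 <= d i.
Proof.
have /eqP := st_orth i i; rewrite eqxx mulr1 => /eqP D2E.
have : D2 <= d i ^+ 2 * D2.
  rewrite -{1}D2E mulr_sumr; apply: ler_sum => k _.
  by rewrite -normCK -exprMn lerXn2r ?nnegrE ?mulr_ge0 ?normr_ge0 ?(ltW (dim_gt0 _)) ?st_bound.
rewrite -[leLHS]mul1r ler_pM2r ?D2_gt0 // -[leLHS](expr1n _ 2).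
by rewrite ler_pXn2r // nnegrE ?ler01 ?ltW ?dim_gt0.
Qed.

Lemma twist0 : th ord0 = 1. Proof. exact: ms_theta0 symbol_NST. Qed.

Lemma twist_norm i : `|th i| = 1. Proof. exact: (ms_theta_norm symbol_NST i). Qed.

Lemma twist_neq0 i : th i != 0.
Proof. by rewrite -normr_eq0 twist_norm oner_eq0. Qed.

(** Cancelling one factor [S] in [ms_ST3] leaves a formula for [T S T S T]; this is its entry at
    [i], [j], divided by the outer twists and by the square of the normalizing factor. *)
Lemma STS i j : \sum_k st i k * st j k * th k = p * st i j / (th i * th j).
Proof.
have s00 : S ord0 ord0 != 0.
  apply: contraTneq isT => s00; have := d0; rewrite mxE s00 invr0 mul0r.
  by move/eqP; rewrite eq_sym oner_eq0.
have uS : S \in unitmx.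
  exact: (unitarymx_unit (ms_unitary symbol_NST)).
have diagT : T = diag_mx (\row_k th k).
  apply/matrixP => k l; rewrite !mxE; have [->|nkl] := eqVneq k l; first by rewrite mulr1n.
  by have /is_diag_mxP-> := ms_diag symbol_NST.
have ST3 : T *m S *m T *m S *m T = (p * S ord0 ord0) *: S.
  have := ms_ST3 symbol_NST; rewrite exprS !expr2 -!mulmxE.
  rewrite scalemxAr => /(congr1 (mulmx (invmx S))).
  by rewrite !mulmxA !(mulVmx uS) !mul1mx => ->.
have [c [c_neq0 Dc SE]] : exists c : C, [/\ c != 0, c = S ord0 ord0 &
    forall k l, S k l = c * st k l].
  by exists (S ord0 ord0); split=> // k l; rewrite mxE mulVKf.
have mulT (A : 'M[C]_n.+1) k l : (T *m A) k l = th k * A k l.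
  by rewrite {1}diagT mul_diag_mx mxE mxE.
have mulTr (A : 'M[C]_n.+1) k l : (A *m T) k l = A k l * th l.
  by rewrite {1}diagT mul_mx_diag mxE mxE.
have /matrixP/(_ i j) := ST3; rewrite mulTr -!mulmxA mulT mulmxA [in LHS]mxE.
under eq_bigr => k _ do rewrite mulTr !SE.
rewrite [RHS]mxE (SE i j) -Dc => ST3ij; apply: (mulfI (expf_neq0 2 c_neq0)).
rewrite mulr_sumr.
have -> : c ^+ 2 * (p * st i j / (th i * th j)) =
   p * c * (c * st i j) / (th i * th j) by ring.
rewrite -ST3ij; apply: (canRL (mulfK _)); first by rewrite mulf_neq0 ?twist_neq0.
rewrite mulr_suml mulr_sumr mulr_suml; apply: eq_bigr => k _.
by rewrite (st_sym j k); ring.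
Qed.

Lemma st_parseval (v : 'I_n.+1 -> C) :
  \sum_j `|\sum_k st j k * v k| ^+ 2 = D2 * \sum_k `|v k| ^+ 2.
Proof.
transitivity (\sum_k \sum_l v k * (v l)^* * (D2 * (k == l)%:R)).
  under eq_bigr => j _ do rewrite normCK rmorph_sum mulr_suml.
  rewrite exchange_big; apply: eq_bigr => k _ /=.
  under eq_bigr => j _ do rewrite mulr_sumr.
  rewrite exchange_big; apply: eq_bigr => l _ /=.
  rewrite -st_orth mulr_sumr; apply: eq_bigr => j _.
  by rewrite rmorphM (st_sym j k) (st_sym j l) /=; ring.
rewrite mulr_sumr; apply: eq_bigr => k _; rewrite (bigD1 k) //= [X in _ + X]big1 ?addr0.
  by rewrite eqxx normCK mulr1; ring.
by move=> l /negPf nlk; rewrite eq_sym nlk !mulr0.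
Qed.

(** Row 0 of [STS] says that [st] maps the vector [d k * th k] to [p * d j / th j]. Both vectors
    have squared norm [D2] up to the factor [p], so Parseval determines the modulus of [p]. *)
Lemma Dplus_norm : `|p| ^+ 2 = D2.
Proof.
have sumE j : \sum_k st j k * (d k * th k) = p * d j / th j.
  have := STS ord0 j; rewrite twist0 mul1r (st0 j) => <-.
  by apply: eq_bigr => k _; rewrite st0 mulrA [_ * d k]mulrC.
have := st_parseval (fun k => d k * th k).
have D2E : \sum_k `|d k * th k| ^+ 2 = D2.
  apply: eq_bigr => k _.
  by rewrite normrM twist_norm mulr1 gtr0_norm ?dim_gt0.
rewrite D2E => parseval; apply: (mulIf (lt0r_neq0 D2_gt0)); rewrite -parseval.
rewrite -D2E mulr_sumr; apply: eq_bigr => j _.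
by rewrite sumE !normrM normfV !twist_norm invr1 !mulr1 exprMn.
Qed.

(** The Verlinde formula: [fusion_eq] expanded along row [k] by orthogonality. *)
Lemma fusion_coefE i j k :
  (M i j k)%:R * D2 = \sum_l st i l * st j l * (st k l)^* / d l.
Proof.
transitivity (\sum_l (\sum_m (M i j m)%:R * st m l) * (st k l)^*).
  under [RHS]eq_bigr => l _ do rewrite mulr_suml.
  rewrite exchange_big /= [RHS](bigD1 k) //= [X in _ + X]big1 => [|m /negPf nmk].
    rewrite addr0; under [RHS]eq_bigr => l _ do rewrite -mulrA.
    by rewrite -mulr_sumr st_orth eqxx mulr1.
  under eq_bigr => l _ do rewrite -mulrA.
  by rewrite -mulr_sumr st_orth nmk !mulr0.
by apply: eq_bigr => l _; rewrite fusion_eq; ring.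
Qed.

(** * Characters of a modular symbol and their Galois permutations *)

Definition lam i a : C := st i a / d a.

Lemma lam_unit : \matrix_(i, a) lam i a \in unitmx.
Proof.
have D2_neq0 := lt0r_neq0 D2_gt0.
pose L' : 'M[C]_n.+1 := \matrix_(a, j) (d a * (st j a)^* / D2).
suffices : \matrix_(i, a) lam i a *m L' = 1%:M by case/mulmx1_unit.
apply/matrixP => i j; rewrite [LHS]mxE [RHS]mxE -[RHS](mulKf D2_neq0) -st_orth.
rewrite mulr_sumr; apply: eq_bigr => k _; rewrite mxE [L' _ _]mxE /lam.
by field; rewrite D2_neq0 dim_neq0.
Qed.

Lemma lam_char a :
  fusion_character (fun i => \matrix_(j, k) (M i j k)%:Z) (lam^~ a).
Proof.
split=> [|i j]; first by rewrite /lam st0 divff ?dim_neq0.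
under eq_bigr => k _ do rewrite mxE /lam mulrA -pmulrn.
by rewrite -mulr_suml fusion_eq /lam; ring.
Qed.

Lemma lam_galois_int e :
  (forall s, galois_perm lam s -> eval (fun i a => lam i (s a)) e = eval lam e) ->
  exists z : int, eval lam e = z%:~R.
Proof. exact: galois_invariant_int lam_char lam_unit e. Qed.

(** The formal codegree of the character [a], with value [D2 / d a ^+ 2]. Complex conjugation cannot
    be written in an [intexpr]; the duality [hat] replaces it. *)
Definition dim_ratio_expr a : intexpr n.+1 :=
  \big[@Add _/Cst 0]_(k <- index_enum 'I_n.+1) (Mul (Var k a) (Var (hat k) a)).

Lemma eval_dim_ratio (f : 'I_n.+1 -> 'I_n.+1) a :
  eval (fun i b => lam i (f b)) (dim_ratio_expr a) = D2 / d (f a) ^+ 2.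
Proof.
rewrite eval_sum /=; have := st_orth (f a) (f a); rewrite eqxx mulr1 => <-; rewrite mulr_suml.
apply: eq_bigr => k _; rewrite /lam (st_sym (hat k)) (mfr_hat fusion_NS) (st_sym k).
by rewrite invfM; ring.
Qed.

(** The codegree of [i] times the square of [lam i ord0] is the codegree of 0. This is an integral
    relation, and its transport along [s] compares the two squares. *)
Lemma galois_perm_dim s i : galois_perm lam s -> st i (s ord0) ^+ 2 = d (s i) ^+ 2.
Proof.
move=> gal_s.
have /= := galois_perm_eq (e1 := Mul (Mul (Var i ord0) (Var i ord0)) (dim_ratio_expr i))
  (e2 := dim_ratio_expr ord0) gal_s.
rewrite !(eval_dim_ratio s) !(eval_dim_ratio id) /lam d0.
have -> : d i / 1 * (d i / 1) * (D2 / d i ^+ 2) = D2 / 1 ^+ 2.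
  by field; rewrite dim_neq0.
move/(_ erefl) => gal_dim; have D2_neq0 := lt0r_neq0 D2_gt0.
apply: (mulfI D2_neq0); have := congr1 (fun x => x * d (s ord0) ^+ 2 * d (s i) ^+ 2) gal_dim.
have -> : D2 / d (s ord0) ^+ 2 * d (s ord0) ^+ 2 * d (s i) ^+ 2 = D2 * d (s i) ^+ 2.
  by field; rewrite dim_neq0.
by move=> <-; field; rewrite !dim_neq0.
Qed.

(** Symmetry of [st] reads [lam i j * lam j ord0 = lam j i * lam i ord0]. After transport along [s]
    and squaring, the dimensions cancel by [galois_perm_dim]. *)
Lemma galois_perm_sqr s i j : galois_perm lam s -> st i (s j) ^+ 2 = st (s i) j ^+ 2.
Proof.
move=> gal_s.
have /= := galois_perm_eq (e1 := Mul (Var i j) (Var j ord0))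
  (e2 := Mul (Var j i) (Var i ord0)) gal_s.
rewrite /lam d0 !divr1 (st_sym j i) !divfK ?dim_neq0 // => /(_ erefl).
move=> /(congr1 (fun x => x ^+ 2)); rewrite !exprMn !exprVn !galois_perm_dim //.
move/(congr1 (fun x => x * d (s ord0) ^+ 2)).
have cancel_dims (x y z : C) : y != 0 -> z != 0 -> x * y^-1 * (y * z^-1) * z = x.
  by move=> y0 z0; field; rewrite y0 z0.
by rewrite !cancel_dims ?expf_neq0 ?dim_neq0 // (st_sym j).
Qed.

Hypothesis pointed : forall s, galois_perm lam s -> s ord0 = ord0.

Lemma pointed_dim_nat i : exists2 m : nat, (0 < m)%N & d i = m%:R.
Proof.
have [|z Ez] := lam_galois_int (e := Var i ord0); first by move=> s /pointed /= ->.
by apply: (nat_of_int_ge1 (z := z) (dim_ge1 i)); rewrite -Ez /= /lam d0 divr1.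
Qed.

Lemma pointed_dim_ratio i : exists m : nat, d i * d i * m%:R = D2.
Proof.
have dimE s : galois_perm lam s -> d (s i) ^+ 2 = d i ^+ 2.
  by move=> gal_s; rewrite -galois_perm_dim // pointed.
have [|z Ez] := lam_galois_int (e := dim_ratio_expr i).
  by move=> s gal_s; rewrite (eval_dim_ratio s) (eval_dim_ratio id) dimE.
have dd : 0 < d i ^+ 2 by rewrite exprn_gt0 ?dim_gt0.
rewrite (eval_dim_ratio id) in Ez; have [|m _ Em] := nat_of_int_ge1 _ Ez.
  rewrite ler_pdivlMr // mul1r (bigD1 i) //= lerDl; apply: sumr_ge0 => k _.
  by rewrite exprn_ge0 // ltW ?dim_gt0.
by exists m; rewrite -Em -expr2 mulrC divfK ?gt_eqF.
Qed.

End ModularSymbol.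

(** * Real S-matrices of rank 4: sign patterns and dimensions *)

Local Notation "x %:C" := (real_complex_def (Phant _) x) : ring_scope.

Lemma conj_realC (R : realType) (x : R) : (x%:C : R[i])^* = x%:C.
Proof. exact: conjc_real. Qed.

(* The matrix [1 a b c; a e f g; b f x y; c g y z], with twists t1, t2, t3, their
   inverses u1, u2, u3, and p the Gauss sum. *)
Record modular_data4 (R : realType) (a b c e f g x y z : R) (t1 t2 t3 u1 u2 u3 p : R[i]) : Prop := {
  ge1_a : 1 <= a; ge1_b : 1 <= b; ge1_c : 1 <= c;
  bd11 : `|e| <= a * a; bd12 : `|f| <= a * b; bd13 : `|g| <= a * c;
  bd22 : `|x| <= b * b; bd23 : `|y| <= b * c; bd33 : `|z| <= c * c;
  or01 : a + a * e + b * f + c * g = 0;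
  or02 : b + a * f + b * x + c * y = 0;
  or03 : c + a * g + b * y + c * z = 0;
  or12 : a * b + e * f + f * x + g * y = 0;
  or13 : a * c + e * g + f * y + g * z = 0;
  or23 : b * c + f * g + x * y + y * z = 0;
  or11 : a * a + e * e + f * f + g * g = 1 + a * a + b * b + c * c;
  or22 : b * b + f * f + x * x + y * y = 1 + a * a + b * b + c * c;
  or33 : c * c + g * g + y * y + z * z = 1 + a * a + b * b + c * c;
  tu1 : t1 * u1 = 1; tu2 : t2 * u2 = 1; tu3 : t3 * u3 = 1;
  cj1 : t1^* = u1; cj2 : t2^* = u2; cj3 : t3^* = u3;
  ppc : p * p^* = (1 + a * a + b * b + c * c)%:C;
  tw00 : 1 + (a * a)%:C * t1 + (b * b)%:C * t2 + (c * c)%:C * t3 = p;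
  tw01 : a%:C + (a * e)%:C * t1 + (b * f)%:C * t2 + (c * g)%:C * t3 = p * a%:C * u1;
  tw02 : b%:C + (a * f)%:C * t1 + (b * x)%:C * t2 + (c * y)%:C * t3 = p * b%:C * u2;
  tw03 : c%:C + (a * g)%:C * t1 + (b * y)%:C * t2 + (c * z)%:C * t3 = p * c%:C * u3;
  tw11 : (a * a)%:C + (e * e)%:C * t1 + (f * f)%:C * t2 + (g * g)%:C * t3
       = p * e%:C * (u1 * u1);
  tw12 : (a * b)%:C + (e * f)%:C * t1 + (f * x)%:C * t2 + (g * y)%:C * t3
       = p * f%:C * (u1 * u2);
  tw13 : (a * c)%:C + (e * g)%:C * t1 + (f * y)%:C * t2 + (g * z)%:C * t3
       = p * g%:C * (u1 * u3);
  tw22 : (b * b)%:C + (f * f)%:C * t1 + (x * x)%:C * t2 + (y * y)%:C * t3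
       = p * x%:C * (u2 * u2);
  tw23 : (b * c)%:C + (f * g)%:C * t1 + (x * y)%:C * t2 + (y * z)%:C * t3
       = p * y%:C * (u2 * u3);
  tw33 : (c * c)%:C + (g * g)%:C * t1 + (y * y)%:C * t2 + (z * z)%:C * t3
       = p * z%:C * (u3 * u3) }.

Lemma modular_data4_p_neq0 (R : realType) (a b c e f g x y z : R) t1 t2 t3 u1 u2 u3 p :
  modular_data4 a b c e f g x y z t1 t2 t3 u1 u2 u3 p -> p != 0.
Proof.
move=> D; apply/eqP => p0; have := ppc D; rewrite p0 mul0r => /esym/eqP.
rewrite fmorph_eq0 => /eqP; have := ge1_a D; nra.
Qed.

Lemma cj_u (R : realType) (t u : R[i]) : t^* = u -> u^* = t.
Proof. by move=> <-; rewrite conjCK. Qed.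

(** * Four-cycles *)

Section FourCycle.
Variables (R : realType) (a b c : R) (t1 t2 t3 u1 u2 u3 p : R[i]).
Hypothesis D : modular_data4 a b c (- b) c 1 (-1) (- a) b t1 t2 t3 u1 u2 u3 p.
Hypothesis rel : a + c = b * (a - c).

Local Notation Q := (a * c).
Local Notation E := (b * b + Q * Q).
Local Notation A := ((1 - b * b) * (b * b)+ (a * a - c * c) * b * Q).
Local Notation B := ((1 - b * b) * Q - (a * a - c * c) * b).
Local Notation rho := (t2 * (u1 * u3)).

(** The twist relations at (0, 2) and (1, 3) involve the twists only through [1 - t2] and [t1 - t3].
    [four_cycle_X] and [four_cycle_Y] solve this 2 by 2 linear system, whose determinant is [E] up
    to sign. *)
Lemma four_cycle_X : E%:C * (1 - t2) = p * u2 * ((b * b)%:C + Q%:C * rho).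
Proof.
have -> : E%:C * (1 - t2) = b%:C * (b%:C + (a * c)%:C * t1 + (b * -1)%:C * t2 + (c * - a)%:C * t3)
   + Q%:C * ((a * c)%:C + (- b * 1)%:C * t1 + (c * - a)%:C * t2 + (1 * b)%:C * t3) by ring.
rewrite (tw02 D) (tw13 D).
have -> : p * u2 * ((b * b)%:C + Q%:C * rho) =
   p * (b * b)%:C * u2 + p * Q%:C * (u1 * u3) * (t2 * u2) by ring.
by rewrite (tu2 D); ring.
Qed.

Lemma four_cycle_Y : E%:C * (t1 - t3) = p * u2 * b%:C * (Q%:C - rho).
Proof.
have -> : E%:C * (t1 - t3) = Q%:C * (b%:C + (a * c)%:C * t1 + (b * -1)%:C * t2 + (c * - a)%:C * t3)
   - b%:C * ((a * c)%:C + (- b * 1)%:C * t1 + (c * - a)%:C * t2 + (1 * b)%:C * t3) by ring.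
rewrite (tw02 D) (tw13 D).
have -> : p * u2 * b%:C * (Q%:C - rho) =
   p * b%:C * Q%:C * u2 - p * b%:C * (u1 * u3) * (t2 * u2) by ring.
by rewrite (tu2 D); ring.
Qed.

(** The difference of the relations at (0, 0) and (2, 2) is again a combination of [1 - t2] and
    [t1 - t3], for which the solved values are inserted. *)
Lemma four_cycle_key : A%:C + B%:C * rho = E%:C * (t2 + u2).
Proof.
have p0 := modular_data4_p_neq0 D.
have u20 : u2 != 0 by apply: contra_eq_neq (tu2 D) => ->; rewrite mulr0 eq_sym oner_eq0.
apply: (mulfI (mulf_neq0 p0 u20)).
have -> : p * u2 * (A%:C + B%:C * rho) = (1 - b * b)%:C * (p * u2 * ((b * b)%:C + Q%:C * rho))
   + (a * a - c * c)%:C * (p * u2 * b%:C * (Q%:C - rho)) by ring.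
rewrite -four_cycle_X -four_cycle_Y.
have -> : (1 - b * b)%:C * (E%:C * (1 - t2)) + (a * a - c * c)%:C * (E%:C * (t1 - t3)) =
  E%:C * ((1 + (a * a)%:C * t1 + (b * b)%:C * t2 + (c * c)%:C * t3) -
    ((b * b)%:C + (c * c)%:C * t1 + (-1 * -1)%:C * t2 + (- a * - a)%:C * t3)) by ring.
rewrite (tw00 D) (tw22 D).
have -> : p * u2 * (E%:C * (t2 + u2)) = E%:C * (p * (t2 * u2) + p * (u2 * u2)) by ring.
by rewrite (tu2 D); ring.
Qed.

Lemma four_cycle_lt : [/\ 0 < c, c < a & 1 < b].
Proof.
have [[ga gb] gc] := (ge1_a D, ge1_b D, ge1_c D).
have ac : c < a.
  by rewrite -subr_gt0 -(pmulr_rgt0 _ (lt_le_trans ltr01 gb)) -rel; lra.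
split=> //; first exact: lt_le_trans gc.
rewrite -subr_gt0 -(pmulr_lgt0 _ (_ : 0 < a - c)) ?subr_gt0 //.
by rewrite mulrBl -rel; lra.
Qed.

(* four_cycle_key writes a combination of 1 and rho with real coefficients as a real number,
   so rho is real. *)
Lemma four_cycle_rho : rho = 1 \/ rho = -1.
Proof.
have [c_gt0 lt_ca b_gt1] := four_cycle_lt.
have a_gt0 := lt_trans c_gt0 lt_ca.
have B_neq0 : B%:C != 0 :> R[i].
  rewrite fmorph_eq0 lt_eqF // subr_lt0; apply: lt_trans (_ : 0 < _).
    by rewrite pmulr_llt0 ?mulr_gt0 ?subr_lt0 //; nra.
  by rewrite mulr_gt0 ?subr_gt0 //; nra.
have rhoK : rho * (u2 * (t1 * t3)) = 1.
  have -> : rho * (u2 * (t1 * t3)) = (t1 * u1) * (t2 * u2) * (t3 * u3) by ring.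
  by rewrite (tu1 D) (tu2 D) (tu3 D) !mulr1.
have := congr1 (fun w => w^*) four_cycle_key.
rewrite !(rmorphD, rmorphM) /= !conj_realC.
rewrite (cj2 D) (cj_u (cj2 D)) (cj_u (cj1 D)) (cj_u (cj3 D)) -!(rmorphM, rmorphD) /=.
rewrite [u2 + t2]addrC -four_cycle_key => /addrI/(mulfI B_neq0) rhoE.
have /eqP : (rho - 1) * (rho + 1) = 0.
  have -> : (rho - 1) * (rho + 1) = rho * rho - 1 by ring.
  by rewrite -{1}rhoE mulrC rhoK subrr.
by rewrite mulf_eq0 subr_eq0 addr_eq0 => /orP[/eqP|/eqP]; [left|right].
Qed.

Hypothesis gal1 : Q = b * b -> - b = c * c.
Hypothesis gal2 : Q * (b * b - 1) = Q * Q + 3 * (b * b) ->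
  b * (a * a - c * c) = b * b + 3 * (Q * Q).

Lemma four_cycle_false : False.
Proof.
have [c_gt0 lt_ca b_gt1] := four_cycle_lt.
have a_gt0 := lt_trans c_gt0 lt_ca; have b_gt0 := lt_trans ltr01 b_gt1.
have Q_gt0 : 0 < Q by rewrite mulr_gt0.
have p0 := modular_data4_p_neq0 D.
have u20 : u2 != 0 by apply: contra_eq_neq (tu2 D) => ->; rewrite mulr0 eq_sym oner_eq0.
have conjX := congr1 (fun w => w^*) four_cycle_X.
have conjY := congr1 (fun w => w^*) four_cycle_Y.
rewrite !(rmorphD, rmorphN, rmorphM, rmorph1) /= !conj_realC (cj2 D) (cj_u (cj2 D))
  (cj_u (cj1 D)) (cj_u (cj3 D)) (cj1 D) (cj3 D) -!(rmorphM, rmorphD) /= in conjX conjY.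
have rhoV : u2 * (t1 * t3) = rho.
  have rhoK : rho * (u2 * (t1 * t3)) = 1.
    have -> : rho * (u2 * (t1 * t3)) = (t1 * u1) * (t2 * u2) * (t3 * u3) by ring.
    by rewrite (tu1 D) (tu2 D) (tu3 D) !mulr1.
  by case: four_cycle_rho => rho1; move: rhoK; rewrite rho1 ?mul1r // mulN1r => <-; ring.
rewrite rhoV in conjX conjY; have key := four_cycle_key.
have := four_cycle_X; have := four_cycle_Y.
case: four_cycle_rho => rho1; rewrite rho1 in conjX conjY key * => Yeq Xeq.
(* For [rho = 1], multiplying [four_cycle_X] by its conjugate removes [p], and [four_cycle_key]
   removes [t2 + u2]. *)
- have : (2 * (E * E) - E * (A + B))%:C = ((1 + a * a + b * b + c * c) * ((b * b + Q) * (b * b + Q)))%:C :> R[i].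
    rewrite [RHS]rmorphM /= -(ppc D).
    have -> : p * p^* * ((b * b + Q) * (b * b + Q))%:C =
       (p * u2 * ((b * b)%:C + Q%:C * 1)) * (p^* * t2 * ((b * b)%:C + Q%:C * 1)).
      rewrite -[LHS]mulr1 -[X in _ * X = _](tu2 D); ring.
    rewrite -Xeq -conjX.
    have -> : E%:C * (1 - t2) * (E%:C * (1 + - u2)) =
      E%:C * (2 * E%:C - (E%:C * (t2 + u2)) + E%:C * (t2 * u2 - 1)) by ring.
    by rewrite -key (tu2 D); ring.
  move/complexI => rel1.
  have h1 : a * (b - 1) = c * (b + 1) by have := rel; lra.
  have Ha : (b * b - 1) * (a * a) - Q * ((b + 1) * (b + 1)) = 0.
    have -> : (b * b - 1) * (a * a) = a * (b - 1) * (a * (b + 1)) by ring.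
    by rewrite h1; ring.
  have Hc : (b * b - 1) * (c * c) - Q * ((b - 1) * (b - 1)) = 0.
    have -> : (b * b - 1) * (c * c) = c * (b + 1) * (c * (b - 1)) by ring.
    by rewrite -h1; ring.
  (* Eliminating [a * a] and [c * c] through [Ha] and [Hc] turns [rel1] into a product whose second
     factor is positive. *)
  have QbE : Q * (b * b - 1) = Q * Q + 3 * (b * b).
    have : (Q * (b * b - 1) - (Q * Q + 3 * (b * b))) *
        (Q * (2 * Q * (b * b + 1) + (b * b - 1) * (b * b + 1))) = 0.
      transitivity ((b * b - 1) * (2 * (E * E) - E * (A + B) -
         (1 + a * a + b * b + c * c) * ((b * b + Q) * (b * b + Q)))
       + (E * (b * Q - b) + (b * b + Q) * (b * b + Q)) *
           ((b * b - 1) * (a * a) - Q * ((b + 1) * (b + 1)))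
       - (E * (b * Q - b) - (b * b + Q) * (b * b + Q)) *
           ((b * b - 1) * (c * c) - Q * ((b - 1) * (b - 1)))); first by ring.
      by rewrite Ha Hc rel1; ring.
    move/eqP; rewrite mulf_eq0 subr_eq0 => /orP[/eqP //|].
    have b2_gt1 : 0 < b * b - 1 by nra.
    by rewrite gt_eqF // mulr_gt0 // addr_gt0 // !mulr_gt0 // addr_gt0 // mulr_gt0.
  have rel2 := gal2 QbE.
  (* Multiplying the relation by its Galois transport gives an impossible identity: the left side
     already contains [10 * (Q * Q * (b * b))]. *)
  have : (Q * Q + 3 * (b * b)) * (b * b + 3 * (Q * Q)) = 4 * (Q * Q * (b * b)).
    rewrite -rel2 -QbE.
    transitivity (Q * b * ((b * b - 1) * (a * a) - Q * ((b + 1) * (b + 1))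
       - ((b * b - 1) * (c * c) - Q * ((b - 1) * (b - 1))) + 4 * b * Q)); first by ring.
    by rewrite Ha Hc; ring.
  have : 0 < Q * Q by rewrite mulr_gt0.
  have : 0 < b * b by rewrite mulr_gt0.
  by move: (Q * Q) (b * b) => q w; nra.
- have /gal1 : Q = b * b; last by nra.
  (* For [rho = -1] one has [u1 * u3 = - u2], so the left side of the conjugate of [four_cycle_Y] is
     [u2] times the original one. With [pt], adding the conjugate of [four_cycle_X] to [u2] times
     [four_cycle_X] gives [Q = b * b]. *)
  have pt : p^* * t2 = p * (u2 * u2).
    have Q1 : (Q + 1)%:C != 0 :> R[i] by rewrite fmorph_eq0 gt_eqF // addr_gt0.
    have bC : b%:C != 0 :> R[i] by rewrite fmorph_eq0 gt_eqF.
    apply: (mulfI (mulf_neq0 bC Q1)).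
    have -> : b%:C * (Q + 1)%:C * (p^* * t2) = p^* * t2 * b%:C * (Q%:C + - -1) by ring.
    rewrite -conjY.
    have -> : b%:C * (Q + 1)%:C * (p * (u2 * u2)) = (p * u2 * b%:C * (Q%:C - -1)) * u2 by ring.
    rewrite -Yeq.
    have uu : u1 * u3 = - u2.
      by rewrite -[LHS]mul1r -(tu2 D) [t2 * u2]mulrC -mulrA rho1 mulrN1.
    have -> : u1 - u3 = (u1 * u3) * (t3 - t1) + u1 * (1 - t3 * u3) - u3 * (1 - t1 * u1) by ring.
    by rewrite (tu3 D) (tu1 D) uu; ring.
  have : (b * b - Q)%:C = 0 :> R[i].
    have u2u2p : p * (u2 * u2) * 2 != 0 by rewrite !mulf_neq0 ?pnatr_eq0.
    apply: (mulfI u2u2p); rewrite mulr0.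
    have -> : p * (u2 * u2) * 2 * (b * b - Q)%:C =
       p * (u2 * u2) * ((b * b)%:C + Q%:C * -1) + (p * u2 * ((b * b)%:C + Q%:C * -1)) * u2 by ring.
    rewrite -pt -conjX -Xeq.
    have -> : E%:C * (1 + - u2) + E%:C * (1 - t2) * u2 = E%:C * (1 - t2 * u2) by ring.
    by rewrite (tu2 D) subrr mulr0.
  by move=> /eqP; rewrite fmorph_eq0 subr_eq0 => /eqP.
Qed.
End FourCycle.

Lemma sqr_eqP (R : idomainType) (x y : R) : x ^+ 2 = y ^+ 2 -> x = y \/ x = - y.
Proof. by move/eqP; rewrite eqf_sqr => /orP[/eqP|/eqP]; [left|right]. Qed.

Lemma sqr1_eqP (R : idomainType) (x : R) : x ^+ 2 = 1 -> x = 1 \/ x = -1.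
Proof. by rewrite -[X in _ = X](expr1n _ 2) => /sqr_eqP. Qed.

(** The last three premises are transports along the four-cycle of coincidences in column 0 or 1;
    they remove sign choices that orthogonality permits. The two outcomes are mirror images under
    exchanging labels 1 and 3. *)
Lemma four_cycle_signs (R : realType) (a b c e f g x y z : R) t1 t2 t3 u1 u2 u3 p :
  modular_data4 a b c e f g x y z t1 t2 t3 u1 u2 u3 p ->
  e ^+ 2 = b ^+ 2 -> f ^+ 2 = c ^+ 2 -> g ^+ 2 = 1 ->
  x ^+ 2 = 1 -> y ^+ 2 = a ^+ 2 -> z ^+ 2 = b ^+ 2 ->
  (a = 1 -> e = a) -> (a * a = e -> e * b = f * a) -> (a = c -> f = y) ->
  [/\ e = - b, f = c, g = 1, x = -1 & [/\ y = - a, z = b & a + c = b * (a - c)]] \/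
  [/\ z = - b, y = a, g = 1, x = -1 & [/\ f = - c, e = b & c + a = b * (c - a)]].
Proof.
move=> D /sqr_eqP He /sqr_eqP Hf /sqr1_eqP Hg /sqr1_eqP Hx /sqr_eqP Hy /sqr_eqP Hz G0 G1 G2.
have a_gt0 := lt_le_trans ltr01 (ge1_a D).
have b_gt0 := lt_le_trans ltr01 (ge1_b D).
have c_gt0 := lt_le_trans ltr01 (ge1_c D).
have ac_gt0 : 0 < a * c by rewrite mulr_gt0.
have ab_gt0 : 0 < a * b by rewrite mulr_gt0.
have bc_gt0 : 0 < b * c by rewrite mulr_gt0.
have o1 := or01 D; have o2 := or02 D; have o3 := or03 D; have o13 := or13 D.
have gb := ge1_b D; have ga := ge1_a D; have gc := ge1_c D.
case: Hx => Hx; subst x.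
- have [Ef Ey] : f = - c /\ y = - a.
    by case: Hf => Hf; case: Hy => Hy; subst f y; split=> //; nra.
  subst f y; have Eb : b = a * c by lra.
  case: Hg => Hg; subst g.
  + have [Ee Ez] : e = - b /\ z = - b by case: He => He; case: Hz => Hz; subst e z; split=> //; nra.
    subst e z; have b1 : b = 1 by nra.
    have a1 : a = 1 by nra.
    by have := G0 a1; lra.
  + have [Ee Ez] : e = b /\ z = b by case: He => He; case: Hz => Hz; subst e z; split=> //; nra.
    subst e z; have Eac : a = c by nra.
    by subst c b; have := G1 erefl; nra.
have [[Ef Ey]|[Ef Ey]] : f = c /\ y = - a \/ f = - c /\ y = a.
    by case: Hf => Hf; case: Hy => Hy; subst f y; try (by left); try (by right); nra.
- subst f y; have Ez : z = - e by case: Hg => Hg; subst g; nra.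
  subst z; case: Hg => Hg; subst g.
    case: He => He; subst e; first by nra.
    by left; split=> //; split=> //; lra.
  case: He => He; subst e; first by nra.
  have Eac : a = c by nra.
  by have := G2 Eac; lra.
subst f y; have Ez : z = - e by case: Hg => Hg; subst g; nra.
subst z; case: Hg => Hg; subst g.
  case: He => He; subst e; last by nra.
  by right; split=> //; split=> //; lra.
case: He => He; subst e; last by nra.
have Eac : a = c by nra.
by have := G2 Eac; lra.
Qed.

Lemma norm_realC (R : realType) (x : R) : `|x%:C : R[i]| = `|x|%:C.
Proof. by rewrite normc_def /= expr0n addr0 sqrtr_sqr. Qed.

Lemma norm_unit_cj (R : realType) (t u : R[i]) : t * u = 1 -> t^* = u -> `|t| = 1.
Proof.
move=> tu tc; apply/eqP; rewrite -(eqrXn2 (n := 2)) ?normr_ge0 ?ler01 //.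
by rewrite normCK tc tu expr1n.
Qed.

(** The four terms and their sum form a closed polygon, no side of which exceeds the sum of the
    others. *)
Lemma twist_sum_norm (R : realType) (x0 x1 x2 x3 d : R) (t1 t2 t3 : R[i]) :
  `|t1| = 1 -> `|t2| = 1 -> `|t3| = 1 ->
  `|x0%:C + x1%:C * t1 + x2%:C * t2 + x3%:C * t3| = d%:C ->
  [/\ d <= `|x0| + `|x1| + `|x2| + `|x3|, `|x1| <= d + `|x0| + `|x2| + `|x3|
    & `|x2| <= d + `|x0| + `|x1| + `|x3|].
Proof.
move=> n1 n2 n3 dE.
have nx (x : R) (t : R[i]) : `|t| = 1 -> `|x%:C * t| = `|x|%:C.
  by move=> nt; rewrite normrM nt mulr1 norm_realC.
have sum4_le (w0 w1 w2 w3 : R[i]) : `|w0 + w1 + w2 + w3| <= `|w0| + `|w1| + `|w2| + `|w3|.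
  by rewrite !(le_trans (ler_normD _ _)) // ?lerD2r ?(le_trans (ler_normD _ _)) ?lerD2r ?ler_normD.
split; rewrite -(@lecR R) !rmorphD /= -dE.
- by rewrite -norm_realC -(nx x1 t1) // -(nx x2 t2) // -(nx x3 t3) // sum4_le.
- set S := _ + x3%:C * t3; have := sum4_le S (- x0%:C) (- (x2%:C * t2)) (- (x3%:C * t3)).
  rewrite !normrN !nx // norm_realC -(nx x1 t1) //; apply: le_trans.
   by rewrite le_eqVlt; apply/orP; left; apply/eqP; congr (`|_|); rewrite /S; ring.
- set S := _ + x3%:C * t3; have := sum4_le S (- x0%:C) (- (x1%:C * t1)) (- (x3%:C * t3)).
  rewrite !normrN !nx // norm_realC -(nx x2 t2) //; apply: le_trans.
   by rewrite le_eqVlt; apply/orP; left; apply/eqP; congr (`|_|); rewrite /S; ring.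
Qed.

Lemma modular_data4_gauss_norm (R : realType) (a b c e f g x y z : R) t1 t2 t3 u1 u2 u3 p :
  modular_data4 a b c e f g x y z t1 t2 t3 u1 u2 u3 p ->
  exists d : R, [/\ 0 <= d, d * d = 1 + a * a + b * b + c * c & `|p| = d%:C].
Proof.
move=> D; set s := 1 + a * a + b * b + c * c.
have s_ge0 : 0 <= s by rewrite /s; nra.
exists (Num.sqrt s); split; first exact: sqrtr_ge0.
  by rewrite -expr2 sqr_sqrtr.
apply/eqP; rewrite -(eqrXn2 (n := 2)) ?normr_ge0 ?ler0c ?sqrtr_ge0 //.
by rewrite normCK (ppc D) -rmorphXn /= sqr_sqrtr.
Qed.

Lemma modular_data4_dims_bound (R : realType) (a b c e f g x y z : R) t1 t2 t3 u1 u2 u3 p :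
  modular_data4 a b c e f g x y z t1 t2 t3 u1 u2 u3 p ->
  exists d : R, [/\ 0 <= d, d * d = 1 + a * a + b * b + c * c,
    a * a <= d + 1 + b * b + c * c & b * b <= d + 1 + a * a + c * c].
Proof.
move=> D; have [d [d_ge0 dd pd]] := modular_data4_gauss_norm D.
exists d; split=> //.
  all: have := @twist_sum_norm R 1 (a * a) (b * b) (c * c) d t1 t2 t3.
  all: rewrite (norm_unit_cj (tu1 D) (cj1 D)) (norm_unit_cj (tu2 D) (cj2 D)).
  all: rewrite (norm_unit_cj (tu3 D) (cj3 D)) (tw00 D) pd !ger0_norm ?ler01 -?expr2 ?sqr_ge0 //.
  all: by case=> // _.
Qed.

(** * Three-cycles *)

Lemma three_cycle_signs (R : realType) (a b c e f g x y z : R) t1 t2 t3 u1 u2 u3 p :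
  modular_data4 a b c e f g x y z t1 t2 t3 u1 u2 u3 p ->
  e ^+ 2 = b ^+ 2 -> f ^+ 2 = 1 -> g ^+ 2 = c ^+ 2 ->
  x ^+ 2 = a ^+ 2 -> y ^+ 2 = c ^+ 2 ->
  (a = 1 -> e = a) -> (b = 1 -> f = a) -> (a = b -> e = f) ->
  [/\ e = - b, f = -1, g = c, x = a & [/\ y = - c, z = b - a - 1 & c * c = a * b + b - a]] \/
  [/\ e = b, f = -1, g = - c, x = - a & [/\ y = c, z = a - b - 1 & c * c = a * b + a - b]].
Proof.
move=> D /sqr_eqP He /sqr1_eqP Hf /sqr_eqP Hg /sqr_eqP Hx /sqr_eqP Hy Ga Gb Gab.
have ga := ge1_a D; have gb := ge1_b D; have gc := ge1_c D.
have a_gt0 : 0 < a by lra.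
have b_gt0 : 0 < b by lra.
have c_gt0 : 0 < c by lra.
have ab_gt0 : 0 < a * b by rewrite mulr_gt0.
have cc_gt0 : 0 < c * c by rewrite mulr_gt0.
have cc_ge1 : 1 <= c * c by rewrite -[leLHS]mulr1 ler_pM.
have ab1 : 0 <= (a - 1) * (b - 1) by rewrite mulr_ge0 ?subr_ge0.
have o1 := or01 D; have o2 := or02 D; have o3 := or03 D; have o12 := or12 D.
clear D; case: Hf => Hf; subst f.
- exfalso.
  case: He => He; case: Hg => Hg; case: Hx => Hx; case: Hy => Hy; subst e g x y;
    rewrite ?(mulrN, mulNr, mulr1, mul1r) ?[b * a]mulrC in o1 o2 o12; try lra.
  (* For [f = 1] the remaining sign choice has [c * c = a + b - a * b]; since [c * c >= 1], one of
     [a], [b] is 1, which the Galois transports [Ga] and [Gb] forbid. *)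
  have /eqP : (a - 1) * (b - 1) = 0 by lra.
  rewrite mulf_eq0 !subr_eq0 => /orP[/eqP/Ga|/eqP/Gb]; lra.
have le_a : a <= a * b by rewrite ler_peMr // ltW.
have le_b : b <= a * b by rewrite ler_peMl // ltW.
have zE : c * (z - (b - a - 1)) = 0 -> z = b - a - 1.
  by move/eqP; rewrite mulf_eq0 gt_eqF //= subr_eq0 => /eqP.
have zE' : c * (z - (a - b - 1)) = 0 -> z = a - b - 1.
  by move/eqP; rewrite mulf_eq0 gt_eqF //= subr_eq0 => /eqP.
case: He => He; case: Hx => Hx; case: Hg => Hg; case: Hy => Hy; subst e g x y;
  rewrite ?(mulrN, mulNr, mulr1, mul1r, opprK) ?[b * a]mulrC in o1 o2 o12; try (exfalso; lra).
- by right; split=> //; split=> //; [apply: zE'|]; lra.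
- by left; split=> //; split=> //; [apply: zE|]; lra.
Qed.

(** The bound on [b * b] forces [d >= 4 * (r * c)], while [d * d] is at most four times the square
    of [r * c]. *)
Lemma three_cycle_pos_false (R : realType) (a b c d r : R) :
  1 <= a -> 1 <= c -> 1 <= r -> b = a + 1 + r * c -> 0 <= d ->
  d * d = (3 + r * r) * (c * c) -> b * b <= d + 1 + a * a + c * c -> False.
Proof.
move=> ga gc gr -> d_ge0 dd bnd; set m := r * c in bnd.
have cm : c <= m by rewrite /m ler_peMl //; lra.
have dm : 4 * m <= d.
  have : m <= a * m by rewrite ler_peMl //; lra.
  have : c * c <= m * m by rewrite ler_pM //; lra.
  have : (a + 1 + m) * (a + 1 + m) = a * a + 2 * a + 1 + 2 * (a * m) + 2 * m + m * m by ring.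
  by move: bnd; move: (a * m) (m * m) (c * c) (a * a) => *; lra.
have : d * d = 3 * (c * c) + m * m by rewrite dd /m; ring.
have : (4 * m) * (4 * m) <= d * d by rewrite ler_pM //; lra.
have : c * c <= m * m by rewrite ler_pM //; lra.
have : 0 < m * m by rewrite mulr_gt0; lra.
have -> : (4 * m) * (4 * m) = 16 * (m * m) by ring.
by move: (m * m) (c * c) (d * d) => *; lra.
Qed.

Lemma three_cycle_neg_false (R : realType) (a b c d : R) (s n : nat) :
  1 <= b -> 1 <= c -> (0 < s)%N -> a = b - 1 + s%:R * c -> a != 1 -> 0 <= d ->
  c * c = a * b + b - a -> (n * (3 + s * s) + s * s * s)%:R * (a * b) = c * c * c ->
  d * d = (3 + s%:R * s%:R) * (c * c) -> a * a <= d + 1 + b * b + c * c -> False.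
Proof.
move=> gb gc s_gt0 aE a1 d_ge0 ccE CE dd bnd.
have s1 : 1 <= s%:R :> R by rewrite ler1n.
have c_gt0 : 0 < c by lra.
have sc1 : 1 <= s%:R * c by rewrite -[leLHS]mulr1 ler_pM.
have abE : a * b = c * c - 1 + s%:R * c by rewrite ccE aE; ring.
have bc : b <= c.
  have h : 0 <= (b - 1) * (s%:R * c - 1) by rewrite mulr_ge0 ?subr_ge0.
  have : b * b <= c * c.
    have -> : c * c = b * b + (b - 1) * (s%:R * c - 1) by rewrite ccE aE; ring.
    by rewrite lerDl.
  by rewrite -!expr2 ler_pXn2r // nnegrE; lra.
(* Since [a * b >= c * c], the integer factor in [CE] bounds [c] from below. It is [4 * n + 1] for
   [s = 1] and at least 8 for [s >= 2], which is too large for the bound on [a * a] apart from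
   [s = 1], [n = 0]. *)
have Cc : (n * (3 + s * s) + s * s * s)%:R <= c.
  have : (n * (3 + s * s) + s * s * s)%:R * (c * c) <= c * (c * c).
    rewrite [leRHS]mulrA -CE ler_wpM2l ?ler0n // abE; lra.
  by rewrite ler_pM2r // mulr_gt0.
have bnd' : 2 * ((b - 1) * (s%:R * c)) + (s%:R * s%:R - 1) * (c * c) <= d + 2 * b.
  move: bnd; rewrite aE => bnd.
  have : (b - 1 + s%:R * c) * (b - 1 + s%:R * c) - b * b - c * c - 1 =
    2 * ((b - 1) * (s%:R * c)) + (s%:R * s%:R - 1) * (c * c) - 2 * b by ring.
  lra.
have [s_le1|s_gt1] := leqP s 1.
  have Es : s = 1%N by apply/eqP; rewrite eqn_leq s_le1.
  subst s; rewrite ?mul1r ?mulr1 subrr mul0r addr0 in aE bnd' abE dd.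
  have dE : d = 2 * c.
    apply/eqP; rewrite -(eqrXn2 (n := 2)) //; last by lra.
    by rewrite !expr2 dd; apply/eqP; ring.
  have b2 : (b - 2) * c <= b by move: bnd'; rewrite dE; lra.
  case: n Cc CE => [|n] Cc CE.
    (* For [n = 0], [CE] is a cubic in [c] alone whose only positive root is 1; it forces
       [a = 1]. *)
    have : (c - 1) * (c - 1) * (c + 1) = 0.
      have -> : (c - 1) * (c - 1) * (c + 1) = c * c * c - (c * c - 1 + c) by ring.
      by rewrite -abE -CE; ring.
    move/eqP; rewrite !mulf_eq0 orbb subr_eq0 => /orP[/eqP c1|]; last by rewrite gt_eqF; lra.
    by move: a1; rewrite aE c1; apply/negP/negPn/eqP; lra.
  have c5 : 5 <= c.
    by apply: le_trans Cc; rewrite ler_nat; clear; lia.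
  have b52 : b <= 5 / 2.
    have [b_le2|b_gt2] := leP b 2; first by lra.
    have : (b - 2) * 5 <= (b - 2) * c by rewrite ler_wpM2l //; lra.
    lra.
  have : (c - 5) * (c - 5) >= 0 by rewrite -expr2 sqr_ge0.
  have : c * c = b * b - b + 1 + (b - 1) * c by rewrite ccE aE; ring.
  have : (b - 1) * c <= 3 / 2 * c by rewrite ler_wpM2r; lra.
  have : (b - 1) * b <= 3 / 2 * (5 / 2) by rewrite ler_pM; lra.
  lra.
have s2 : 2 <= s%:R :> R by rewrite ler_nat.
have c8 : 8 <= c by apply: le_trans Cc; rewrite ler_nat; clear - s_gt1; nia.
have dlt : d <= (s%:R + 1) * c.
  rewrite -(@ler_pXn2r _ 2) ?nnegrE ?mulr_ge0 //; try lra.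
  have -> : ((s%:R + 1) * c) ^+ 2 = (s%:R * s%:R + 2 * s%:R + 1) * (c * c) by ring.
  by rewrite expr2 dd ler_wpM2r ?mulr_ge0 //; lra.
have h0 : 0 <= (b - 1) * (s%:R * c) by rewrite mulr_ge0; lra.
have : (s%:R * s%:R - 1) * c <= s%:R + 3.
  rewrite -(ler_pM2r c_gt0) -mulrA; apply: (le_trans (y := d + 2 * b)); first by lra.
  by rewrite mulrDl; move: dlt; rewrite mulrDl; lra.
have : 2 * s%:R <= s%:R * s%:R :> R by rewrite ler_wpM2r ?ler0n.
have : (s%:R * s%:R - 1) * 8 <= (s%:R * s%:R - 1) * c.
  rewrite ler_wpM2l // subr_ge0 -[leLHS]mulr1 ler_pM //.
lra.
Qed.

Lemma three_cycle_zero (R : realType) (a b c : R) (n1 n3 : nat) :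
  1 <= a -> 1 <= c -> b = a + 1 -> c * c = a * b + b - a ->
  (3 * n3)%:R * (a * b) = c * c * c ->
  (3 * n1)%:R * (a * b) = a * a * b - b * b - a ->
  c = a * a - 1 /\ a ^+ 3 - 3 * a - 1 = 0.
Proof.
move=> ga gc bE ccE N3 N1.
have a_gt0 : 0 < a by lra.
have ab_gt0 : 0 < a * b by rewrite mulr_gt0 // bE; lra.
have : (n3 * n3)%:R = (n1 * n1 + n1 + 1)%:R :> R.
  have h : 9 * ((a * b) * (a * b)) != 0 by rewrite !mulf_neq0 ?pnatr_eq0 ?gt_eqF // bE; lra.
  apply: (mulfI h).
  have -> : 9 * (a * b * (a * b)) * (n3 * n3)%:R = ((3 * n3)%:R * (a * b)) * ((3 * n3)%:R * (a * b)).
    by rewrite !natrM; ring.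
  have -> : 9 * (a * b * (a * b)) * (n1 * n1 + n1 + 1)%:R =
     ((3 * n1)%:R * (a * b)) * ((3 * n1)%:R * (a * b)) + 3 * (a * b) * ((3 * n1)%:R * (a * b))
      + 9 * (a * b) * (a * b) by rewrite !natrD !natrM; ring.
  rewrite N1 N3.
  have -> : c * c * c * (c * c * c) = (c * c) * (c * c) * (c * c) by ring.
  by rewrite ccE bE; ring.
move/eqP; rewrite eqr_nat => /eqP n13.
(* Otherwise [n3 * n3] would lie strictly between the squares of [n1] and [n1 + 1]. With [n1 = 0],
   [N1] becomes the cubic equation for [a]. *)
have n10 : n1 = 0%N.
  by have [h|h] := leqP n3 n1; have := leq_mul h h; lia.
move: N1; rewrite n10 muln0 mul0r bE => a3.
have a30 : a ^+ 3 - 3 * a - 1 = 0 by rewrite !exprS expr0; lra.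
split=> //; have a2_gt1 : 0 <= a * a - 1.
  have : 0 < a * a by rewrite mulr_gt0.
  have : 0 <= (a - 1) * (a + 1) by rewrite mulr_ge0; lra.
  lra.
apply/eqP; rewrite -(eqrXn2 (n := 2)) //; last by lra.
apply/eqP; have -> : (a * a - 1) ^+ 2 = c * c + a * (a ^+ 3 - 3 * a - 1) by rewrite ccE bE; ring.
by rewrite a30 mulr0 addr0 expr2.
Qed.

(* With z = r c the sum of squares is (3 + r^2) c^2.  The triangle inequality in tw00, with
   the integrality of n3 = N_(3,3)^3 when r < 0, excludes r <> 0; for r = 0, n3 and
   n1 = N_(3,3)^1 satisfy n3^2 = n1^2 + n1 + 1, whence n1 = 0. *)
Lemma three_cycle_core (R : realType) (a b c z : R) t1 t2 t3 u1 u2 u3 p (r : int) (n1 n3 : nat) :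
  modular_data4 a b c (- b) (-1) c a (- c) z t1 t2 t3 u1 u2 u3 p ->
  z = b - a - 1 -> c * c = a * b + b - a -> z = r%:~R * c -> a != 1 ->
  n1%:R * (1 + a * a + b * b + c * c) = c * c * a - c * c * b / a - c * c / b + z * z ->
  n3%:R * (1 + a * a + b * b + c * c) = c * c * c + c * c * c / a - c * c * c / b + z * z * z / c ->
  [/\ z = 0, b = a + 1, c = a * a - 1 & a ^+ 3 - 3 * a - 1 = 0].
Proof.
move=> D zE ccE zr a1 N1 N3.
have ga := ge1_a D; have gb := ge1_b D; have gc := ge1_c D.
have a_neq0 : a != 0 by rewrite gt_eqF; lra.
have b_neq0 : b != 0 by rewrite gt_eqF; lra.
have c_neq0 : c != 0 by rewrite gt_eqF; lra.
have [d [d_ge0 dd bnd_a bnd_b]] := modular_data4_dims_bound D.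
have D2E : 1 + a * a + b * b + c * c = (3 + r%:~R * r%:~R) * (c * c).
  by rewrite -(or33 D) zr; ring.
rewrite {}D2E {D} in N1 N3 dd.
have c3 : n3%:R * (3 + r%:~R * r%:~R) * (a * b) = c * c * c + r%:~R * r%:~R * r%:~R * (a * b).
  apply: (mulfI (mulf_neq0 c_neq0 c_neq0)).
  have -> : c * c * (n3%:R * (3 + r%:~R * r%:~R) * (a * b)) =
    n3%:R * ((3 + r%:~R * r%:~R) * (c * c)) * (a * b) by ring.
  rewrite N3 zr -[X in _ = c * c * (X + _)](mulfK (mulf_neq0 c_neq0 c_neq0)).
  have -> : c * c * c * (c * c) = c * c * c * (a * b + b - a) by rewrite ccE.
  by field; rewrite a_neq0 b_neq0 ?c_neq0.
case: (ltrgtP r 0) => [r_lt0|r_gt0|r0]; last first.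
- rewrite r0 mul0r in zr; rewrite r0 !(mul0r, addr0) in c3 N1.
  have bE : b = a + 1 by lra.
  have [cE a3] : c = a * a - 1 /\ a ^+ 3 - 3 * a - 1 = 0.
    apply: (@three_cycle_zero R a b c n1 n3) => //; first by rewrite natrM -c3; ring.
    apply: (mulfI (mulf_neq0 c_neq0 c_neq0)).
    have -> : c * c * ((3 * n1)%:R * (a * b)) = n1%:R * (3 * (c * c)) * (a * b).
      by rewrite natrM; ring.
    by rewrite N1 zr; field; rewrite a_neq0 b_neq0.
  by split.
- exfalso; apply: (@three_cycle_pos_false R a b c d r%:~R) => //.
    by rewrite -[1]/(1%:~R) ler_int.
  by rewrite -zr zE; ring.
- exfalso; have [s Es] : exists s : nat, r = - s%:Z.
    by exists `|r|%N; rewrite ltz0_abs ?opprK.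
  have rs : r%:~R = - s%:R :> R by rewrite Es rmorphN.
  apply: (@three_cycle_neg_false R a b c d s n3) => //.
  + by rewrite lt0n; apply: contraTneq r_lt0 => s0; rewrite Es s0.
  + have -> : s%:R * c = - z by rewrite zr rs; ring.
    by rewrite zE; ring.
  + rewrite natrD !natrM natrD natrM mulrDl.
    move: c3; rewrite rs => c3.
    have -> : 3%:R + s%:R * s%:R = 3 + - s%:R * - s%:R :> R by ring.
    by rewrite c3; ring.
  + by rewrite dd rs; ring.
Qed.

(** * Transpositions *)

Lemma transposition_signs (R : realType) (a b c e f g x y z : R) t1 t2 t3 u1 u2 u3 p :
  modular_data4 a b c e f g x y z t1 t2 t3 u1 u2 u3 p ->
  e ^+ 2 = 1 -> f ^+ 2 = b ^+ 2 -> g ^+ 2 = c ^+ 2 ->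
  (b = c -> f = g) -> (y = b * c -> a * y = c * f) -> (a * y = c * f -> y = b * c) ->
  [/\ e = 1, f = b, g = - c, x = - (1 + a) & [/\ y = 0, z = a - 1 & c * c = b * b + 2 * a]] \/
  [/\ e = 1, f = - b, g = c, z = - (1 + a) & [/\ y = 0, x = a - 1 & b * b = c * c + 2 * a]].
Proof.
move=> D /sqr1_eqP He /sqr_eqP Hf /sqr_eqP Hg G1 G2 G3.
have ga := ge1_a D; have gb := ge1_b D; have gc := ge1_c D.
have a_gt0 : 0 < a by lra.
have b_gt0 : 0 < b by lra.
have c_gt0 : 0 < c by lra.
have bb_gt0 : 0 < b * b by rewrite mulr_gt0.
have cc_gt0 : 0 < c * c by rewrite mulr_gt0.
have bc_gt0 : 0 < b * c by rewrite mulr_gt0.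
have o1 := or01 D; have o2 := or02 D; have o3 := or03 D; have o12 := or12 D.
have o13 := or13 D; have o23 := or23 D; clear D.
have cancelb (w v : R) : b * w = b * v -> w = v by move/(mulfI (lt0r_neq0 b_gt0)).
have cancelc (w v : R) : c * w = c * v -> w = v by move/(mulfI (lt0r_neq0 c_gt0)).
case: He => He; subst e; last first.
  have /eqP : b ^+ 2 = c ^+ 2.
    by rewrite !expr2; case: Hf => Hf; case: Hg => Hg; subst f g;
       rewrite ?(mulrN, mulNr, mulr1) in o1; lra.
  rewrite eqrXn2 // ?ltW // => /eqP bc; have := G1 bc.
  by case: Hf => Hf; case: Hg => Hg; subst f g; subst c => h;
     rewrite ?(mulrN, mulNr, mulr1) in o1; lra.
case: Hf => Hf; case: Hg => Hg; subst f g; rewrite ?(mulrN, mulNr, mulr1, mul1r, opprK) in o1 o2 o3 o12 o13 o23 *.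
- by exfalso; lra.
- have y0 : y = 0 by apply: cancelc; lra.
  subst y; left; split=> //.
    by apply: cancelb; rewrite mulrN mulrDr mulr1 mulr0 [b * a]mulrC in o2 *; lra.
  split=> //; last by lra.
  by apply: cancelc; rewrite mulrBr mulr1 mulr0 [c * a]mulrC in o3 *; lra.
- have y0 : y = 0 by apply: cancelb; lra.
  subst y; right; split=> //.
    by apply: cancelc; rewrite mulrN mulrDr mulr1 mulr0 [c * a]mulrC in o3 *; lra.
  split=> //; last by lra.
  by apply: cancelb; rewrite mulrBr mulr1 mulr0 [b * a]mulrC in o2 *; lra.
exfalso.
(* For [f = - b] and [g = - c], orthogonality leaves [y = b * c] or [a * y = - (b * c)]. By [G2] and
   [G3] the transposition makes each of them imply the other, so both hold, and their signs
   disagree. *)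
have : (b * c - y) * (b * c + a * y) = 0.
  have -> : (b * c - y) * (b * c + a * y) =
    (b * c * (b * c + b * c + x * y + y * z)) / 2 - y * (b * y + c * z - (a * c - c)) * b / 2
     - y * (b * x + c * y - (a * b - b)) * c / 2
     - y * y * (2 * a - b * b - c * c) / 2 by field.
  rewrite [b * c + b * c + _ + _](_ : _ = 0); last by lra.
  rewrite [b * y + c * z - _](_ : _ = 0); last by lra.
  rewrite [b * x + c * y - _](_ : _ = 0); last by lra.
  by rewrite [2 * a - _ - _](_ : _ = 0); [ring | lra].
move/eqP; rewrite mulf_eq0 subr_eq0 => /orP[/eqP yE|/eqP yE].
  have := G2 (esym yE); rewrite -yE.
  have : 0 < a * (b * c) by rewrite mulr_gt0.
  have : 0 < c * b by rewrite mulr_gt0.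
  lra.
have yE' : a * y = - (c * b) by rewrite [c * b]mulrC; lra.
have yE2 := G3 (etrans yE' (esym (mulrN c b))).
have : 0 < a * (b * c) by rewrite mulr_gt0.
have : 0 < c * b by rewrite mulr_gt0.
by rewrite -yE2; lra.
Qed.

Lemma int_multiple_ge (R : realType) (m : int) (x y : R) :
  0 < x -> 0 <= y -> y != 0 -> y = m%:~R * x -> x <= y.
Proof.
move=> x_gt0 y_ge0 y_neq0 yE.
have m_gt0 : 0 < m.
  by rewrite -(ltr_int R) -(pmulr_lgt0 _ x_gt0) -yE lt0r y_neq0.
by rewrite yE ler_peMl ?(ltW x_gt0) // -[1]/(1%:~R) ler_int.
Qed.

(* Put x2 = t2 + 1/t2 and x3 = t3 + 1/t3.  For a <> 1 the twist relations give
   m2^2 (1 - x2) = 2, m3^2 (1 - x3) = 2 and x2^2 + x2 x3 + x3^2 = 3, so that x2 and x3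
   lie in [-1, 1) and are both -1. *)
Lemma transposition_false (R : realType) (a b c : R) t1 t2 t3 u1 u2 u3 p (m2 m3 : int) :
  modular_data4 a b c 1 b (- c) (- (1 + a)) 0 (a - 1) t1 t2 t3 u1 u2 u3 p ->
  c * c = b * b + 2 * a -> 1 + a = m2%:~R * b -> a - 1 = m3%:~R * c -> False.
Proof.
move=> D ccE m2E m3E.
have ga := ge1_a D; have gb := ge1_b D; have gc := ge1_c D.
have [a_gt0 b_gt0 c_gt0] : [/\ 0 < a, 0 < b & 0 < c] by split; lra.
have p0 := modular_data4_p_neq0 D.
have C0 (x : R) : 0 < x -> x%:C != 0 :> R[i] by move=> x0; rewrite fmorph_eq0 gt_eqF.
(* The entry [y = 0] annihilates the right side of the relation at (2, 3), and its left side is a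
   multiple of [1 - t1]. *)
have t1E : t1 = 1.
  have /eqP : (b * c)%:C * (1 - t1) = 0.
    transitivity ((b * c)%:C + (b * - c)%:C * t1 + (- (1 + a) * 0)%:C * t2 + (0 * (a - 1))%:C * t3).
      by ring.
    by rewrite (tw23 D); ring.
  by rewrite mulf_eq0 (negPf (C0 _ (mulr_gt0 b_gt0 c_gt0))) /= subr_eq0 => /eqP.
have u1E : u1 = 1 by have := tu1 D; rewrite t1E mul1r.
have p2 : p * u2 = (1 + a)%:C * (1 - t2).
  apply: (mulfI (C0 _ b_gt0)).
  transitivity (p * b%:C * u2); first by ring.
  by rewrite -(tw02 D) t1E; ring.
have p3 : p * u3 = (a - 1)%:C * (t3 - 1).
  apply: (mulfI (C0 _ c_gt0)).
  transitivity (p * c%:C * u3); first by ring.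
  by rewrite -(tw03 D) t1E; ring.
have a_neq1 : a - 1 != 0.
  apply: contraNneq p0 => a1; move: p3; rewrite a1 mul0r => /(congr1 (fun w => w * t3)).
  by rewrite -mulrA [u3 * t3]mulrC (tu3 D) mulr1 mul0r => ->.
have b_le : b <= 1 + a by apply: int_multiple_ge m2E; lra.
have c_le : c <= a - 1 by apply: int_multiple_ge m3E => //; lra.
have a1_gt0 : 0 < a - 1 by lra.
have pE2 : p = (1 + a)%:C * (t2 - t2 * t2).
  rewrite -[LHS]mulr1 -(tu2 D) [t2 * u2]mulrC mulrA p2; ring.
have pE3 : p = (a - 1)%:C * (t3 * t3 - t3).
  rewrite -[LHS]mulr1 -(tu3 D) [t3 * u3]mulrC mulrA p3; ring.
have sum01 : ((1 + a) * (1 + a))%:C + (2 * (b * b))%:C * t2 = p * (1 + a)%:C.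
  transitivity (p + p * a%:C * u1); last by rewrite u1E; ring.
  by rewrite -(tw01 D) -{1}(tw00 D) t1E; ring.
have dif01 : ((a - 1) * (a - 1))%:C + (2 * (c * c))%:C * t3 = p * (1 - a)%:C.
  transitivity (p - p * a%:C * u1); last by rewrite u1E; ring.
  by rewrite -(tw01 D) -{1}(tw00 D) t1E; ring.
pose X2 : R := 1 - 2 * (b * b) / ((1 + a) * (1 + a)).
pose X3 : R := 1 - 2 * (c * c) / ((a - 1) * (a - 1)).
have a1pp : 0 < (1 + a) * (1 + a) by rewrite mulr_gt0 // addr_gt0.
have a1mm : 0 < (a - 1) * (a - 1) by rewrite mulr_gt0.
have X2E : t2 + u2 = X2%:C.
  apply: (mulfI (C0 _ a1pp)).
  transitivity (((1 + a) * (1 + a) - 2 * (b * b))%:C : R[i]); last first.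
    by rewrite -rmorphM /=; congr _%:C; rewrite /X2; field; rewrite gt_eqF // addr_gt0.
  have : (((1 + a) * (1 + a))%:C + (2 * (b * b))%:C * t2) * u2 = p * (1 + a)%:C * u2.
    by rewrite sum01.
  rewrite {1}pE2 => h.
  have -> : ((1 + a) * (1 + a) - 2 * (b * b))%:C =
     ((1 + a) * (1 + a))%:C - ((((1 + a) * (1 + a))%:C + (2 * (b * b))%:C * t2) * u2
     - ((1 + a) * (1 + a))%:C * u2 + (2 * (b * b))%:C * (1 - t2 * u2)) by ring.
  rewrite h (tu2 D).
  have -> : (1 + a)%:C * (t2 - t2 * t2) * (1 + a)%:C * u2 =
    ((1 + a) * (1 + a))%:C * (t2 * u2 - t2 * (t2 * u2)) by ring.
  by rewrite (tu2 D); ring.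
have X3E : t3 + u3 = X3%:C.
  apply: (mulfI (C0 _ a1mm)).
  transitivity (((a - 1) * (a - 1) - 2 * (c * c))%:C : R[i]); last first.
    by rewrite -rmorphM /=; congr _%:C; rewrite /X3; field; rewrite gt_eqF.
  have : (((a - 1) * (a - 1))%:C + (2 * (c * c))%:C * t3) * u3 = p * (1 - a)%:C * u3.
    by rewrite dif01.
  rewrite {1}pE3 => h.
  have -> : ((a - 1) * (a - 1) - 2 * (c * c))%:C =
     ((a - 1) * (a - 1))%:C - ((((a - 1) * (a - 1))%:C + (2 * (c * c))%:C * t3) * u3
     - ((a - 1) * (a - 1))%:C * u3 + (2 * (c * c))%:C * (1 - t3 * u3)) by ring.
  rewrite h (tu3 D).
  have -> : (a - 1)%:C * (t3 * t3 - t3) * (1 - a)%:C * u3 =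
    ((a - 1) * (a - 1))%:C * (t3 * u3 - t3 * (t3 * u3)) by ring.
  by rewrite (tu3 D); ring.
have cjp2 : p^* = - (p * (u2 * u2 * u2)).
  have := congr1 (fun w => w^*) p2.
  rewrite !(rmorphB, rmorphM, rmorph1) /= !conj_realC (cj2 D) (cj_u (cj2 D)) => h.
  rewrite -[LHS]mulr1 -(tu2 D) [LHS]mulrA h.
  have -> : (1 + a)%:C * (1 - u2) * u2 =
     - ((1 + a)%:C * (1 - t2)) * (u2 * u2) + (1 + a)%:C * u2 * (1 - t2 * u2) by ring.
  by rewrite -p2 (tu2 D); ring.
have cjp3 : p^* = - (p * (u3 * u3 * u3)).
  have := congr1 (fun w => w^*) p3.
  rewrite !(rmorphB, rmorphM, rmorph1) /= !conj_realC (cj3 D) (cj_u (cj3 D)) => h.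
  rewrite -[LHS]mulr1 -(tu3 D) [LHS]mulrA h.
  have -> : (a%:C - 1) * (u3 - 1) * u3 =
     - ((a - 1)%:C * (t3 - 1)) * (u3 * u3) - (a - 1)%:C * u3 * (1 - t3 * u3) by ring.
  by rewrite -p3 (tu3 D); ring.
(* The conjugate of [p] is minus [p] times the cube of [u2], and likewise for [u3]; hence the two
   cubes agree. *)
have /eqP : (u2 - u3) * (u2 * u2 + u2 * u3 + u3 * u3) = 0.
  apply: (mulfI p0); rewrite mulr0.
  transitivity (- (p * (u3 * u3 * u3)) - - (p * (u2 * u2 * u2))); first by ring.
  by rewrite -cjp2 -cjp3 subrr.
rewrite mulf_eq0 subr_eq0 => /orP[/eqP u23|/eqP uu].
  have t23 : t2 = t3 by rewrite -(cj_u (cj2 D)) u23 (cj_u (cj3 D)).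
  have /eqP : (2 * a)%:C * (1 - t3) = 0.
    transitivity ((1 + a)%:C * (1 - t2) - (a - 1)%:C * (t3 - 1)); first by rewrite t23; ring.
    by rewrite -p2 -p3 u23 subrr.
  rewrite mulf_eq0 (negPf (C0 _ _)) /=; last by rewrite mulr_gt0.
  rewrite subr_eq0 => /eqP t31; move: p0; rewrite pE3 -t31.
  by rewrite mulr1 subrr mulr0 eqxx.
have tt : t2 * t2 + t2 * t3 + t3 * t3 = 0.
  have := congr1 (fun w => w^*) uu.
  by rewrite !(rmorphD, rmorphM, rmorph0) /= (cj_u (cj2 D)) (cj_u (cj3 D)).
have tu23 : u2 * t3 + 1 + u3 * t2 = 0.
  have : (u2 * u2 + u2 * u3 + u3 * u3) * (t2 * t3) = 0 by rewrite uu mul0r.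
  have -> : (u2 * u2 + u2 * u3 + u3 * u3) * (t2 * t3) =
    u2 * t3 * (t2 * u2) + (t2 * u2) * (t3 * u3) + u3 * t2 * (t3 * u3) by ring.
  by rewrite (tu2 D) (tu3 D) !mulr1.
have X23 : X2 * X2 + X2 * X3 + X3 * X3 = 3.
  apply: (@complexI R); rewrite !rmorphD !rmorphM /= -X2E -X3E.
  transitivity ((t2 * t2 + t2 * t3 + t3 * t3) + (u2 * u2 + u2 * u3 + u3 * u3)
    + 2 * (t2 * u2) + 2 * (t3 * u3) + (u2 * t3 + 1 + u3 * t2) - 1); first by ring.
  by rewrite tt uu tu23 (tu2 D) (tu3 D); ring.
clear - X23 X2 X3 ccE ga gb gc a_gt0 b_gt0 c_gt0 a1_gt0 a1pp a1mm b_le c_le.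
have bb_gt0 : 0 < b * b by rewrite mulr_gt0.
have cc_gt0 : 0 < c * c by rewrite mulr_gt0.
have bb_le : b * b <= (1 + a) * (1 + a) by rewrite ler_pM // ltW.
have cc_le : c * c <= (a - 1) * (a - 1) by rewrite ler_pM // ltW.
have X2_lt : X2 < 1 by rewrite /X2 ltrBlDr ltrDl divr_gt0 // mulr_gt0.
have X3_lt : X3 < 1 by rewrite /X3 ltrBlDr ltrDl divr_gt0 // mulr_gt0.
have bb2 : 2 * (b * b) = (1 - X2) * ((1 + a) * (1 + a)) by rewrite /X2; field; rewrite gt_eqF // addr_gt0.
have cc2 : 2 * (c * c) = (1 - X3) * ((a - 1) * (a - 1)) by rewrite /X3; field; rewrite gt_eqF.
have X2_ge : -1 <= X2.
  have : (1 - X2) * ((1 + a) * (1 + a)) <= 2 * ((1 + a) * (1 + a)) by rewrite -bb2; lra.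
  by rewrite ler_pM2r //; lra.
have X3_ge : -1 <= X3.
  have : (1 - X3) * ((a - 1) * (a - 1)) <= 2 * ((a - 1) * (a - 1)) by rewrite -cc2; lra.
  by rewrite ler_pM2r //; lra.
have h2 : 0 <= (1 - X2) * (1 + X2) by rewrite mulr_ge0; lra.
have h3 : 0 <= (1 - X3) * (1 + X3) by rewrite mulr_ge0; lra.
have h23 : 0 <= (X2 - X3) * (X2 - X3) by rewrite -expr2 sqr_ge0.
(* [X23] says that three times the quantities of [h2] and [h3] plus that of [h23] is zero, so each
   of these nonnegative quantities vanishes. *)
have sq2 : (1 - X2) * (1 + X2) = 0 by lra.
have sq3 : (1 - X3) * (1 + X3) = 0 by lra.
have eqm (X : R) : X < 1 -> (1 - X) * (1 + X) = 0 -> X = -1.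
  move=> X1 /eqP; rewrite mulf_eq0 subr_eq0 gt_eqF //= addrC addr_eq0.
  by move/eqP.
move: bb2 cc2; rewrite (eqm _ X2_lt sq2) (eqm _ X3_lt sq3) => bb2 cc2.
have : (1 + a) * (1 + a) - (a - 1) * (a - 1) = 4 * a by ring.
lra.
Qed.

(** * Double transpositions *)

Lemma quad_unit_search (k q l v n : int) :
  1 <= k -> 1 <= q -> - k <= l -> l <= k -> l != 0 -> 
  v * q * (l * l + 4) = 2 * k * l + 4 - l * l ->
  k * k + 2 + 2 * q * k <= 4 * (1 + q) * (1 + q) ->
  (k - n) * (k - n) * (k * k + 4) = q * q * ((n - l) * (n - l)) * (l * l + 4) ->
  q = 1 /\ (l = k \/ l = -2 /\ k = 2).
Proof.
move=> k1 q1 lk1 lk2 l0 vE bnd nE.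
(* For [v = 0] the number [k * k + 4] would be the square of [k - l], but it is not a square when
   [k >= 1]. *)
have v_neq0 : v != 0.
  apply/eqP => v0; rewrite v0 !mul0r in vE.
  pose m := k - l; have mm : m * m = k * k + 4 by rewrite /m; lia.
  have m0 : 0 <= m by rewrite /m; lia.
  have [mk|km] := leP m k; first by have : m * m <= k * k by [rewrite ler_pM]; lia.
  have [mE|mE] : m = k + 1 \/ k + 2 <= m by lia.
    by move: mm; rewrite mE; lia.
  have : (k + 2) * (k + 2) <= m * m by rewrite ler_pM //; lia.
  lia.
have ll : 0 <= l * l by rewrite -expr2 sqr_ge0.
(* As [v] is at least 1 in absolute value, [vE] bounds [q * (l * l + 4)]; then use that [l * l + 4]
   is at least 4 times the absolute value of [l]. *)
have kq : 2 * q <= k + 2.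
  have h1 : q * (l * l + 4) <= 2 * k * l + 4 - l * l \/ q * (l * l + 4) <= - (2 * k * l + 4 - l * l).
    rewrite -vE -mulrA; set w := q * _.
    have w_ge0 : 0 <= w by rewrite mulr_ge0; lia.
    have [hv|hv] : 1 <= v \/ v <= -1 by lia.
      by left; rewrite ler_peMl.
    by right; have : 0 <= (-1 - v) * w by [rewrite mulr_ge0 //; lia]; lia.
  have h2 : 4 * l <= l * l + 4 by have := sqr_ge0 (l - 2); rewrite expr2; lia.
  have h3 : - 4 * l <= l * l + 4 by have := sqr_ge0 (l + 2); rewrite expr2; lia.
  have h4 : k * (4 * l) <= k * (l * l + 4) by rewrite ler_wpM2l; lia.
  have h5 : k * (- 4 * l) <= k * (l * l + 4) by rewrite ler_wpM2l; lia.
  have : 2 * q * (l * l + 4) <= (k + 2) * (l * l + 4) by case: h1; lia.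
  by rewrite ler_pM2r //; lia.
have kq_cases : [\/ q = 1 /\ (k = 1 \/ k = 2), q = 2 /\ [\/ k = 2, k = 3 | k = 4],
    q = 3 /\ (k = 4 \/ k = 5) | q = 4 /\ k = 6].
  (* Written in [q] and the slack [h] of [kq], the premise [bnd] bounds both, and eight pairs [k],
     [q] remain; then [l] runs over a finite range. *)
  have [h hE0] : exists h, h = k + 2 - 2 * q by exists (k + 2 - 2 * q).
  have h0 : 0 <= h by lia.
  have kE : k = h + 2 * q - 2 by lia.
  have bnd' : 4 * (q * q) - 20 * q + 2 + h * h + (6 * q - 4) * h <= 0.
    by move: bnd; rewrite kE; lia.
  have hh : 0 <= h * h by rewrite mulr_ge0.
  have qh : 2 * h <= (6 * q - 4) * h by rewrite ler_wpM2r //; lia.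
  have q4 : q <= 4.
    rewrite leNgt; apply/negP => q5.
    by have : 0 <= q * (q - 5) by [rewrite mulr_ge0; lia]; lia.
  have h2 : h <= 2.
    rewrite leNgt; apply/negP => h3.
    have : 3 * h <= h * h by rewrite ler_wpM2r //; lia.
    by have [qE|[qE|[qE|qE]]] : q = 1 \/ q = 2 \/ q = 3 \/ q = 4 by [lia];
      rewrite qE in bnd'; lia.
  have kqh : exists h' q' : nat, [/\ h = h'%:Z, q = q'%:Z, (h' <= 2)%N & (q' <= 4)%N].
    by exists `|h|%N, `|q|%N; split; lia.
  have [h' [q' [hE qE h'2 q'4]]] := kqh; move: bnd' kE q1; rewrite hE qE => bnd' kE q1.
  by case: q' qE q'4 bnd' kE q1 => [|[|[|[|[|q']]]]] // _ _; case: h' hE h'2 => [|[|[|h']]] // _ _ bnd' kE _;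
   try (by exfalso; lia); by [constructor 1; split=> //; lia
    |constructor 2; split=> //; constructor 1; lia
    |constructor 2; split=> //; constructor 2; lia|constructor 2; split=> //; constructor 3; lia
    |constructor 3; split=> //; lia|constructor 4; split=> //; lia].
(* For [q = 2], [k = 4] and [l = -2] or [l = 2], completing the square in [nE] as an equation for
   [n] yields 160. *)
have no160 (m : int) : m * m <> 160.
  move=> mm; have [w ww] : exists w : nat, (w * w = 160)%N by exists `|m|%N; lia.
  by move: ww; case: (ltnP w 13) => [|w13]; [do 13 (case: w => [//|w])|have := leq_mul w13 w13; lia].
clear bnd kq ll v_neq0.
case: kq_cases => [[qE [kE|kE]]|[qE [kE|kE|kE]]|[qE [kE|kE]]|[qE kE]]; subst k q.
{ have [lE|lE] : l = -1 \/ l = 1 by lia.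
  all: rewrite lE in vE nE *; try (by exfalso; lia).
  by split=> //; left. }
{ have [lE|[lE|[lE|lE]]] : l = -2 \/ l = -1 \/ l = 1 \/ l = 2 by lia.
  all: rewrite lE in vE nE *; try (by exfalso; lia).
  by split=> //; right.
  by split=> //; left. }
{ have [lE|[lE|[lE|lE]]] : l = -2 \/ l = -1 \/ l = 1 \/ l = 2 by lia.
  all: rewrite lE in vE nE *; try (by exfalso; lia). }
{ have [lE|[lE|[lE|[lE|[lE|lE]]]]] : l = -3 \/ l = -2 \/ l = -1 \/ l = 1 \/ l = 2 \/ l = 3 by lia.
  all: rewrite lE in vE nE *; try (by exfalso; lia). }
{ have [lE|[lE|[lE|[lE|[lE|[lE|[lE|lE]]]]]]] : l = -4 \/ l = -3 \/ l = -2 \/ l = -1 \/ l = 1 \/ l = 2 \/ l = 3 \/ l = 4 by lia.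
  all: rewrite lE in vE nE *; try (by exfalso; lia).
  by case: (no160 (4 - n - 16)); lia.
  by case: (no160 (3 * (4 - n) - 16)); lia. }
{ have [lE|[lE|[lE|[lE|[lE|[lE|[lE|lE]]]]]]] : l = -4 \/ l = -3 \/ l = -2 \/ l = -1 \/ l = 1 \/ l = 2 \/ l = 3 \/ l = 4 by lia.
  all: rewrite lE in vE nE *; try (by exfalso; lia). }
{ have [lE|[lE|[lE|[lE|[lE|[lE|[lE|[lE|[lE|lE]]]]]]]]] : l = -5 \/ l = -4 \/ l = -3 \/ l = -2 \/ l = -1 \/ l = 1 \/ l = 2 \/ l = 3 \/ l = 4 \/ l = 5 by lia.
  all: rewrite lE in vE nE *; try (by exfalso; lia). }
{ have [lE|[lE|[lE|[lE|[lE|[lE|[lE|[lE|[lE|[lE|[lE|lE]]]]]]]]]]] : l = -6 \/ l = -5 \/ l = -4 \/ l = -3 \/ l = -2 \/ l = -1 \/ l = 1 \/ l = 2 \/ l = 3 \/ l = 4 \/ l = 5 \/ l = 6 by lia.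
  all: rewrite lE in vE nE *; try (by exfalso; lia). }
Qed.

(** The first outcome is already a product of two rank 2 matrices, with the labels rotated. The
    other two are exchanged by swapping labels 2 and 3, and leave one diagonal entry and [y]
    open. *)
Lemma double_transposition_signs (R : realType) (a b c e f g x y z : R) t1 t2 t3 u1 u2 u3 p :
  modular_data4 a b c e f g x y z t1 t2 t3 u1 u2 u3 p ->
  e ^+ 2 = 1 -> f ^+ 2 = c ^+ 2 -> g ^+ 2 = b ^+ 2 -> (b = 1 -> f = a) ->
  [/\ e = 1, f = - c, g = - b & [/\ x = -1, y = a, z = -1 & a = b * c]] \/
  [\/ [/\ e = -1, f = c, g = - b & z = - x] | [/\ e = -1, f = - c, g = b & x = - z]].
Proof.
move=> D /sqr1_eqP He /sqr_eqP Hf /sqr_eqP Hg G1.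
have ga := ge1_a D; have gb := ge1_b D; have gc := ge1_c D.
have [a_gt0 b_gt0 c_gt0] : [/\ 0 < a, 0 < b & 0 < c] by split; lra.
have bc_gt0 : 0 < b * c by rewrite mulr_gt0.
have bcC := mulrC b c.
have cancelb (w v : R) : b * w = b * v -> w = v by move/(mulfI (lt0r_neq0 b_gt0)).
have cancelc (w v : R) : c * w = c * v -> w = v by move/(mulfI (lt0r_neq0 c_gt0)).
have o1 := or01 D; have o2 := or02 D; have o3 := or03 D; have o12 := or12 D.
have o13 := or13 D; have o23 := or23 D; have o22 := or22 D.
case: He => He; case: Hf => Hf; case: Hg => Hg; subst e f g;
  rewrite ?(mulrN, mulNr, mulr1, mul1r, opprK) -?bcC in o1 o2 o3 o12 o13 o23 *;
  try (by exfalso; lra); first 1 last.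
- right; left; split=> //; apply: cancelb; rewrite mulrN; lra.
- right; right; split=> //; apply: cancelb; rewrite mulrN; lra.
left; have aE : a = b * c by lra.
have zx : z = x by apply: cancelb; lra.
subst z; suffices [xE yE] : x = -1 /\ y = a by split.
have e1 : b * x + c * y = b * (c * c - 1) by rewrite -(subr0 (_ * _ + _)) -o2 aE; ring.
have e2 : c * x + b * y = c * (b * b - 1) by rewrite -(subr0 (_ * _ + _)) -o3 aE; ring.
have [bc|bc] := eqVneq b c; last first.
  have bc2 : b * b - c * c != 0.
    have -> : b * b - c * c = (b - c) * (b + c) by ring.
    by rewrite mulf_neq0 ?subr_eq0 // gt_eqF // addr_gt0.
  split; apply: (mulfI bc2).
    transitivity (b * (b * x + c * y) - c * (c * x + b * y)); first by ring.
    by rewrite e1 e2; ring.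
  transitivity (b * (c * x + b * y) - c * (b * x + c * y)); first by ring.
  by rewrite e1 e2 aE; ring.
subst c.
have yE : y = b * b - 1 - x by apply: cancelb; lra.
have /eqP : (x + 1) * (x - b * b) = 0.
  have -> : (x + 1) * (x - b * b) = (b * b + - b * - b + x * x + y * y - (1 + a * a + b * b + b * b)) / 2.
    by rewrite yE aE; field.
  by rewrite o22 subrr mul0r.
rewrite mulf_eq0 addr_eq0 subr_eq0 => /orP[/eqP xE|/eqP xE]; first by rewrite yE xE aE; split=> //; ring.
(* If [x = b * b], the twist sums at (0, 1) and (2, 3) coincide. Comparing absolute values of their
   right sides gives [a = 1], then [b = 1], against [G1]. *)
exfalso; have yE' : y = -1 by rewrite yE xE; ring.
have p0 := modular_data4_p_neq0 D.
have n (t u : R[i]) : t * u = 1 -> t^* = u -> `|u| = 1.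
  by move=> tu tc; rewrite -tc norm_conjC (norm_unit_cj tu tc).
have h : p * a%:C * u1 = p * y%:C * (u2 * u3).
  by rewrite -(tw01 D) -(tw23 D) xE yE' aE; ring.
have : `|a%:C : R[i]| = `|y%:C : R[i]|.
  apply: (mulfI (_ : `|p| != 0)); first by rewrite normr_eq0.
  have := congr1 Num.norm h; rewrite !normrM (n _ _ (tu1 D) (cj1 D)) (n _ _ (tu2 D) (cj2 D)).
  by rewrite (n _ _ (tu3 D) (cj3 D)) !mulr1.
rewrite !norm_realC yE' normrN1 => /complexI; rewrite ger0_norm ?ltW // => a1.
have b1 : b = 1.
  have : 0 <= (b - 1) * (b + 1) by rewrite mulr_ge0; lra.
  have : (b - 1) * b = 0.
    have : b <= b * b by rewrite ler_peMl // ltW.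
    by rewrite mulrBl mul1r; lra.
  by move/eqP; rewrite mulf_eq0 (gt_eqF b_gt0) orbF subr_eq0 => /eqP.
by have := G1 b1; lra.
Qed.

Lemma double_transposition_product (R : realType) (a b c x y : R) t1 t2 t3 u1 u2 u3 p :
  modular_data4 a b c (-1) c (- b) x y (- x) t1 t2 t3 u1 u2 u3 p ->
  x ^+ 2 = 1 -> y ^+ 2 = a ^+ 2 -> [/\ x = -1, y = - a & c = a * b].
Proof.
move=> D /sqr1_eqP Hx /sqr_eqP Hy.
have ga := ge1_a D; have gb := ge1_b D; have gc := ge1_c D.
have [a_gt0 b_gt0 c_gt0] : [/\ 0 < a, 0 < b & 0 < c] by split; lra.
have ac_gt0 : 0 < a * c by rewrite mulr_gt0.
have o2 := or02 D; have o3 := or03 D; clear D.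
case: Hx => Hx; case: Hy => Hy; subst x y; rewrite ?(mulrN, mulNr, mulr1, mul1r, opprK) ?[c * a]mulrC ?[b * a]mulrC in o2 o3 *; try (by exfalso; lra).
by split=> //; lra.
Qed.

(* Orthogonality, the Gauss sum bound and N_(1,1)^1 turn into polynomial relations between
   the integers k, q, l, v, n; their finitely many solutions are found by quad_unit_search. *)
Lemma double_transposition_core (R : realType) (a b c x y : R) t1 t2 t3 u1 u2 u3 p
    (k q l v : int) (n : nat) :
  modular_data4 a b c (-1) c (- b) x y (- x) t1 t2 t3 u1 u2 u3 p -> a != 1 -> b != c ->
  a * a - 1 = k%:~R * a -> b * c = q%:~R * a -> c * c - b * b = l%:~R * (b * c) ->
  x * y = v%:~R * (b * c) ->
  n%:R * (1 + a * a + b * b + c * c) =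
    a * a * a - 1 / a + c * c * c / b - b * b * b / c ->
  [/\ x = -1, y = - a, c = a * b & b = 1].
Proof.
move=> D a1 bc hk hq hl hv hn.
have ga := ge1_a D; have gb := ge1_b D; have gc := ge1_c D.
have [a_gt0 b_gt0 c_gt0] : [/\ 0 < a, 0 < b & 0 < c] by split; lra.
have [a_neq0 b_neq0 c_neq0] : [/\ a != 0, b != 0 & c != 0] by split; rewrite gt_eqF.
have bc_gt0 : 0 < b * c by rewrite mulr_gt0.
have o2 := or02 D; have o3 := or03 D; rewrite mulrN in o3.
(* Orthogonality of row 0 with rows 2 and 3 is a linear system for [x] and [y] of determinant
   [b * b + c * c]; [xS] and [yS] are its solution by Cramer's rule. *)
have xS : x * (b * b + c * c) = b * c * (l%:~R - 2 * a).
  transitivity (b * (b + a * c + b * x + c * y) - c * (c - a * b + b * y + c * - x)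
    + (c * c - b * b) - 2 * (a * (b * c))); first by ring.
  by rewrite o2 o3 hl; ring.
have yS : y * (b * b + c * c) = - (b * c * (a * l%:~R + 2)).
  transitivity (c * (b + a * c + b * x + c * y) + b * (c - a * b + b * y + c * - x)
    - a * (c * c - b * b) - 2 * (b * c)); first by ring.
  by rewrite o2 o3 hl; ring.
have S2 : (b * b + c * c) * (b * b + c * c) = (b * c) * (b * c) * (l%:~R * l%:~R + 4).
  transitivity ((c * c - b * b) * (c * c - b * b) + 4 * ((b * c) * (b * c))); first by ring.
  by rewrite hl; ring.
have A2 : (1 + a * a) * (1 + a * a) = a * a * (k%:~R * k%:~R + 4).
  transitivity ((a * a - 1) * (a * a - 1) + 4 * (a * a)); first by ring.
  by rewrite hk; ring.
have aE : a * a = k%:~R * a + 1 by rewrite -hk; ring.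
have vE : v * q * (l * l + 4) = 2 * k * l + 4 - l * l.
  apply: (mulrIz (oner_neq0 R)); rewrite !(rmorphM, rmorphD, rmorphB, rmorphN) /=.
  apply: (mulfI (mulf_neq0 (mulf_neq0 a_neq0 (lt0r_neq0 bc_gt0)) (lt0r_neq0 bc_gt0))).
  transitivity (v%:~R * (q%:~R * a) * ((b * c) * (b * c) * (l%:~R * l%:~R + 4))); first by ring.
  rewrite -hq -hv -S2.
  transitivity (x * (b * b + c * c) * (y * (b * b + c * c))); first by ring.
  rewrite xS yS.
  transitivity ((b * c) * (b * c) * (2 * (a * a) * l%:~R + 4 * a - a * (l%:~R * l%:~R) - 2 * l%:~R)).
    by ring.
  by rewrite aE; ring.
(* The Verlinde sum [hn] is [k] times [1 + a * a] plus [l] times [b * b + c * c]. Squaring the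
   resulting balance lets [A2] and [S2] replace both factors, and the dimensions cancel. *)
have nE : (k - n%:Z) * (k - n%:Z) * (k * k + 4) = q * q * ((n%:Z - l) * (n%:Z - l)) * (l * l + 4).
  have h : (k%:~R - n%:R) * (1 + a * a) = (n%:R - l%:~R) * (b * b + c * c).
    have : n%:R * (1 + a * a + b * b + c * c) = k%:~R * (1 + a * a) + l%:~R * (b * b + c * c).
      rewrite hn; transitivity ((a * a - 1) / a * (1 + a * a) +
         (c * c - b * b) / (b * c) * (b * b + c * c)).
        by field; rewrite a_neq0 b_neq0 c_neq0.
      by rewrite hk hl !mulfK // lt0r_neq0.
    move=> h; transitivity (k%:~R * (1 + a * a) + l%:~R * (b * b + c * c)
      - n%:R * (1 + a * a + b * b + c * c) + (n%:R - l%:~R) * (b * b + c * c)); first by ring.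
    by rewrite h; ring.
  apply: (mulrIz (oner_neq0 R)); rewrite !(rmorphM, rmorphD, rmorphB, rmorphN) /= -!pmulrn.
  apply: (mulfI (mulf_neq0 a_neq0 a_neq0)).
  transitivity ((k%:~R - n%:R) * (k%:~R - n%:R) * ((1 + a * a) * (1 + a * a))).
    by rewrite A2; ring.
  transitivity (((k%:~R - n%:R) * (1 + a * a)) * ((k%:~R - n%:R) * (1 + a * a))); first by ring.
  rewrite h; transitivity ((n%:R - l%:~R) * (n%:R - l%:~R) * ((b * b + c * c) * (b * b + c * c))).
    by ring.
  by rewrite S2 hq; ring.
have k_gt0 : 0 < k.
  rewrite -(ltr_int R) -(pmulr_lgt0 _ a_gt0) -hk.
  have -> : a * a - 1 = (a - 1) * (a + 1) by ring.
  by rewrite mulr_gt0 ?(addr_gt0 a_gt0 ltr01) // subr_gt0 lt_neqAle eq_sym a1.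
have q_gt0 : 0 < q by rewrite -(ltr_int R) -(pmulr_lgt0 _ a_gt0) -hq.
have c_le : c <= a * b by rewrite (le_trans (ler_norm _)) // (bd12 D).
have b_le : b <= a * c by have := bd13 D; rewrite normrN; apply: le_trans; rewrite ler_norm.
have abc_gt0 : 0 < a * (b * c) by rewrite mulr_gt0.
have lk : l <= k.
  rewrite -(ler_int R) -(ler_pM2r abc_gt0) -subr_ge0.
  have -> : k%:~R * (a * (b * c)) - l%:~R * (a * (b * c)) = (a * b - c) * (a * c + b).
    transitivity (k%:~R * a * (b * c) - l%:~R * (b * c) * a); first by ring.
    by rewrite -hk -hl; ring.
  by rewrite mulr_ge0 ?subr_ge0 // addr_ge0 ?ltW // mulr_gt0.
have lk' : - k <= l.
  rewrite -(ler_int R) -(ler_pM2r abc_gt0) -subr_ge0 rmorphN /=.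
  have -> : l%:~R * (a * (b * c)) - (- k%:~R) * (a * (b * c)) = (a * c - b) * (a * b + c).
    transitivity (k%:~R * a * (b * c) + l%:~R * (b * c) * a); first by ring.
    by rewrite -hk -hl; ring.
  by rewrite mulr_ge0 ?subr_ge0 // addr_ge0 ?ltW // mulr_gt0.
have l_neq0 : l != 0.
  apply: contraNneq bc => l0; rewrite -(eqrXn2 (n := 2)) ?ltW //.
  by rewrite !expr2; apply/eqP; move: hl; rewrite l0; lra.
(* The relation at (0, 1), divided by [a], writes [p * u1] as [1 - t1 + q * (t2 - t3)], so
   [d <= 2 + 2 * q]. On the other side, [a >= k] and [b * b + c * c >= 2 * (b * c)] bound [d * d]
   from below. *)
have bnd : k * k + 2 + 2 * q * k <= 4 * (1 + q) * (1 + q).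
  have [d [d_ge0 dd pd]] := modular_data4_gauss_norm D.
  have d_le : d <= 2 + 2 * q%:~R.
    have n1 := norm_unit_cj (tu1 D) (cj1 D).
    have := @twist_sum_norm R 1 (-1) q%:~R (- q%:~R) d t1 t2 t3 n1
      (norm_unit_cj (tu2 D) (cj2 D)) (norm_unit_cj (tu3 D) (cj3 D)).
    case=> [|h _ _].
      have u1n : `|u1| = 1 by rewrite -(cj1 D) norm_conjC.
      rewrite -pd -[RHS]mulr1 -[X in _ = _ * X]u1n -normrM; congr `|_|.
      have aC : a%:C != 0 :> R[i] by rewrite fmorph_eq0.
      apply: (mulfI aC); transitivity (p * a%:C * u1); last by ring.
      have hqC : b%:C * c%:C = q%:~R%:C * a%:C :> R[i] by rewrite -!rmorphM /= hq.
      rewrite -(tw01 D); transitivity (a%:C - a%:C * t1 + q%:~R%:C * a%:C * t2 - q%:~R%:C * a%:C * t3).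
        by ring.
      by rewrite -hqC; ring.
    have q0 : 0 <= q%:~R :> R by rewrite ler0z ltW.
    by move: h; rewrite !normrN normr1 (ger0_norm q0); lra.
  have q0 : 0 <= q%:~R :> R by rewrite ler0z ltW.
  have k0 : 0 <= k%:~R :> R by rewrite ler0z ltW.
  have ka : k%:~R <= a by rewrite -(ler_pM2r a_gt0) aE; lra.
  have : d * d <= (2 + 2 * q%:~R) * (2 + 2 * q%:~R) by rewrite ler_pM.
  have : 0 <= (b - c) * (b - c) by rewrite -expr2 sqr_ge0.
  have : k%:~R * k%:~R <= k%:~R * a by rewrite ler_wpM2l.
  have : q%:~R * k%:~R <= q%:~R * a by rewrite ler_wpM2l.
  rewrite -(ler_int R) !(rmorphM, rmorphD) /= dd.
  have -> : (b - c) * (b - c) = b * b + c * c - 2 * (b * c) by ring.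
  rewrite hq aE; move: (k%:~R * a) (q%:~R * a) (b * b) (c * c) => *; lra.
have [q1 lE] : q = 1 /\ (l = k \/ l = -2 /\ k = 2).
  by apply: (@quad_unit_search k q l v n%:Z) => //; lia.
rewrite q1 mul1r in hq.
have Tpos : 0 < a * a + 1 by rewrite addr_gt0 // mulr_gt0.
case: lE => [lE|[lE kE]].
  have cE : c = a * b.
    have /eqP : (c - a * b) * (a * c + b) = 0.
      transitivity (a * (c * c - b * b) - (a * a - 1) * (b * c)); first by ring.
      by rewrite hk hl lE; ring.
    by rewrite mulf_eq0 (gt_eqF (addr_gt0 (mulr_gt0 a_gt0 c_gt0) b_gt0)) orbF subr_eq0 => /eqP.
  have b1 : b = 1.
    have /eqP : a * ((b - 1) * (b + 1)) = 0.
      by transitivity (b * (a * b) - a); [ring | rewrite -cE hq subrr].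
    by rewrite mulf_eq0 (negPf a_neq0) mulf_eq0 (gt_eqF (addr_gt0 b_gt0 ltr01)) orbF subr_eq0 => /eqP.
  split=> //.
    apply: (mulIf (lt0r_neq0 Tpos)).
    transitivity (x * (b * b + c * c)); first by rewrite cE b1; ring.
    rewrite xS cE b1 lE; transitivity (k%:~R * a - 2 * (a * a)); first by ring.
    by rewrite -hk; ring.
  apply: (mulIf (lt0r_neq0 Tpos)).
  transitivity (y * (b * b + c * c)); first by rewrite cE b1; ring.
  rewrite yS cE b1 lE; transitivity (- (a * (k%:~R * a) + 2 * a)); first by ring.
  by rewrite -hk; ring.
(* The solution [l = -2], [k = 2] gives [b = a * c] and [c = 1], and then the diagonal entry [- x]
   exceeds its bound [c * c]. *)
exfalso.
have bE : b = a * c.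
  have /eqP : (b - a * c) * (a * b + c) = 0.
    transitivity (- (a * (c * c - b * b)) - (a * a - 1) * (b * c)); first by ring.
    by rewrite hk hl lE kE; ring.
  by rewrite mulf_eq0 (gt_eqF (addr_gt0 (mulr_gt0 a_gt0 b_gt0) c_gt0)) orbF subr_eq0 => /eqP.
have c1 : c = 1.
  have /eqP : a * ((c - 1) * (c + 1)) = 0.
    by transitivity ((a * c) * c - a); [ring | rewrite -bE hq subrr].
  by rewrite mulf_eq0 (negPf a_neq0) mulf_eq0 (gt_eqF (addr_gt0 c_gt0 ltr01)) orbF subr_eq0 => /eqP.
have xT : - x * (a * a + 1) = 2 * a + 2 * (a * a).
  transitivity (- (x * (b * b + c * c))); first by rewrite bE c1; ring.
  by rewrite xS bE c1 lE; ring.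
have : - x * (a * a + 1) <= 1 * (a * a + 1).
  rewrite (ler_wpM2r (ltW Tpos)) //; apply: le_trans (ler_norm _) _.
  by have := bd33 D; rewrite c1 mulr1.
rewrite xT; have : 0 < a * a by rewrite mulr_gt0.
lra.
Qed.

(** Being minus a sum of two numbers of modulus 1, [k * u] is at most 2; this leaves [k = 0] and
    [k = 1]. *)
Lemma golden_or_one (R : realType) (u : R) (t w : R[i]) (k : nat) :
  1 <= u -> u * u - 1 = k%:R * u -> t * w = 1 -> t^* = w -> 
  - w = t + (k%:R * u)%:C -> u = 1 \/ u * u = u + 1.
Proof.
move=> gu ku tw tc bal.
have [t1 w1] : `|t| = 1 /\ `|w| = 1.
  by rewrite -tc norm_conjC (norm_unit_cj tw tc).
have : k%:R * u <= 2.
  rewrite -(@lecR R) -[leLHS]ger0_norm ?ler0c ?mulr_ge0 ?ler0n //; last by lra.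
  have -> : (k%:R * u)%:C = - w - t by rewrite bal; ring.
  by rewrite (le_trans (ler_normB _ _)) // normrN w1 t1 rmorphD.
case: k ku {bal} => [|[|k]] ku k2.
- left; have /eqP : (u - 1) * (u + 1) = 0 by transitivity (u * u - 1); [ring | rewrite ku mul0r].
  by rewrite mulf_eq0 subr_eq0 => /orP[/eqP //|]; rewrite gt_eqF //; lra.
- by right; lra.
exfalso; have k22 : 2 <= k.+2%:R :> R by rewrite ler_nat.
have : 2 * u <= k.+2%:R * u by rewrite ler_wpM2r //; lra.
have u1 : u = 1 \/ 1 < u by move: gu; rewrite le_eqVlt => /orP[/eqP|]; [left|right].
by case: u1 => [u1|]; [move: ku; rewrite u1 | ]; lra.
Qed.

(** Label 1 generates a rank 2 fusion ring in which its square is [1 + k] times itself. Hence the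
    twist sum at (1, 1) is the one at (0, 0) plus [k] times the one at (0, 1), which is the
    balancing equation needed by [golden_or_one]; label 2 is treated alike. *)
Lemma product_golden (R : realType) (u v : R) t1 t2 t3 u1 u2 u3 p (k l : nat) :
  modular_data4 u v (u * v) (-1) (u * v) (- v) (-1) (- u) 1 t1 t2 t3 u1 u2 u3 p ->
  u * u - 1 = k%:R * u -> v * v - 1 = l%:R * v ->
  (u = 1 \/ u * u = u + 1) /\ (v = 1 \/ v * v = v + 1).
Proof.
move=> D hk hl.
have p0 := modular_data4_p_neq0 D.
have hkC : u%:C * u%:C = 1 + (k%:R * u)%:C :> R[i].
  by rewrite -hk; ring.
have hlC : v%:C * v%:C = 1 + (l%:R * v)%:C :> R[i].
  by rewrite -hl; ring.
have bal (d : R) (t w : R[i]) m : t * w = 1 -> 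
    p + (m%:R)%:C * (p * d%:C * w) = p * (-1)%:C * (w * w) -> - w = t + (m%:R * d)%:C.
  move=> tw h; apply: (mulfI p0); apply: (mulIf (_ : w != 0)).
    by apply: contra_eq_neq tw => ->; rewrite mulr0 eq_sym oner_eq0.
  transitivity (p * (-1)%:C * (w * w)); first by ring.
  by rewrite -h; transitivity (p * (t * w) + (m%:R)%:C * (p * d%:C * w)); [rewrite tw; ring | ring].
split.
  apply: (golden_or_one (ge1_a D) hk (tu1 D) (cj1 D)); apply: (bal _ _ _ _ (tu1 D)).
  rewrite -(tw01 D) -(tw11 D) -(tw00 D).
  by move: hkC; rewrite !rmorphM /= => hkC; ring: hkC.
apply: (golden_or_one (ge1_b D) hl (tu2 D) (cj2 D)); apply: (bal _ _ _ _ (tu2 D)).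
rewrite -(tw02 D) -(tw22 D) -(tw00 D).
by move: hlC; rewrite !rmorphM /= => hlC; ring: hlC.
Qed.

Lemma sqr_mod8 (x : nat) : exists m, (x * x = 4 * m \/ x * x = 8 * m + 1)%N.
Proof.
have [w [Ew|Ew]] : exists w, (x = 2 * w \/ x = 2 * w + 1)%N by exists x./2; lia.
  by exists (w * w)%N; left; rewrite Ew; lia.
have [v Ev] : exists v, (w * w + w = 2 * v)%N.
  have [v [Ev|Ev]] : exists v, (w = 2 * v \/ w = 2 * v + 1)%N by exists w./2; lia.
    by exists (2 * v * v + v)%N; rewrite Ev; lia.
  by exists (2 * v * v + 3 * v + 1)%N; rewrite Ev; lia.
by exists v; right; rewrite Ew; lia.
Qed.

(** The sum of squares divided by the square of the largest dimension is 2, 3 or at least 4. The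
    values 2 and 3 are refuted by parity: squares are 0 mod 4 or 1 mod 8, and the square of an even
    dimension must divide the sum. A quotient of at least 4 forces the largest dimension to be 1. *)
Lemma dims_all_one (d1 d2 d3 k1 k2 k3 : nat) :
  (0 < d1)%N -> (0 < d2)%N -> (0 < d3)%N ->
  (d1 * d1 * k1 = 1 + d1 * d1 + d2 * d2 + d3 * d3)%N ->
  (d2 * d2 * k2 = 1 + d1 * d1 + d2 * d2 + d3 * d3)%N ->
  (d3 * d3 * k3 = 1 + d1 * d1 + d2 * d2 + d3 * d3)%N ->
  [/\ d1 = 1, d2 = 1 & d3 = 1]%N.
Proof.
have main (x y z kx ky kz : nat) : (0 < x)%N -> (0 < y)%N -> (0 < z)%N -> 
    (x <= z)%N -> (y <= z)%N ->
    (x * x * kx = 1 + x * x + y * y + z * z)%N ->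
    (y * y * ky = 1 + x * x + y * y + z * z)%N ->
    (z * z * kz = 1 + x * x + y * y + z * z)%N -> [/\ x = 1, y = 1 & z = 1]%N.
  move=> x0 y0 z0 xz yz hx hy hz.
  have xx : (x * x <= z * z)%N by rewrite leq_mul.
  have yy : (y * y <= z * z)%N by rewrite leq_mul.
  have zz : (0 < z * z)%N by rewrite muln_gt0 z0.
  have kz_gt1 : (1 < kz)%N.
    rewrite ltnNge; apply/negP => kz1; have := leq_mul (leqnn (z * z)%N) kz1.
    by rewrite hz; have : (0 < x * x)%N by [rewrite muln_gt0 x0]; lia.
  have [mx Ex] := sqr_mod8 x; have [my Ey] := sqr_mod8 y; have [mz Ez] := sqr_mod8 z.
  have [kzE|[kzE|kz4]] : (kz = 2 \/ kz = 3 \/ 4 <= kz)%N by lia.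
  - by exfalso; rewrite {}kzE in hz; case: Ex => Ex; case: Ey => Ey; case: Ez => Ez;
      rewrite ?Ex ?Ey ?Ez in hx hy hz; lia.
  - by exfalso; rewrite {}kzE in hz; case: Ex => Ex; case: Ey => Ey; case: Ez => Ez;
      rewrite ?Ex ?Ey ?Ez in hx hy hz; lia.
  have := leq_mul (leqnn (z * z)%N) kz4; rewrite hz => h.
  have z1 : z = 1%N.
    apply/eqP; rewrite eqn_leq z0 andbT leqNgt; apply/negP => z2.
    have zz4 := leq_mul z2 z2; clear - h xx yy zz4.
    move: (x * x)%N (y * y)%N (z * z)%N h xx yy zz4 => *; lia.
  by split=> //; apply/eqP; rewrite eqn_leq -{1}z1 ?xz ?yz.
move=> d10 d20 d30 h1 h2 h3.
have [m12|m12] := leqP d1 d2; have [m13|m13] := leqP d1 d3; have [m23|m23] := leqP d2 d3.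
all: try (by case: (@main d1 d2 d3 k1 k2 k3)).
all: try (by case: (@main d1 d3 d2 k1 k3 k2); rewrite ?h1 ?h2 ?h3; clear -m12 m13 m23 d10 d20 d30; lia).
all: by case: (@main d2 d3 d1 k2 k3 k1); rewrite ?h1 ?h2 ?h3; clear -m12 m13 m23 d10 d20 d30; lia.
Qed.

(** * Relabelling and the classification *)

Definition o0 : 'I_4 := ord0.
Definition o1 : 'I_4 := @Ordinal 4 1 isT.
Definition o2 : 'I_4 := @Ordinal 4 2 isT.
Definition o3 : 'I_4 := @Ordinal 4 3 isT.

Lemma ord4_ind (P : 'I_4 -> Prop) : P o0 -> P o1 -> P o2 -> P o3 -> forall i, P i.
Proof.
move=> P0 P1 P2 P3 [[|[|[|[|//]]]] lt_i].
- by rewrite (_ : Ordinal lt_i = o0) //; apply: val_inj.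
- by rewrite (_ : Ordinal lt_i = o1) //; apply: val_inj.
- by rewrite (_ : Ordinal lt_i = o2) //; apply: val_inj.
- by rewrite (_ : Ordinal lt_i = o3) //; apply: val_inj.
Qed.

Lemma sum4 (A : nmodType) (F : 'I_4 -> A) : \sum_k F k = F o0 + F o1 + F o2 + F o3.
Proof.
rewrite !big_ord_recl big_ord0 addr0 !addrA.
by congr (F _ + F _ + F _ + F _); apply: val_inj.
Qed.

Lemma pointed_dims_one (C : numClosedFieldType) (hat : 'I_4 -> 'I_4)
    (N : 'I_4 -> 'M[rat]_4) (S T : 'M[C]_4) :
  unitary_modular_symbol hat N S T ->
  (forall t, galois_perm (lam S) t -> t o0 = o0) -> forall i, normalized_S S i o0 = 1.
Proof.
move=> US fix0.
have [[m1 m1_gt0 E1] [m2 m2_gt0 E2] [m3 m3_gt0 E3]] :=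
  And3 (pointed_dim_nat US fix0 o1) (pointed_dim_nat US fix0 o2) (pointed_dim_nat US fix0 o3).
have [[k1 K1] [k2 K2] [k3 K3]] :=
  And3 (pointed_dim_ratio US fix0 o1) (pointed_dim_ratio US fix0 o2) (pointed_dim_ratio US fix0 o3).
rewrite sum4 (d0 US) expr1n !expr2 in K1 K2 K3.
have [] := dims_all_one (k1 := k1) (k2 := k2) (k3 := k3) m1_gt0 m2_gt0 m3_gt0.
- by apply/eqP; rewrite -(eqr_nat C) !natrD !natrM -E1 -E2 -E3 K1.
- by apply/eqP; rewrite -(eqr_nat C) !natrD !natrM -E1 -E2 -E3 K2.
- by apply/eqP; rewrite -(eqr_nat C) !natrD !natrM -E1 -E2 -E3 K3.
move=> m1E m2E m3E; apply: ord4_ind; first exact: (d0 US).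
all: by rewrite ?E1 ?E2 ?E3 ?m1E ?m2E ?m3E.
Qed.

Section Relabelling.
Variable A : pzRingType.
Variables (n : nat) (v : 'I_n -> 'I_n -> A) (q : {perm 'I_n}).
Local Notation v' := (fun i a => v (q i) (q a)).

Lemma galois_perm_relabel t : galois_perm v' t -> galois_perm v (q^-1 * t * q).
Proof.
move=> gal_t e e0; have := gal_t (rename_expr q^-1%g q^-1%g e).
have e1 : eval (fun i a => v (q (q^-1%g i)) (q (q^-1%g a))) e = 0.
  by rewrite -[RHS]e0; apply: eq_eval => i a; rewrite !permKV.
rewrite !eval_rename => /(_ e1) <-.
by apply: eq_eval => i a; rewrite permKV !permM.
Qed.

Lemma galois_perm_unrelabel t : galois_perm v t -> galois_perm v' (q * t * q^-1).
Proof.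
move=> gal_t e e0; have := gal_t (rename_expr q q e).
rewrite !eval_rename => /(_ e0) <-.
by apply: eq_eval => i a; rewrite !permM permKV.
Qed.

End Relabelling.

(** All that the case analysis uses of a symbol with real matrix, in a form stable under
    relabelling. [r_int] and [r_pointed] carry the arithmetic input. *)
Record real_modular_data (R : realType) (s : 'M[R]_4) (th : 'I_4 -> R[i]) (p : R[i]) : Prop := {
  r_sym : forall i j, s i j = s j i;
  r_00 : s o0 o0 = 1;
  r_ge1 : forall i, 1 <= s i o0;
  r_bound : forall i j, `|s i j| <= s i o0 * s j o0;
  r_orth : forall i j, \sum_k s i k * s j k = (\sum_k s k o0 ^+ 2) * (i == j)%:R;
  r_coef : forall i j k, exists m : nat,
    m%:R * (\sum_k s k o0 ^+ 2) = \sum_l s i l * s j l * s k l / s l o0;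
  r_twist0 : th o0 = 1;
  r_twist : forall i, `|th i| = 1;
  r_norm : p * p^* = (\sum_k s k o0 ^+ 2)%:C;
  r_STS : forall i j, \sum_k (s i k * s j k)%:C * th k = p * (s i j)%:C / (th i * th j);
  r_int : forall e,
    (forall t, galois_perm (fun i a => s i a / s a o0) t ->
      eval (fun i a => s i (t a) / s (t a) o0) e = eval (fun i a => s i a / s a o0) e) ->
    exists z : int, eval (fun i a => s i a / s a o0) e = z%:~R;
  r_sqr : forall t, galois_perm (fun i a => s i a / s a o0) t ->
    forall i j, s i (t j) ^+ 2 = s (t i) j ^+ 2;
  r_pointed : (forall t, galois_perm (fun i a => s i a / s a o0) t -> t o0 = o0) ->
    forall i, s i o0 = 1 }.

Lemma sum_relabel (A : nmodType) (q : 'S_4) (F : 'I_4 -> A) : \sum_k F (q k) = \sum_k F k.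
Proof. by rewrite [RHS](reindex_inj (@perm_inj _ q)). Qed.

Lemma real_modular_data_relabel (R : realType) (s : 'M[R]_4) th p (q : 'S_4) : q o0 = o0 ->
  real_modular_data s th p -> real_modular_data (mxsub q q s) (fun i => th (q i)) p.
Proof.
move=> q0 D.
have D2E : \sum_k (mxsub q q s) k o0 ^+ 2 = \sum_k s k o0 ^+ 2.
  by rewrite -[RHS](sum_relabel q); apply: eq_bigr => k _; rewrite mxE q0.
have lamE (t : 'I_4 -> 'I_4) : (fun i a => mxsub q q s i (t a) / mxsub q q s (t a) o0) =
    (fun i a => s (q i) (q (t a)) / s (q (t a)) o0).
  by apply/funext => i; apply/funext => a; rewrite !mxE q0.
have lamE1 := lamE id; rewrite /= in lamE1.
split.
- by move=> i j; rewrite !mxE (r_sym D).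
- by rewrite !mxE q0 (r_00 D).
- by move=> i; rewrite !mxE q0 (r_ge1 D).
- by move=> i j; rewrite !mxE q0 (r_bound D).
- move=> i j; rewrite D2E -(inj_eq (@perm_inj _ q)) -(r_orth D) -[RHS](sum_relabel q).
  by apply: eq_bigr => k _; rewrite !mxE.
- move=> i j k; have [m Dm] := r_coef D (q i) (q j) (q k); exists m.
  rewrite D2E Dm -[LHS](sum_relabel q).
  by apply: eq_bigr => l _; rewrite !mxE q0.
- by rewrite q0 (r_twist0 D).
- by move=> i; rewrite (r_twist D).
- by rewrite D2E (r_norm D).
- move=> i j; rewrite !mxE -(r_STS D) -[RHS](sum_relabel q).
  by apply: eq_bigr => k _; rewrite !mxE.
- rewrite lamE1 => e inv_e; pose lam i a := s i a / s a o0.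
  have [|z Dz] := r_int D (e := rename_expr q q e); last by exists z; rewrite -Dz eval_rename.
  move=> t gal_t; have := inv_e _ (galois_perm_unrelabel (q := q) gal_t).
  rewrite !eval_rename => <-; rewrite lamE; apply: eq_eval => i a.
  by rewrite !permM permKV.
- rewrite lamE1 => t gal_t i j.
  have := r_sqr D (galois_perm_relabel (v := fun i a => s i a / s a o0) gal_t) (q i) (q j).
  by rewrite !permM !permK !mxE.
- rewrite lamE1 => fix0 i; rewrite mxE q0; apply: (r_pointed D) => t gal_t.
  have := fix0 _ (galois_perm_unrelabel (q := q) gal_t); rewrite !permM q0 => h.
  by rewrite -(permKV q (t o0)) h q0.
Qed.

Lemma real_modular_data_data4 (R : realType) (s : 'M[R]_4) th p : real_modular_data s th p ->
  modular_data4 (s o1 o0) (s o2 o0) (s o3 o0) (s o1 o1) (s o1 o2) (s o1 o3) (s o2 o2) (s o2 o3) (s o3 o3)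
    (th o1) (th o2) (th o3) (th o1)^-1 (th o2)^-1 (th o3)^-1 p.
Proof.
move=> D.
have th0 i : th i != 0 by rewrite -normr_eq0 (r_twist D) oner_eq0.
have thc i : (th i)^* = (th i)^-1 by rewrite invC_norm (r_twist D) expr1n invr1 mul1r.
have s0 i : s o0 i = s i o0 by apply: (r_sym D).
have s21 := r_sym D o2 o1; have s31 := r_sym D o3 o1; have s32 := r_sym D o3 o2.
have D2E : \sum_k s k o0 ^+ 2 = 1 + s o1 o0 * s o1 o0 + s o2 o0 * s o2 o0 + s o3 o0 * s o3 o0.
  by rewrite sum4 (r_00 D) expr1n !expr2.
have orth i j : i != j -> \sum_k s i k * s j k = 0.
  by move=> /negPf nij; rewrite (r_orth D) nij mulr0.
have tw i j : \sum_k (s i k * s j k)%:C * th k = p * (s i j)%:C * ((th i)^-1 * (th j)^-1).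
  by rewrite (r_STS D) invfM.
split; rewrite ?(r_ge1 D) ?(r_bound D) ?divff ?thc //.
- by have := orth o0 o1 isT; rewrite sum4 !s0 (r_00 D) !mul1r.
- by have := orth o0 o2 isT; rewrite sum4 !s0 (r_00 D) s21 !mul1r.
- by have := orth o0 o3 isT; rewrite sum4 !s0 (r_00 D) s31 s32 !mul1r.
- by have := orth o1 o2 isT; rewrite sum4 s21.
- by have := orth o1 o3 isT; rewrite sum4 s31 s32.
- by have := orth o2 o3 isT; rewrite sum4 s21 s31 s32.
- by have := r_orth D o1 o1; rewrite eqxx mulr1 D2E sum4.
- by have := r_orth D o2 o2; rewrite eqxx mulr1 D2E sum4 s21.
- by have := r_orth D o3 o3; rewrite eqxx mulr1 D2E sum4 s31 s32.
- by rewrite (r_norm D) D2E.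
- by have := tw o0 o0; rewrite sum4 !s0 (r_00 D) (r_twist0 D) invr1 !mulr1 !rmorph1 ?mulr1.
- by have := tw o0 o1; rewrite sum4 !s0 (r_00 D) (r_twist0 D) invr1 !mul1r mulr1.
- by have := tw o0 o2; rewrite sum4 !s0 (r_00 D) (r_twist0 D) invr1 !mul1r mulr1 s21.
- by have := tw o0 o3; rewrite sum4 !s0 (r_00 D) (r_twist0 D) invr1 !mul1r mulr1 s31 s32.
- by have := tw o1 o1; rewrite sum4 (r_twist0 D) mulr1.
- by have := tw o1 o2; rewrite sum4 (r_twist0 D) mulr1 s21.
- by have := tw o1 o3; rewrite sum4 (r_twist0 D) mulr1 s31 s32.
- by have := tw o2 o2; rewrite sum4 (r_twist0 D) mulr1 s21.
- by have := tw o2 o3; rewrite sum4 (r_twist0 D) mulr1 s21 s31 s32.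
- by have := tw o3 o3; rewrite sum4 (r_twist0 D) mulr1 s31 s32.
Qed.

Definition rank4_S (R : realType) (St : 'M[R[i]]_4) : Prop :=
  (exists w : R[i], (w = 'i \/ w = - 'i) /\ St = St1 w) \/
  St = St2 R[i] \/
  St = St3 R[i] \/
  St = St4 R[i] \/
  St = St5 R[i] \/
  (exists d : R, largest_real_root ('X^3 - 3 *: 'X - 1) d /\ St = St6 (d%:C)%C).

Definition classified (R : realType) (St : 'M[R[i]]_4) : Prop :=
  exists q : 'S_4, q ord0 = ord0 /\ rank4_S (mxsub q q St).

Lemma classified_relabel (R : realType) (St : 'M[R[i]]_4) (q : 'S_4) :
  q o0 = o0 -> classified (mxsub q q St) -> classified St.
Proof.
move=> q0 [r [r0 Sr]]; exists (r * q)%g; split; first by rewrite permM r0.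
suffices -> : mxsub (r * q)%g (r * q)%g St = mxsub r r (mxsub q q St) by [].
by apply/matrixP => i j; rewrite !mxE !permM.
Qed.

Lemma classified_id (R : realType) (St : 'M[R[i]]_4) : rank4_S St -> classified St.
Proof.
move=> cSt; exists 1%g; split; first by rewrite perm1.
suffices -> : mxsub (1%g : 'S_4) (1%g : 'S_4) St = St by [].
by apply/matrixP => i j; rewrite !mxE !perm1.
Qed.

Lemma perm4_exists (x y z : 'I_4) : x != o0 -> y != o0 -> z != o0 ->
  x != y -> x != z -> y != z ->
  exists q : 'S_4, [/\ q o0 = o0, q o1 = x, q o2 = y & q o3 = z].
Proof.
move=> x0 y0 z0 xy xz yz.
pose f (i : 'I_4) := nth o0 [:: o0; x; y; z] i.
have injf : injective f.
  apply: ord4_ind; apply: ord4_ind; rewrite /f //= => /eqP;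
    rewrite ?(negPf x0, negPf y0, negPf z0, negPf xy, negPf xz, negPf yz) //;
    rewrite eq_sym ?(negPf x0, negPf y0, negPf z0, negPf xy, negPf xz, negPf yz) //.
by exists (perm injf); rewrite !permE.
Qed.

(** The cases are the length of the cycle through 0, and for length 2 the action on the other two
    labels; [q] lists the successive images of 0 first. *)
Lemma perm4_normal_form (t : 'S_4) : t o0 != o0 -> exists q : 'S_4, q o0 = o0 /\
  let t' := (q * t * q^-1)%g in
  [\/ [/\ t' o0 = o1, t' o1 = o0, t' o2 = o2 & t' o3 = o3],
      [/\ t' o0 = o1, t' o1 = o0, t' o2 = o3 & t' o3 = o2],
      [/\ t' o0 = o1, t' o1 = o2, t' o2 = o0 & t' o3 = o3]
    | [/\ t' o0 = o1, t' o1 = o2, t' o2 = o3 & t' o3 = o0]].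
Proof.
move=> t0.
have tE (q : 'S_4) i j : t (q i) = q j -> (q * t * q^-1)%g i = j.
  by rewrite !permM => ->; rewrite permK.
have other (x y : 'I_4) : exists z, [/\ z != o0, z != x & z != y].
  by move: x y; apply: ord4_ind; apply: ord4_ind;
    first [by exists o1|by exists o2|by exists o3].
have tI i j : (t i == t j) = (i == j) by rewrite (inj_eq (@perm_inj _ t)).
have [x Ex] : exists x, x = t o0 by exists (t o0).
rewrite -Ex in t0; have tx_x : t x != x by rewrite {2}Ex tI.
have surj4 (y z : 'I_4) (q : 'S_4) : q o0 = o0 -> q o1 = x -> q o2 = y -> q o3 = z ->
    forall w, [\/ w = o0, w = x, w = y | w = z].
  move=> q0 q1 q2 q3 w; rewrite -(permKV q w); move: (q^-1%g w).
  by apply: ord4_ind; rewrite ?q0 ?q1 ?q2 ?q3;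
    [constructor 1|constructor 2|constructor 3|constructor 4].
have [tx|tx] := eqVneq (t x) o0.
  have [y [y0 yx _]] := other x x; have [z [z0 zx zy]] := other x y.
  have xy : x != y by rewrite eq_sym.
  have xz : x != z by rewrite eq_sym.
  have yz : y != z by rewrite eq_sym.
  have [q [q0 q1 q2 q3]] := perm4_exists t0 y0 z0 xy xz yz; exists q; split=> // t'.
  have all4 := surj4 y z q q0 q1 q2 q3.
  have ty0 : t y != o0 by rewrite -tx tI.
  have tyx : t y != x by rewrite Ex tI.
  have tz0 : t z != o0 by rewrite -tx tI.
  have tzx : t z != x by rewrite Ex tI.
  have tyz : t y != t z by rewrite tI.
  have [ty|ty] : t y = y \/ t y = z.
    by case: (all4 (t y)) => E; rewrite E ?eqxx in ty0 tyx *; [| |left|right].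
  - have tz : t z = z.
      by case: (all4 (t z)) => // E; rewrite E ?ty ?eqxx in tz0 tzx tyz.
    by constructor 1; split; apply: tE; rewrite ?q0 ?q1 ?q2 ?q3.
  - have tz : t z = y.
      by case: (all4 (t z)) => // E; rewrite E ?ty ?eqxx in tz0 tzx tyz.
    by constructor 2; split; apply: tE; rewrite ?q0 ?q1 ?q2 ?q3.
have [y Ey] : exists y, y = t x by exists (t x).
rewrite -Ey in tx tx_x; have [z [z0 zx zy]] := other x y.
have xy : x != y by rewrite eq_sym.
have xz : x != z by rewrite eq_sym.
have yz : y != z by rewrite eq_sym.
have [q [q0 q1 q2 q3]] := perm4_exists t0 tx z0 xy xz yz; exists q; split=> // t'.
have all4 := surj4 y z q q0 q1 q2 q3.
have tyx : t y != x by rewrite Ex tI.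
have tyy : t y != y by rewrite {2}Ey tI eq_sym.
have tzx : t z != x by rewrite Ex tI.
have tzy : t z != y by rewrite Ey tI.
have tyz : t y != t z by rewrite tI.
have [ty|ty] : t y = o0 \/ t y = z.
  by case: (all4 (t y)) => E; rewrite E ?eqxx in tyx tyy *; [left| | |right].
- have tz : t z = z.
    by case: (all4 (t z)) => // E; rewrite E ?ty ?eqxx in tzx tzy tyz.
  by constructor 3; split; apply: tE; rewrite ?q0 ?q1 ?q2 ?q3.
- have tz : t z = o0.
    by case: (all4 (t z)) => // E; rewrite E ?ty ?eqxx in tzx tzy tyz.
  by constructor 4; split; apply: tE; rewrite ?q0 ?q1 ?q2 ?q3.
Qed.

(** * The cycle types of Galois permutations moving 0 *)

Local Notation characters s := (fun i a => s i a / s a o0).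

Lemma real_modular_data_dim_neq0 (R : realType) (s : 'M[R]_4) th p i : real_modular_data s th p -> s i o0 != 0.
Proof. by move=> D; rewrite gt_eqF // (lt_le_trans ltr01 (r_ge1 D i)). Qed.

Lemma galois_perm_var (A : pzRingType) n (v : 'I_n -> 'I_n -> A) t i a j b :
  galois_perm v t -> v i a = v j b -> v i (t a) = v j (t b).
Proof. by move=> gal_t; apply: (galois_perm_eq (e1 := Var i a) (e2 := Var j b) gal_t). Qed.

Lemma galois_perm_one (A : pzRingType) n (v : 'I_n -> 'I_n -> A) t i a :
  galois_perm v t -> v i a = 1 -> v i (t a) = 1.
Proof. by move=> gal_t; apply: (galois_perm_eq (e1 := Var i a) (e2 := Cst 1) gal_t). Qed.

Lemma conj_permE n (q t : 'S_n) i j : t (q i) = q j -> (q * t * q^-1)%g i = j.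
Proof. by rewrite !permM => ->; rewrite permK. Qed.

Lemma lam_relabel (R : realType) (s : 'M[R]_4) (q : 'S_4) : q o0 = o0 ->
  (fun i a => s (q i) (q a) / s (q a) o0) = characters (mxsub q q s).
Proof. by move=> q0; apply/funext => i; apply/funext => j; rewrite !mxE q0. Qed.

Lemma galois_perm_conj (R : realType) (s : 'M[R]_4) (q t : 'S_4) : q o0 = o0 ->
  galois_perm (characters s) t -> galois_perm (characters (mxsub q q s)) (q * t * q^-1)%g.
Proof. by move=> q0 /(galois_perm_unrelabel (q := q)); rewrite lam_relabel. Qed.

(** The two arithmetic premises of [four_cycle_false] are relations between the dimensions
    transported by [t] from column 0 to column 1. *)
Lemma four_cycle_normal_false (R : realType) (s : 'M[R]_4) th p t :
  real_modular_data s th p -> galois_perm (characters s) t ->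
  [/\ t o0 = o1, t o1 = o2, t o2 = o3 & t o3 = o0] ->
  [/\ s o1 o1 = - s o2 o0, s o1 o2 = s o3 o0, s o1 o3 = 1, s o2 o2 = -1 &
   [/\ s o2 o3 = - s o1 o0, s o3 o3 = s o2 o0 &
     s o1 o0 + s o3 o0 = s o2 o0 * (s o1 o0 - s o3 o0)]] -> False.
Proof.
move=> D gal_t [t0 t1 t2 t3] [e11 e12 e13 e22 [e23 e33 rel]].
have := real_modular_data_data4 D; rewrite e11 e12 e13 e22 e23 e33 => D4.
have a0 := real_modular_data_dim_neq0 o1 D; have s21 := r_sym D o2 o1; have s31 := r_sym D o3 o1.
have aa0 : s o1 o0 * s o1 o0 != 0 by rewrite mulf_neq0.
apply: (four_cycle_false D4 rel) => h.
- have /= := galois_perm_eq (e1 := Mul (Var o1 o0) (Var o3 o0))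
    (e2 := Mul (Var o2 o0) (Var o2 o0)) gal_t.
  rewrite t0 (r_00 D) !divr1 h s21 s31 e11 e12 e13 => /(_ erefl) h2.
  apply: (mulIf (invr_neq0 aa0)); rewrite invfM; move: h2; rewrite mulrACA [RHS]mulrACA.
  by rewrite mulr1.
- pose Q := Mul (Var o1 o0) (Var o3 o0); pose B := Mul (Var o2 o0) (Var o2 o0).
  have /= := galois_perm_eq (e1 := Mul Q (Add B (Cst (-1))))
    (e2 := Add (Mul Q Q) (Mul (Cst 3) B)) gal_t.
  rewrite t0 (r_00 D) !divr1 mulrN1z h s21 s31 e11 e12 e13 => /(_ erefl) h2.
  have := congr1 (fun w => w * (s o1 o0 * s o1 o0 * (s o1 o0 * s o1 o0))) h2.
  move: (s o1 o0) (s o2 o0) (s o3 o0) a0 => a b c a0 {}h2.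
  transitivity (- (b * (c * c - a * a))); first by ring.
  transitivity (- (b / a * (1 / a)) * (c / a * (c / a) - 1) * (a * a * (a * a))).
    by field; rewrite a0.
  rewrite (_ : - (b / a * (1 / a)) = - b / a * (1 / a)); last by ring.
  by rewrite h2; field; rewrite a0.
Qed.

Lemma four_cycle_excluded (R : realType) (s : 'M[R]_4) th p t :
  real_modular_data s th p -> galois_perm (characters s) t ->
  [/\ t o0 = o1, t o1 = o2, t o2 = o3 & t o3 = o0] -> False.
Proof.
move=> D gal_t tE; have [t0 t1 t2 t3] := tE.
have D4 := real_modular_data_data4 D; have sq := r_sqr D gal_t.
have s00 := r_00 D.
have [[a0 b0] c0] := (real_modular_data_dim_neq0 o1 D, real_modular_data_dim_neq0 o2 D, real_modular_data_dim_neq0 o3 D).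
have s21 := r_sym D o2 o1; have s31 := r_sym D o3 o1; have s32 := r_sym D o3 o2.
have s01 := r_sym D o0 o1; have s02 := r_sym D o0 o2; have s03 := r_sym D o0 o3.
have g2 : s o1 o3 ^+ 2 = 1 by have := sq o3 o0; rewrite t0 t3 s31 s00 => ->; rewrite expr1n.
have gv := galois_perm_var gal_t.
case: (four_cycle_signs D4).
- by have := sq o1 o0; rewrite t0 t1.
- by have := sq o2 o0; rewrite t0 t2 s21.
- exact: g2.
- by have := sq o2 o1; rewrite t1 t2 s31 => ->.
- by have := sq o3 o1; rewrite t1 t3 s32 s01.
- by have := sq o3 o2; rewrite t2 t3 s02.
- move=> h; have /= := galois_perm_one (i := o1) (a := o0) gal_t.
  by rewrite t0 s00 divr1 h => /(_ erefl); rewrite divr1.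
- move=> h; have /= := gv o1 o0 o1 o1.
  rewrite t0 t1 s00 divr1 -h mulfK // => /(_ erefl) h2.
  have <- : s o1 o0 * s o2 o0 = s o1 o2 by rewrite h2 divfK.
  by rewrite mulrAC mulrC mulrA mulrC mulrA.
- move=> h; have gal_tt := galois_permM gal_t gal_t.
  have /= := galois_perm_var (i := o1) (a := o0) (j := o3) (b := o0) gal_tt.
  by rewrite !permM t0 t1 s00 !divr1 => /(_ h) /(mulIf (invr_neq0 b0)); rewrite s32.
- by case=> e f g x [y z r]; apply: (four_cycle_normal_false D gal_t tE).
case=> z y g x [f e r].
(* In the mirror pattern, exchanging labels 1 and 3 inverts the cycle; the inverse is the third
   power of [t], hence again a Galois permutation. *)
have [q [q0 q1 q2 q3]] : exists q : 'S_4, [/\ q o0 = o0, q o1 = o3, q o2 = o2 & q o3 = o1].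
  exact: perm4_exists.
have gal_t3 := galois_permM gal_t (galois_permM gal_t gal_t).
have D' := real_modular_data_relabel q0 D.
apply: (four_cycle_normal_false D' (galois_perm_conj q0 gal_t3)).
  by split; apply: conj_permE; rewrite !permM ?(q0, q1, q2, q3) !(t0, t1, t2, t3).
by rewrite !mxE q0 q1 q2 q3 s21 s31 s32.
Qed.

Definition complex_mx (R : realType) (s : 'M[R]_4) : 'M[R[i]]_4 := map_mx (fun x : R => x%:C : R[i]) s.

Lemma complex_mx_mx4 (R : realType) (s : 'M[R]_4) (a b c e f g x y z : R) :
  (forall i j, s i j = s j i) -> s o0 o0 = 1 ->
  s o1 o0 = a -> s o2 o0 = b -> s o3 o0 = c ->
  s o1 o1 = e -> s o1 o2 = f -> s o1 o3 = g -> s o2 o2 = x -> s o2 o3 = y -> s o3 o3 = z ->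
  complex_mx s = mx4 [:: [:: 1; a%:C; b%:C; c%:C]; [:: a%:C; e%:C; f%:C; g%:C];
                 [:: b%:C; f%:C; x%:C; y%:C]; [:: c%:C; g%:C; y%:C; z%:C]].
Proof.
move=> sym s00 s10 s20 s30 s11 s12 s13 s22 s23 s33.
apply/matrixP; apply: ord4_ind; apply: ord4_ind; rewrite !mxE /= ?s00 ?rmorph1 //.
all: by rewrite ?s10 ?s20 ?s30 ?s11 ?s12 ?s13 ?s22 ?s23 ?s33 // sym
  ?s10 ?s20 ?s30 ?s11 ?s12 ?s13 ?s22 ?s23 ?s33.
Qed.

Lemma complex_mx_mxsub (R : realType) (s : 'M[R]_4) (q : 'S_4) : mxsub q q (complex_mx s) = complex_mx (mxsub q q s).
Proof. by apply/matrixP => i j; rewrite !mxE. Qed.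

Lemma cubic_largest_root (R : realType) (a : R) : 1 <= a -> a ^+ 3 - 3 * a - 1 = 0 ->
  largest_real_root ('X^3 - 3 *: 'X - 1) a.
Proof.
move=> ga a0; split; first by rewrite /root !hornerE; apply/eqP.
move=> x; rewrite /root !hornerE => /eqP x0; rewrite leNgt; apply/negP => lt_ax.
have : (x - a) * (x * x + x * a + a * a - 3) = 0.
  transitivity (x ^+ 3 - 3 * x - 1 - (a ^+ 3 - 3 * a - 1)); first by ring.
  by rewrite x0 a0 subrr.
apply/eqP; rewrite mulf_neq0 ?gt_eqF ?subr_gt0 //.
have aa : 1 <= a * a by rewrite -[leLHS]mulr1 ler_pM.
have xa : 1 < x * a by apply: (le_lt_trans aa); rewrite ltr_pM2r // (lt_le_trans ltr01).
have xx : 1 < x * x by apply: (lt_trans xa); rewrite ltr_pM2l //; lra.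
by lra.
Qed.

(** The entries of column 3 in rows 0, 1, 2 have equal squares. If [u] moved 3, two of these rows
    would have equal squares in one of the columns 0, 1, 2, where the squares are those of the
    distinct numbers 1, [a] and [b]. *)
Lemma three_cycle_fixed (R : realType) (s : 'M[R]_4) th p t u :
  real_modular_data s th p -> galois_perm (characters s) t -> galois_perm (characters s) u ->
  [/\ t o0 = o1, t o1 = o2, t o2 = o0 & t o3 = o3] ->
  [/\ s o1 o1 = - s o2 o0, s o1 o2 = -1, s o1 o3 = s o3 o0, s o2 o2 = s o1 o0 &
   [/\ s o2 o3 = - s o3 o0, s o3 o3 = s o2 o0 - s o1 o0 - 1 &
     s o3 o0 * s o3 o0 = s o1 o0 * s o2 o0 + s o2 o0 - s o1 o0]] ->
  s o1 o0 != 1 -> s o2 o0 != 1 -> s o1 o0 != s o2 o0 -> u o3 = o3.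
Proof.
move=> D gal_t gal_u [t0 t1 t2 t3] [e f g x [y z r]] a1 b1 ab.
have ga := r_ge1 D o1; have gb := r_ge1 D o2; have gc := r_ge1 D o3.
have s00 := r_00 D.
have [[a0 b0] c0] := (real_modular_data_dim_neq0 o1 D, real_modular_data_dim_neq0 o2 D, real_modular_data_dim_neq0 o3 D).
have s21 := r_sym D o2 o1; have s31 := r_sym D o3 o1; have s32 := r_sym D o3 o2.
have s01 := r_sym D o0 o1; have s02 := r_sym D o0 o2; have s03 := r_sym D o0 o3.
have sq := r_sqr D gal_u.
apply/eqP; apply: contraT => u3.
have col i : u i != o3 -> s i (u o3) ^+ 2 = s o3 o0 ^+ 2.
  rewrite sq; move: (u i); apply: ord4_ind => //= _; rewrite ?s03 ?g //.
  by rewrite y sqrrN.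
have two : [\/ u o0 != o3 /\ u o1 != o3, u o0 != o3 /\ u o2 != o3 | u o1 != o3 /\ u o2 != o3].
  have [E0|n0] := eqVneq (u o0) o3.
    by constructor 3; rewrite -E0 !(inj_eq (@perm_inj _ u)).
  have [E1|n1] := eqVneq (u o1) o3.
    by constructor 2; rewrite -E1 !(inj_eq (@perm_inj _ u)).
  by constructor 1.
have ne (v w : R) : 1 <= v -> 1 <= w -> v != w -> v ^+ 2 != w ^+ 2.
  by move=> v1 w1; rewrite eqrXn2 //; lra.
have [a1' b1' ba] : [/\ 1 != s o1 o0, 1 != s o2 o0 & s o2 o0 != s o1 o0].
  by split; rewrite eq_sym.
exfalso; case: two => -[/col + /col]; move: (u o3) u3; apply: ord4_ind => // _;
  rewrite ?(e, f, x, s00, s01, s02, s21, sqrrN) => <- /eqP; apply/negP; exact: ne.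
Qed.

Lemma three_cycle_normal (R : realType) (s : 'M[R]_4) th p t :
  real_modular_data s th p -> galois_perm (characters s) t ->
  [/\ t o0 = o1, t o1 = o2, t o2 = o0 & t o3 = o3] ->
  [/\ s o1 o1 = - s o2 o0, s o1 o2 = -1, s o1 o3 = s o3 o0, s o2 o2 = s o1 o0 &
   [/\ s o2 o3 = - s o3 o0, s o3 o3 = s o2 o0 - s o1 o0 - 1 &
     s o3 o0 * s o3 o0 = s o1 o0 * s o2 o0 + s o2 o0 - s o1 o0]] ->
  s o1 o0 != 1 -> s o2 o0 != 1 -> s o1 o0 != s o2 o0 -> classified (complex_mx s).
Proof.
move=> D gal_t tE sE a1 b1 ab; have [e f g x [y z r]] := sE.
have [m zm] : exists m : int, s o3 o3 / s o3 o0 = m%:~R.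
  apply: (r_int D (e := Var o3 o3)) => u gal_u /=.
  by rewrite (three_cycle_fixed D gal_t gal_u tE sE a1 b1 ab).
have [[a0 b0] c0] := (real_modular_data_dim_neq0 o1 D, real_modular_data_dim_neq0 o2 D, real_modular_data_dim_neq0 o3 D).
have s21 := r_sym D o2 o1; have s31 := r_sym D o3 o1; have s32 := r_sym D o3 o2.
have s01 := r_sym D o0 o1; have s02 := r_sym D o0 o2; have s03 := r_sym D o0 o3.
have D2E : \sum_k s k o0 ^+ 2 = 1 + s o1 o0 * s o1 o0 + s o2 o0 * s o2 o0 + s o3 o0 * s o3 o0.
  by rewrite sum4 (r_00 D) expr1n !expr2.
have [n1 n1E] := r_coef D o3 o3 o1; have [n3 n3E] := r_coef D o3 o3 o3.
have := real_modular_data_data4 D; rewrite e f g x y => D4.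
have zE : s o3 o3 = m%:~R * s o3 o0 by rewrite -zm divfK.
have [] := three_cycle_core (n1 := n1) (n3 := n3) D4 z r zE a1.
- rewrite -D2E n1E sum4 s31 s32 (r_00 D) e f g y; field; first by rewrite ?a0 ?b0 ?c0.
- rewrite -D2E n3E sum4 s31 s32 (r_00 D) g y; field; first by rewrite ?a0 ?b0 ?c0.
move=> z0 bE cE aE.
have [q [q0 q1 q2 q3]] : exists q : 'S_4, [/\ q o0 = o0, q o1 = o3, q o2 = o2 & q o3 = o1].
  exact: perm4_exists.
exists q; split=> //; do 5!right; exists (s o1 o0); split.
  exact: cubic_largest_root (r_ge1 D o1) aE.
have cE' : s o3 o0 = s o1 o0 ^+ 2 - 1 by rewrite expr2.
rewrite complex_mx_mxsub.
rewrite (complex_mx_mx4 (a := s o1 o0 ^+ 2 - 1) (b := s o1 o0 + 1) (c := s o1 o0)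
  (e := 0) (f := - s o1 o0 ^+ 2 + 1) (g := s o1 o0 ^+ 2 - 1) (x := s o1 o0) (y := -1)
  (z := - s o1 o0 - 1)).
- by rewrite !(rmorphD, rmorphN, rmorphXn, rmorph1, rmorph0).
- by move=> i j; rewrite !mxE (r_sym D).
all: rewrite ?mxE ?q0 ?q1 ?q2 ?q3 ?(r_00 D) //.
all: by rewrite ?s32 ?s31 ?s21 ?y ?g ?f ?e ?cE' ?bE ?opprD ?opprK.
Qed.

Lemma three_cycle_classified (R : realType) (s : 'M[R]_4) th p t :
  real_modular_data s th p -> galois_perm (characters s) t ->
  [/\ t o0 = o1, t o1 = o2, t o2 = o0 & t o3 = o3] -> classified (complex_mx s).
Proof.
move=> D gal_t tE; have [t0 t1 t2 t3] := tE.
have s00 := r_00 D; have sq := r_sqr D gal_t.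
have [[a0 b0] c0] := (real_modular_data_dim_neq0 o1 D, real_modular_data_dim_neq0 o2 D, real_modular_data_dim_neq0 o3 D).
have s21 := r_sym D o2 o1; have s31 := r_sym D o3 o1; have s32 := r_sym D o3 o2.
have s01 := r_sym D o0 o1; have s02 := r_sym D o0 o2; have s03 := r_sym D o0 o3.
have G1 : s o1 o0 = 1 -> s o1 o1 = s o1 o0.
  move=> h; have /= := galois_perm_one (i := o1) (a := o0) gal_t.
  by rewrite t0 s00 divr1 h => /(_ erefl); rewrite divr1.
have G2 : s o2 o0 = 1 -> s o1 o2 = s o1 o0.
  move=> h; have /= := galois_perm_one (i := o2) (a := o0) gal_t.
  by rewrite t0 s00 divr1 h s21 => /(_ erefl) h2; rewrite -[LHS](divfK a0) h2 mul1r.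
have G3 : s o1 o0 = s o2 o0 -> s o1 o1 = s o1 o2.
  move=> h; have /= := galois_perm_var (i := o1) (a := o0) (j := o2) (b := o0) gal_t.
  by rewrite t0 s00 !divr1 s21 => /(_ h)/(mulIf (invr_neq0 a0)).
have [ga gb] := (r_ge1 D o1, r_ge1 D o2).
case: (three_cycle_signs (real_modular_data_data4 D)) => //.
- by have := sq o1 o0; rewrite t0 t1.
- by have := sq o2 o0; rewrite t0 t2 s21 s00 expr1n.
- by have := sq o3 o0; rewrite t0 t3 s31.
- by have := sq o2 o1; rewrite t1 t2 s01.
- by have := sq o3 o1; rewrite t1 t3 s32 s31 => ->; have := sq o3 o0; rewrite t0 t3 s31.
- move=> sE; have [e f g x [y z r]] := sE.
  apply: (three_cycle_normal D gal_t tE sE); apply/eqP => h.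
  + by have := G1 h; lra.
  + by have := G2 h; lra.
  + by have := G3 h; have := G1; lra.
move=> [e f g x [y z r]].
have [q [q0 q1 q2 q3]] : exists q : 'S_4, [/\ q o0 = o0, q o1 = o2, q o2 = o1 & q o3 = o3].
  exact: perm4_exists.
apply: (classified_relabel q0); rewrite complex_mx_mxsub.
have gal_t2 := galois_permM gal_t gal_t.
apply: (three_cycle_normal (real_modular_data_relabel q0 D) (galois_perm_conj q0 gal_t2)).
all: rewrite ?mxE ?q0 ?q1 ?q2 ?q3.
- by split; apply: conj_permE; rewrite !permM ?(q0, q1, q2, q3) !(t0, t1, t2, t3).
- by split; rewrite ?mxE ?q0 ?q1 ?q2 ?q3 ?s21 //; split; rewrite ?mxE ?q0 ?q1 ?q2 ?q3 ?s31 //; lra.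
- by apply/eqP => h; have := G2 h; lra.
- by apply/eqP => h; have := G1 h; lra.
- by apply/eqP => h; have := G3 (esym h); lra.
Qed.

(** Columns 0 and 1 have no zero entry, and the zeros at (2, 3) and (3, 2) force [u] to preserve the
    labels 2 and 3 as a set. Swapping them would make the dimensions of 2 and 3 equal, although
    their squares differ by [2 * a]. *)
Lemma transposition_fixed (R : realType) (s : 'M[R]_4) th p u :
  real_modular_data s th p -> galois_perm (characters s) u ->
  [/\ s o1 o1 = 1, s o1 o2 = s o2 o0, s o1 o3 = - s o3 o0, s o2 o2 = - (1 + s o1 o0) &
   [/\ s o2 o3 = 0, s o3 o3 = s o1 o0 - 1 &
     s o3 o0 * s o3 o0 = s o2 o0 * s o2 o0 + 2 * s o1 o0]] ->
  u o2 = o2 /\ u o3 = o3.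
Proof.
move=> D gal_u [e f g x [y z r]].
have ga := r_ge1 D o1; have gb := r_ge1 D o2; have gc := r_ge1 D o3.
have s00 := r_00 D.
have [[a0 b0] c0] := (real_modular_data_dim_neq0 o1 D, real_modular_data_dim_neq0 o2 D, real_modular_data_dim_neq0 o3 D).
have s21 := r_sym D o2 o1; have s31 := r_sym D o3 o1; have s32 := r_sym D o3 o2.
have s01 := r_sym D o0 o1; have s02 := r_sym D o0 o2; have s03 := r_sym D o0 o3.
have sq := r_sqr D gal_u.
have uI i j : (u i == u j) = (i == j) by rewrite (inj_eq (@perm_inj _ u)).
have zero_col j k : s (u k) j = 0 -> s k (u j) = 0.
  by move=> h; apply/eqP; rewrite -sqrf_eq0 sq h expr0n.
have inv2 : exists k, u k = o2 by exists (u^-1%g o2); rewrite permKV.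
have inv3 : exists k, u k = o3 by exists (u^-1%g o3); rewrite permKV.
have col0 k j : s k j = 0 -> j = o2 \/ j = o3.
  move: j; apply: ord4_ind => h; try (by left); try (by right); exfalso.
    by have := r_ge1 D k; rewrite h; lra.
  move: h; move: k; apply: ord4_ind => /eqP.
  - by rewrite s01 (negPf a0).
  - by rewrite e oner_eq0.
  - by rewrite s21 f (negPf b0).
  - by rewrite s31 g oppr_eq0 (negPf c0).
have u2 : u o2 = o2 \/ u o2 = o3.
  by have [k uk] := inv3; apply: (col0 k); apply: zero_col; rewrite uk s32.
have u3 : u o3 = o2 \/ u o3 = o3.
  by have [k uk] := inv2; apply: (col0 k); apply: zero_col; rewrite uk.
case: u2 => u2; case: u3 => u3; try by [].
- by have := uI o2 o3; rewrite u2 u3 eqxx.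
- have u01 : u o0 = o0 \/ u o0 = o1.
    have := uI o0 o2; have := uI o0 o3; rewrite u2 u3.
    by move: (u o0); apply: ord4_ind; rewrite ?eqxx //; [left|right].
  have : s o3 o0 ^+ 2 = s o2 o0 ^+ 2.
    by have := sq o0 o2; rewrite u2 s03 => ->; case: u01 => ->; rewrite ?s02 ?f.
  rewrite !expr2 => h; have /eqP : s o1 o0 = 0 by lra.
  by rewrite (negPf a0).
- by have := uI o2 o3; rewrite u2 u3 eqxx.
Qed.

Lemma transposition_normal_false (R : realType) (s : 'M[R]_4) th p :
  real_modular_data s th p ->
  [/\ s o1 o1 = 1, s o1 o2 = s o2 o0, s o1 o3 = - s o3 o0, s o2 o2 = - (1 + s o1 o0) &
   [/\ s o2 o3 = 0, s o3 o3 = s o1 o0 - 1 &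
     s o3 o0 * s o3 o0 = s o2 o0 * s o2 o0 + 2 * s o1 o0]] -> False.
Proof.
move=> D sE; have [e f g x [y z r]] := sE.
have [b0 c0] := (real_modular_data_dim_neq0 o2 D, real_modular_data_dim_neq0 o3 D).
have [m m2] : exists m : int, s o2 o2 / s o2 o0 = m%:~R.
  apply: (r_int D (e := Var o2 o2)) => u gal_u /=.
  by have [-> _] := transposition_fixed D gal_u sE.
have [n n3] : exists n : int, s o3 o3 / s o3 o0 = n%:~R.
  apply: (r_int D (e := Var o3 o3)) => u gal_u /=.
  by have [_ ->] := transposition_fixed D gal_u sE.
have := real_modular_data_data4 D; rewrite e f g x y z => D4.
apply: (transposition_false (m2 := - m) (m3 := n) D4 r).
- by rewrite mulrNz mulNr -m2 divfK // x opprK.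
- by rewrite -n3 divfK.
Qed.

Lemma transposition_excluded (R : realType) (s : 'M[R]_4) th p t :
  real_modular_data s th p -> galois_perm (characters s) t ->
  [/\ t o0 = o1, t o1 = o0, t o2 = o2 & t o3 = o3] -> False.
Proof.
move=> D gal_t [t0 t1 t2 t3].
have s00 := r_00 D; have sq := r_sqr D gal_t.
have [[a0 b0] c0] := (real_modular_data_dim_neq0 o1 D, real_modular_data_dim_neq0 o2 D, real_modular_data_dim_neq0 o3 D).
have s21 := r_sym D o2 o1; have s31 := r_sym D o3 o1; have s32 := r_sym D o3 o2.
have s01 := r_sym D o0 o1; have s02 := r_sym D o0 o2; have s03 := r_sym D o0 o3.
case: (transposition_signs (real_modular_data_data4 D)).
- by have := sq o1 o0; rewrite t0 t1 s00 expr1n.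
- by have := sq o2 o0; rewrite t0 t2 s21.
- by have := sq o3 o0; rewrite t0 t3 s31.
- move=> h; have /= := galois_perm_var (i := o2) (a := o0) (j := o3) (b := o0) gal_t.
  by rewrite t0 s00 !divr1 s21 s31 => /(_ h)/(mulIf (invr_neq0 a0)).
- move=> h; have /= := galois_perm_var (i := o2) (a := o3) (j := o2) (b := o0) gal_t.
  rewrite t0 t3 s00 divr1 h mulfK // s21 => /(_ erefl) ->.
  by field.
- move=> h; have /= := galois_perm_var (i := o2) (a := o3) (j := o2) (b := o1) gal_t.
  rewrite t1 t3 s00 divr1 s21 => h2; rewrite -[LHS](divfK c0) h2 //.
  by apply/eqP; rewrite eqr_div // mulrC h mulrC.
- exact: transposition_normal_false D.
move=> [e f g z [y x r]].
have [q [q0 q1 q2 q3]] : exists q : 'S_4, [/\ q o0 = o0, q o1 = o1, q o2 = o3 & q o3 = o2].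
  exact: perm4_exists.
apply: (transposition_normal_false (real_modular_data_relabel q0 D)).
by rewrite !mxE q0 q1 q2 q3 s32.
Qed.

Lemma golden_realC (R : realType) (u : R) : 1 <= u -> u * u = u + 1 -> golden R[i] = u%:C.
Proof.
move=> gu uu; rewrite /golden.
have -> : sqrtC (5 : R[i]) = (2 * u - 1)%:C.
  rewrite -[RHS]sqrCK ?ler0c; last by lra.
  congr sqrtC; rewrite -rmorphXn /= -[LHS](rmorph_nat (@real_complex R) 5); congr (_%:C).
  by rewrite expr2; lra.
rewrite rmorphB rmorphM /= rmorph1 (rmorph_nat (@real_complex R) 2).
by field.
Qed.

(** The hypothesis describes the Kronecker product of two matrices with rows (1, u) and (u, -1). The
    Verlinde formula gives [u * u - 1] as a natural multiple of [u] for each factor, so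
    [product_golden] applies. *)
Lemma product_classified (R : realType) (s : 'M[R]_4) th p :
  real_modular_data s th p ->
  [/\ s o3 o0 = s o1 o0 * s o2 o0, s o1 o1 = -1, s o1 o2 = s o3 o0, s o1 o3 = - s o2 o0 &
   [/\ s o2 o2 = -1, s o2 o3 = - s o1 o0 & s o3 o3 = 1]] -> classified (complex_mx s).
Proof.
move=> D [c e f g [x y z]].
have s00 := r_00 D.
have [[a0 b0] c0] := (real_modular_data_dim_neq0 o1 D, real_modular_data_dim_neq0 o2 D, real_modular_data_dim_neq0 o3 D).
have s21 := r_sym D o2 o1; have s31 := r_sym D o3 o1; have s32 := r_sym D o3 o2.
have s01 := r_sym D o0 o1; have s02 := r_sym D o0 o2; have s03 := r_sym D o0 o3.
have D2E : \sum_k s k o0 ^+ 2 = (1 + s o1 o0 * s o1 o0) * (1 + s o2 o0 * s o2 o0).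
  by rewrite sum4 s00 c; ring.
have [ga gb] := (r_ge1 D o1, r_ge1 D o2).
have coef (u v : R) n : 1 <= u -> 1 <= v ->
    n%:R * ((1 + u * u) * (1 + v * v)) = (u * u * u - 1 / u) * (1 + v * v) -> u * u - 1 = n%:R * u.
  move=> gu gv h; have v0 : 1 + v * v != 0 by rewrite gt_eqF //; nra.
  have u0 : 1 + u * u != 0 by rewrite gt_eqF //; nra.
  apply: (mulfI u0); apply: (mulIf v0).
  have -> : (1 + u * u) * (n%:R * u) * (1 + v * v) = n%:R * ((1 + u * u) * (1 + v * v)) * u by ring.
  by rewrite h; field; rewrite gt_eqF; lra.
have [n n1] := r_coef D o1 o1 o1; have [m m2] := r_coef D o2 o2 o2.
rewrite D2E sum4 s00 e f g c in n1; rewrite D2E sum4 s00 s21 f x y c in m2.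
have := real_modular_data_data4 D; rewrite e f g x y z c => D4.
have := product_golden (k := n) (l := m) D4.
case.
- by apply: (coef _ (s o2 o0)); rewrite // n1; field; rewrite a0 b0.
- by apply: (coef _ (s o1 o0)); rewrite // [(1 + s o2 o0 * _) * _]mulrC m2; field; rewrite a0 b0.
have rSE := complex_mx_mx4 (r_sym D) s00 erefl erefl erefl erefl erefl erefl erefl erefl erefl.
case=> [a1|aa] [b1|bb].
- apply: classified_id; right; right; left.
  by rewrite rSE e f g x y z c a1 b1 !mulr1 /St3 !(rmorphN, rmorph1).
- have [q [q0 q1 q2 q3]] : exists q : 'S_4, [/\ q o0 = o0, q o1 = o2, q o2 = o1 & q o3 = o3].
    exact: perm4_exists.
  apply: (classified_relabel q0); rewrite complex_mx_mxsub; apply: classified_id; do 3!right; left.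
  have D' := real_modular_data_relabel q0 D.
  rewrite (complex_mx_mx4 (r_sym D') (r_00 D') erefl erefl erefl erefl erefl erefl erefl erefl erefl).
  rewrite !mxE q0 q1 q2 q3 s21 e f g x y z c a1 mul1r /St4 (golden_realC gb bb).
  by rewrite !(rmorphN, rmorph1).
- apply: classified_id; do 3!right; left.
  by rewrite rSE e f g x y z c b1 !mulr1 /St4 (golden_realC ga aa) !(rmorphN, rmorph1).
- apply: classified_id; do 4!right; left.
  have ab : s o2 o0 = s o1 o0.
    by have /eqP : (s o2 o0 - s o1 o0) * (s o2 o0 + s o1 o0 - 1) = 0; [lra|];
      rewrite mulf_eq0 subr_eq0 => /orP[/eqP //|/eqP]; lra.
  by rewrite rSE e f g x y z c ab /St5 (golden_realC ga aa) !(rmorphN, rmorph1) expr2 rmorphM.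
Qed.

(** * The case where all Galois permutations fix 0 *)

Lemma three_signs (R : realType) (e f g : R) :
  e * e <= 1 -> f * f <= 1 -> g * g <= 1 -> e * e + f * f + g * g = 3 -> e + f + g = -1 ->
  [\/ [/\ e = 1, f = -1 & g = -1], [/\ e = -1, f = 1 & g = -1] | [/\ e = -1, f = -1 & g = 1]].
Proof.
move=> e1 f1 g1 n.
have sgn (w : R) : w * w = 1 -> w = 1 \/ w = -1 by rewrite -expr2 => /sqr1_eqP.
have [ee ff gg] : [/\ e * e = 1, f * f = 1 & g * g = 1] by split; lra.
clear e1 f1 g1 n.
case: (sgn e ee) => ->; case: (sgn f ff) => ->; case: (sgn g gg) => -> h; try (by exfalso; lra).
- by constructor 1.
- by constructor 2.
- by constructor 3.
Qed.

(** With all dimensions 1, the entries are at most 1 in absolute value and every row has squared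
    norm 4, so they are signs. Rows 1 to 3 contain exactly one further 1 each, placed symmetrically:
    on the diagonal for [St2], otherwise [St3] up to relabelling. *)
Lemma pointed_classified (R : realType) (s : 'M[R]_4) th p : real_modular_data s th p ->
  (forall u, galois_perm (characters s) u -> u o0 = o0) -> classified (complex_mx s).
Proof.
move=> D fix0; have d1 := r_pointed D fix0; have s00 := r_00 D.
have bnd i j : s i j * s i j <= 1.
  rewrite -expr2 -real_normK ?num_real //.
  have := r_bound D i j; rewrite !d1 mulr1 => h.
  by rewrite expr_le1.
have := real_modular_data_data4 D; rewrite !d1 => D4.
have [b11 b12 b13] := And3 (bnd o1 o1) (bnd o1 o2) (bnd o1 o3).
have [b22 b23 b33] := And3 (bnd o2 o2) (bnd o2 o3) (bnd o3 o3).
have [r1 r2 r3] := And3 (or01 D4) (or02 D4) (or03 D4).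
have [n1 n2 n3] := And3 (or11 D4) (or22 D4) (or33 D4); clear D4.
have rSE := complex_mx_mx4 (r_sym D) s00 erefl erefl erefl erefl erefl erefl erefl erefl erefl.
have rot (q1 q2 q3 : 'I_4) : q1 != o0 -> q2 != o0 -> q3 != o0 -> q1 != q2 -> q1 != q3 -> q2 != q3 ->
  [/\ s q1 q1 = -1, s q1 q2 = 1, s q1 q3 = -1, s q2 q2 = -1 & [/\ s q2 q3 = -1 & s q3 q3 = 1]] ->
  classified (complex_mx s).
  move=> x0 y0 z0 xy xz yz; have [q [q0 <- <- <-]] := perm4_exists x0 y0 z0 xy xz yz.
  move=> [e f g x [y z]]; apply: (classified_relabel q0); rewrite complex_mx_mxsub.
  apply: classified_id; do 2!right; left; have D' := real_modular_data_relabel q0 D.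
  rewrite (complex_mx_mx4 (r_sym D') (r_00 D') erefl erefl erefl erefl erefl erefl erefl erefl erefl).
  by rewrite !mxE q0 !d1 e f g x y z /St3 !(rmorphN, rmorph1).
have s21 := r_sym D o2 o1; have s31 := r_sym D o3 o1; have s32 := r_sym D o3 o2.
have T1 := three_signs b11 b12 b13; have T2 := three_signs b12 b22 b23.
have T3 := three_signs b13 b23 b33; clear b11 b12 b13 b22 b23 b33.
have c1 : (1 : R) = -1 -> False by lra.
case: T1 => [||[e f g]|[e f g]|[e f g]]; [lra|lra| | | ]; rewrite ?(e, f, g) in T2 T3 r2 r3 n2 n3 *.
- case: T2 => [||[? x y]|[? x y]|[? x y]]; [lra|lra|exfalso; lra| | ]; rewrite ?(x, y) in T3 r3 n3 *.
  + have z : s o3 o3 = 1 by lra.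
    apply: classified_id; right; left.
    by rewrite rSE !d1 e f g x y z /St2 !(rmorphN, rmorph1).
  + have z : s o3 o3 = -1 by lra.
    by apply: (rot o2 o3 o1); rewrite // s21 s31.
- case: T2 => [||[? x y]|[? x y]|[? x y]]; [lra|lra| |exfalso; lra|exfalso; lra].
  have z : s o3 o3 = 1 by lra.
  by apply: (rot o1 o2 o3).
- case: T3 => [||[? y z]|[? y z]|[? y z]]; [lra|lra| |exfalso; lra|exfalso; lra].
  have x : s o2 o2 = 1 by lra.
  by apply: (rot o1 o3 o2); rewrite // s32.
Qed.

(** Integrality needs control of all Galois permutations at once. Assuming the conclusion false
    supplies it, since every other cycle type moving 0 is contradictory or already leads to the
    conclusion. *)
Lemma galois_double_transposition (R : realType) (s : 'M[R]_4) th p u :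
  real_modular_data s th p -> ~ classified (complex_mx s) -> galois_perm (characters s) u -> u o0 != o0 ->
  involutive u /\ forall i, u i != i.
Proof.
move=> D nC gal_u /perm4_normal_form[q [q0]].
have D' := real_modular_data_relabel q0 D; have gal' := galois_perm_conj q0 gal_u.
case=> tE.
- by case: (transposition_excluded D' gal' tE).
- move: tE; set t := (q * u * q^-1)%g => -[t0 t1 t2 t3].
  have tq i : t (q^-1%g i) = q^-1%g (u i) by rewrite !permM permKV.
  have tt : involutive t by apply: ord4_ind; rewrite ?(t0, t1, t2, t3).
  split=> i.
    apply: (@perm_inj _ q^-1%g); rewrite -!tq; exact: tt.
  apply/eqP => ui; have := tq i; rewrite ui.
  by move: (q^-1%g i); apply: ord4_ind; rewrite ?(t0, t1, t2, t3).
- by case: nC; apply: (classified_relabel q0); rewrite complex_mx_mxsub; apply: three_cycle_classified D' gal' tE.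
- by case: (four_cycle_excluded D' gal' tE).
Qed.

(** A double transposition sending 0 to 2 or 3 yields, through its squares, the entries that the
    swap of 0 and 1 leaves open. *)
Lemma double_transposition_far (R : realType) (s : 'M[R]_4) th p u :
  real_modular_data s th p -> galois_perm (characters s) u -> involutive u -> (forall i, u i != i) ->
  [/\ s o1 o1 = -1, s o1 o2 = s o3 o0, s o1 o3 = - s o2 o0 & s o3 o3 = - s o2 o2] ->
  u o0 != o0 -> u o0 != o1 -> classified (complex_mx s).
Proof.
move=> D gal_u uu un [e f g z] u00 u01; have sq := r_sqr D gal_u; have s00 := r_00 D.
have s01 := r_sym D o0 o1; have s32 := r_sym D o3 o2.
have uI i j : (u i == u j) = (i == j) by rewrite (inj_eq (@perm_inj _ u)).
have [x2 y2] : s o2 o2 ^+ 2 = 1 /\ s o2 o3 ^+ 2 = s o1 o0 ^+ 2.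
  have [u0|u0] : u o0 = o2 \/ u o0 = o3.
    by move: (u o0) u00 u01; apply: ord4_ind => //; [left|right].
  - have u2 : u o2 = o0 by rewrite -u0 uu.
    have u1 : u o1 = o3.
      have := uI o1 o0; have := uI o1 o2; have := un o1; rewrite u0 u2.
      by move: (u o1); apply: ord4_ind.
    by have := sq o2 o0; have := sq o2 o1; rewrite u0 u1 u2 s00 expr1n s01.
  - have u3 : u o3 = o0 by rewrite -u0 uu.
    have u1 : u o1 = o2.
      have := uI o1 o0; have := uI o1 o3; have := un o1; rewrite u0 u3.
      by move: (u o1); apply: ord4_ind.
    have := sq o3 o0; have := sq o3 o1; rewrite u0 u1 u3 s00 expr1n s01 z s32 => ->.
    by rewrite sqrrN.
have := real_modular_data_data4 D; rewrite e f g z => D4.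
have [x y c] := double_transposition_product D4 x2 y2.
by apply: (product_classified D); rewrite z x opprK.
Qed.

Lemma double_transposition_near (R : realType) (s : 'M[R]_4) th p t :
  real_modular_data s th p -> galois_perm (characters s) t ->
  [/\ t o0 = o1, t o1 = o0, t o2 = o3 & t o3 = o2] ->
  (forall u, galois_perm (characters s) u -> u o0 = o0 \/ u o0 = o1 /\ involutive u) ->
  [/\ s o1 o1 = -1, s o1 o2 = s o3 o0, s o1 o3 = - s o2 o0 & s o3 o3 = - s o2 o2] ->
  classified (complex_mx s).
Proof.
move=> D gal_t [t0 t1 t2 t3] near [e f g z].
have s00 := r_00 D.
have [[a0 b0] c0] := (real_modular_data_dim_neq0 o1 D, real_modular_data_dim_neq0 o2 D, real_modular_data_dim_neq0 o3 D).
have s21 := r_sym D o2 o1; have s31 := r_sym D o3 o1; have s32 := r_sym D o3 o2.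
have s01 := r_sym D o0 o1; have s02 := r_sym D o0 o2; have s03 := r_sym D o0 o3.
have blocks u : galois_perm (characters s) u ->
    (u o0 = o0 /\ u o1 = o1 \/ u o0 = o1 /\ u o1 = o0) /\
    (u o2 = o2 /\ u o3 = o3 \/ u o2 = o3 /\ u o3 = o2).
  move=> gal_u; have uI i j : (u i == u j) = (i == j) by rewrite (inj_eq (@perm_inj _ u)).
  have u01 : u o0 = o0 /\ u o1 = o1 \/ u o0 = o1 /\ u o1 = o0.
    have [u0|[u0 uu]] := near _ gal_u; last by right; rewrite -u0 uu.
    (* The composite sends 0 to [u o1], which therefore is 0 or 1, and 0 is taken. *)
    left; split=> //; have := near _ (galois_permM gal_u gal_t).
    by rewrite permM t0 => -[h|[]//]; have := uI o1 o0; rewrite h u0.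
  split=> //.
  have [[n20 n21] [n30 n31] n23] : [/\ u o2 != o0 /\ u o2 != o1, u o3 != o0 /\ u o3 != o1 & u o2 != u o3].
    rewrite uI; have := uI o2 o0; have := uI o2 o1; have := uI o3 o0; have := uI o3 o1.
    by case: u01 => -[-> ->] -> -> -> ->.
  move: (u o2) (u o3) n20 n21 n30 n31 n23; apply: ord4_ind => //; apply: ord4_ind => // *;
    by [left|right].
have [ga gb] := (r_ge1 D o1, r_ge1 D o2); have gc := r_ge1 D o3.
have a1 : s o1 o0 != 1.
  apply/eqP => h; have /= := galois_perm_one (i := o1) (a := o0) gal_t.
  by rewrite t0 s00 divr1 h e => /(_ erefl); lra.
have bc : s o2 o0 != s o3 o0.
  apply/eqP => h; have /= := galois_perm_var (i := o2) (a := o0) (j := o3) (b := o0) gal_t.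
  rewrite t0 s00 !divr1 s21 s31 f g => /(_ h)/(mulIf (invr_neq0 a0)); lra.
(* All Galois permutations preserve the blocks of columns 0, 1 and 2, 3, so sums and products over a
   block are integers. *)
have [k kE] : exists k : int, eval (characters s) (Add (Var o1 o0) (Var o1 o1)) = k%:~R.
  apply: (r_int D) => u /blocks[[[/= -> ->]//|[/= -> ->]] _]; exact: addrC.
have [q qE] : exists k : int, eval (characters s) (Mul (Var o2 o0) (Var o2 o1)) = k%:~R.
  apply: (r_int D) => u /blocks[[[/= -> ->]//|[/= -> ->]] _]; exact: mulrC.
have [l lE] : exists k : int, eval (characters s) (Add (Var o1 o2) (Var o1 o3)) = k%:~R.
  apply: (r_int D) => u /blocks[_ [[/= -> ->]//|[/= -> ->]]]; exact: addrC.
have [v vE] : exists k : int, eval (characters s) (Mul (Var o2 o2) (Var o2 o3)) = k%:~R.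
  apply: (r_int D) => u /blocks[_ [[/= -> ->]//|[/= -> ->]]]; exact: mulrC.
rewrite /= s00 !divr1 e in kE; rewrite /= s00 divr1 s21 f in qE.
rewrite /= f g in lE; rewrite /= in vE.
have [n n1] := r_coef D o1 o1 o1; rewrite !sum4 s00 e f g expr1n !expr2 in n1.
have := real_modular_data_data4 D; rewrite e f g z => D4.
have [] := double_transposition_core (k := k) (q := q) (l := l) (v := v) (n := n) D4 a1 bc.
- by rewrite -kE; field.
- by rewrite -qE; field.
- by rewrite -lE; field; rewrite b0 c0.
- by rewrite -vE; field; rewrite b0 c0.
- by rewrite n1; field; rewrite a0 b0 c0.
move=> x y c _; by apply: (product_classified D); rewrite z x opprK.
Qed.

Lemma double_transposition_normal (R : realType) (s : 'M[R]_4) th p t :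
  real_modular_data s th p -> galois_perm (characters s) t ->
  [/\ t o0 = o1, t o1 = o0, t o2 = o3 & t o3 = o2] ->
  [/\ s o1 o1 = -1, s o1 o2 = s o3 o0, s o1 o3 = - s o2 o0 & s o3 o3 = - s o2 o2] ->
  classified (complex_mx s).
Proof.
move=> D gal_t tE sE; have [//|nC] := pselect (classified (complex_mx s)).
apply: (double_transposition_near D gal_t tE) => // u gal_u.
have [|u00] := eqVneq (u o0) o0; first by left.
have [uu un] := galois_double_transposition D nC gal_u u00.
have [|u01] := eqVneq (u o0) o1; first by right.
by case: nC; apply: (double_transposition_far D gal_u).
Qed.

Lemma double_transposition_classified (R : realType) (s : 'M[R]_4) th p t :
  real_modular_data s th p -> galois_perm (characters s) t ->
  [/\ t o0 = o1, t o1 = o0, t o2 = o3 & t o3 = o2] -> classified (complex_mx s).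
Proof.
move=> D gal_t tE; have [t0 t1 t2 t3] := tE.
have s00 := r_00 D; have sq := r_sqr D gal_t.
have a0 := real_modular_data_dim_neq0 o1 D.
have s21 := r_sym D o2 o1; have s31 := r_sym D o3 o1; have s32 := r_sym D o3 o2.
case: (double_transposition_signs (real_modular_data_data4 D)).
- by have := sq o1 o0; rewrite t0 t1 s00 expr1n.
- by have := sq o2 o0; rewrite t0 t2 s21.
- by have := sq o3 o0; rewrite t0 t3 s31.
- move=> h; have /= := galois_perm_one (i := o2) (a := o0) gal_t.
  by rewrite t0 s00 divr1 h s21 => /(_ erefl) h2; rewrite -[LHS](divfK a0) h2 mul1r.
- move=> [e f g [x y z a]].
  have [q [q0 q1 q2 q3]] : exists q : 'S_4, [/\ q o0 = o0, q o1 = o2, q o2 = o3 & q o3 = o1].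
    exact: perm4_exists.
  apply: (classified_relabel q0); rewrite complex_mx_mxsub.
  apply: (product_classified (real_modular_data_relabel q0 D)).
  by rewrite !mxE q0 q1 q2 q3 s21 s31 e f g x y z a.
case=> sE.
  exact: (double_transposition_normal D gal_t tE sE).
have [e f g x] := sE.
have [q [q0 q1 q2 q3]] : exists q : 'S_4, [/\ q o0 = o0, q o1 = o1, q o2 = o3 & q o3 = o2].
  exact: perm4_exists.
apply: (classified_relabel q0); rewrite complex_mx_mxsub.
apply: (double_transposition_normal (real_modular_data_relabel q0 D) (galois_perm_conj q0 gal_t)).
- by split; apply: conj_permE; rewrite ?(q0, q1, q2, q3) (t0, t1, t2, t3).
- by rewrite !mxE q0 q1 q2 q3.
Qed.

Theorem real_modular_data_classified (R : realType) (s : 'M[R]_4) th p : real_modular_data s th p -> classified (complex_mx s).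
Proof.
move=> D; have [//|nC] := pselect (classified (complex_mx s)).
apply: (pointed_classified D) => u gal_u; apply/eqP; apply: contraT => u0.
have [uu un] := galois_double_transposition D nC gal_u u0.
have [q [q0]] := perm4_normal_form u0.
have D' := real_modular_data_relabel q0 D; have gal' := galois_perm_conj q0 gal_u.
case=> tE.
- by case: (transposition_excluded D' gal' tE).
- by case: nC; apply: (classified_relabel q0); rewrite complex_mx_mxsub; apply: double_transposition_classified D' gal' tE.
- by case: nC; apply: (classified_relabel q0); rewrite complex_mx_mxsub; apply: three_cycle_classified D' gal' tE.
- by case: (four_cycle_excluded D' gal' tE).
Qed.

(** * The two types of charge conjugation *)

Section SelfDual.
Variables (R : realType) (hat : 'I_4 -> 'I_4) (N : 'I_4 -> 'M[rat]_4) (S T : 'M[R[i]]_4).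
Hypothesis unitary_NST : unitary_modular_symbol hat N S T.
Hypothesis hat_id : forall i, hat i = i.

Local Notation st := (normalized_S S).
Let s : 'M[R]_4 := \matrix_(i, j) complex.Re (st i j).

Lemma st_realE i j : st i j = (s i j)%:C.
Proof.
have := mfr_hat (ms_fusion unitary_NST.1) i j; rewrite hat_id [s i j]mxE => st_conj.
apply/esym; apply: (@RRe_real R); apply/CrealP; exact/esym.
Qed.

Lemma lam_realE i a : lam S i a = (s i a / s a o0)%:C.
Proof. by rewrite /lam !st_realE fmorph_div. Qed.

Lemma eval_lam_real (f : 'I_4 -> 'I_4) e :
  eval (fun i a => lam S i (f a)) e = (eval (fun i a => s i (f a) / s (f a) o0) e)%:C.
Proof. by rewrite (eval_morph (real_complex R)); apply: eq_eval => i a; rewrite lam_realE. Qed.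

Lemma galois_perm_real t :
  galois_perm (fun i a => s i a / s a o0) t <-> galois_perm (lam S) t.
Proof.
split=> gal e.
- rewrite (eval_lam_real id) (eval_lam_real t) => /eqP; rewrite fmorph_eq0 => /eqP/gal ->.
  exact: rmorph0.
- move=> e0; apply/eqP; rewrite -(fmorph_eq0 (real_complex R)); apply/eqP.
  rewrite -[LHS](eval_lam_real t); apply: gal; rewrite (eval_lam_real id) /= e0.
  exact: rmorph0.
Qed.

Lemma self_dual_modular_data : real_modular_data s (fun i => T i i) (Dplus S T).
Proof.
have D2E : \sum_k st k o0 ^+ 2 = (\sum_k s k o0 ^+ 2)%:C.
  by rewrite rmorph_sum; apply: eq_bigr => k _; rewrite st_realE rmorphXn.
split.
- by move=> i j; apply: complexI; rewrite -!st_realE (st_sym unitary_NST).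
- by apply: complexI; rewrite -st_realE (d0 unitary_NST).
- by move=> i; rewrite -lecR -st_realE (dim_ge1 unitary_NST).
- move=> i j; rewrite -lecR rmorphM /= -!st_realE -norm_realC -st_realE.
  exact: st_bound unitary_NST i j.
- move=> i j; apply: complexI; rewrite rmorphM /= -D2E rmorph_nat -(st_orth unitary_NST).
  by rewrite rmorph_sum; apply: eq_bigr => k _; rewrite rmorphM /= -!st_realE [st j k]st_realE conj_realC.
- move=> i j k; exists (fusion_coef unitary_NST i j k); apply: complexI.
  rewrite rmorphM /= rmorph_nat -D2E (fusion_coefE unitary_NST) rmorph_sum.
  by apply: eq_bigr => l _; rewrite fmorph_div !rmorphM /= -!st_realE [st k l]st_realE conj_realC.
- exact: twist0 unitary_NST.
- exact: twist_norm unitary_NST.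
- by rewrite -D2E -(Dplus_norm unitary_NST) normCK.
- move=> i j; rewrite -st_realE -(STS unitary_NST).
  by apply: eq_bigr => k _; rewrite rmorphM /= -!st_realE.
- move=> e inv_e; have [|z Ez] := lam_galois_int unitary_NST (e := e).
    move=> t /galois_perm_real/inv_e e_t.
    by rewrite (eval_lam_real t) (eval_lam_real id) e_t.
  exists z; apply: complexI; rewrite -(eval_lam_real id) rmorph_int; exact: Ez.
- move=> t /galois_perm_real gal_t i j; apply: complexI.
  by rewrite !rmorphXn /= -!st_realE (galois_perm_sqr unitary_NST).
- move=> fix0 i; apply: complexI; rewrite -st_realE; apply: (pointed_dims_one unitary_NST).
  by move=> t /galois_perm_real/fix0.
Qed.

Lemma self_dual_classified : classified st.
Proof.
suffices -> : st = complex_mx s by apply: real_modular_data_classified self_dual_modular_data.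
by apply/matrixP => i j; rewrite [RHS]mxE -st_realE.
Qed.

End SelfDual.

(** Here [u] and [N] stand for the sum and the product of the diagonal entry at a non-self-dual
    label and its conjugate. *)
Lemma pointed_non_self_dual (R : realType) (e f u N : R) :
  `|e| <= 1 -> `|f| <= 1 -> 1 + e + 2 * f = 0 -> 1 + f + u = 0 ->
  1 + e * e + 2 * (f * f) = 4 -> 1 + f * f + 2 * N = 4 ->
  [/\ e = 1, f = -1, u = 0 & N = 1].
Proof.
move=> be bf r1 r2 n1 n2; have eE : e = - 1 - 2 * f by lra.
have f1 : f * f = 1.
  have : f * f <= 1 by rewrite -expr2 -real_normK ?num_real // expr_le1.
  have : e * e <= 1 by rewrite -expr2 -real_normK ?num_real // expr_le1.
  by lra.
have fE : f = -1 by subst e; lra.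
by subst f; split; lra.
Qed.

(* The fusion coefficient n = N_(2,2)^2 is (b - 1/b)/2, and the Gauss sum relation at
   (0, 1) bounds b. *)
Lemma swapping_non_self_dual (R : realType) (a b e f u N : R) (t1 t2 p : R[i]) (n : nat) :
  1 <= a -> 1 <= b -> e * e = 1 -> f * f = b * b ->
  a + a * e + 2 * (b * f) = 0 -> b + a * f + b * u = 0 ->
  b * b + f * f + 2 * N = 1 + a * a + 2 * (b * b) ->
  n%:R * (1 + a * a + 2 * (b * b)) = b * b * b + f * f * f / a + N * u / b ->
  `|t1| = 1 -> `|t2| = 1 -> `|p| ^+ 2 = (1 + a * a + 2 * (b * b))%:C ->
  (1 + e%:C * t1) * a%:C + (2 * b * f)%:C * t2 = p * a%:C / t1 ->
  [/\ b = 1, f = -1 & a = 1].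
Proof.
move=> ga gb ee ff r1 r2 n2 nE nt1 nt2 np tw.
have [a_gt0 b_gt0] : 0 < a /\ 0 < b by split; lra.
have e1 : e = 1.
  have /sqr1_eqP[//|eN] : e ^+ 2 = 1 by rewrite expr2.
  have /eqP : b * f = 0 by subst e; lra.
  rewrite mulf_eq0 gt_eqF //= => /eqP f0; exfalso.
  have : 0 < b * b by rewrite mulr_gt0.
  by rewrite -ff f0 mulr0 ltxx.
have fE : f = - b.
  have /sqr_eqP[fb|//] : f ^+ 2 = b ^+ 2 by rewrite !expr2.
  have : 0 < b * b by rewrite mulr_gt0.
  by subst e f; lra.
subst e f; have aE : a = b * b by lra.
subst a; have D2E : 1 + b * b * (b * b) + 2 * (b * b) = (1 + b * b) ^+ 2 by ring.
have pE : `|p| = (1 + b * b)%:C.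
  apply/eqP; rewrite -(eqrXn2 (n := 2)) ?normr_ge0 ?ler0c //; last by rewrite addr_ge0 // ltW.
  by rewrite np D2E rmorphXn.
have bb0 : (b * b)%:C != 0 :> R[i] by rewrite fmorph_eq0 gt_eqF.
have t10 : t1 != 0 by rewrite -normr_eq0 nt1 oner_eq0.
have : 1 + t1 - 2%:R * t2 = p / t1.
  apply: (mulIf bb0); rewrite mulrAC -tw rmorph1 mul1r.
  have -> : (2 * b * - b)%:C = - (2%:R * (b * b)%:C) :> R[i].
    by rewrite -(rmorph_nat (real_complex R)) -rmorphM -rmorphN /=; congr (_%:C); ring.
  ring.
move/(congr1 Num.norm); rewrite normf_div nt1 divr1 pE => bndE.
have bnd : 1 + b * b <= 4.
  rewrite -(@lecR R) -bndE (le_trans (ler_normB _ _)) // (le_trans (lerD (ler_normD _ _) (lexx _))) //.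
  rewrite normrM normr1 nt1 nt2 normr_nat mulr1 (rmorph_nat (real_complex R) 4).
  by rewrite (_ : 1 + 1 + 2%:R = 4%:R) //; ring.
have nb : 2 * n%:R * b = b * b - 1.
  have D0 : (1 + b * b) ^+ 2 != 0 by rewrite expf_neq0 // gt_eqF //; have := mulr_gt0 b_gt0 b_gt0; lra.
  apply: (mulIf D0); have u_E : u = b * b - 1 by apply: (mulfI (lt0r_neq0 b_gt0)); lra.
  have NE : N = (1 + b * b * (b * b)) / 2 by lra.
  transitivity (2 * b * (n%:R * (1 + b * b * (b * b) + 2 * (b * b)))); first by ring.
  by rewrite nE u_E NE; field; rewrite gt_eqF.
have n0 : n = 0%N.
  case: n nE nb => // n _ nb; have nS : n.+1%:R = n%:R + 1 :> R by rewrite -natr1.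
  have nb_ge0 : 0 <= n%:R * b by rewrite mulr_ge0 ?ler0n // ltW.
  rewrite nS in nb; have b_le1 : b <= 1 by lra.
  by exfalso; have := ler_pM2l b_gt0 b 1; rewrite b_le1 mulr1; lra.
have b1 : b = 1.
  have /eqP : (b - 1) * (b + 1) = 0 by subst n; lra.
  by rewrite mulf_eq0 => /orP[/eqP|/eqP]; lra.
by subst b; rewrite mulr1.
Qed.

Lemma real_complexP (R : realType) (v : R[i]) : v^* = v -> exists x : R, v = x%:C.
Proof. by move=> /CrealP/complex_realP[x ->]; exists x. Qed.

(** * Symbols with a pair of distinct dual labels *)

Section NonSelfDual.
Variables (R : realType) (hat : 'I_4 -> 'I_4) (N : 'I_4 -> 'M[rat]_4) (S T : 'M[R[i]]_4).
Hypothesis unitary_NST : unitary_modular_symbol hat N S T.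
Variable q : 'S_4.
Hypothesis q0 : q o0 = o0.
Hypothesis hat1 : hat (q o1) = q o1.
Hypothesis hat2 : hat (q o2) = q o3.

Local Notation st := (normalized_S S).
Local Notation w := (st (q o2) (q o2)).

Let st_hat i j : st i (hat j) = (st i j)^*.
Proof. exact: mfr_hat (ms_fusion unitary_NST.1) i j. Qed.

Let stC i j : st i j = st j i. Proof. exact: st_sym unitary_NST i j. Qed.

Let sumq (F : 'I_4 -> R[i]) : \sum_k F k = F o0 + F (q o1) + F (q o2) + F (q o3).
Proof. by rewrite -(sum_relabel q) sum4 q0. Qed.

Lemma non_self_dual_entries : exists a b e f u m : R,
  [/\ st (q o1) o0 = a%:C, st (q o2) o0 = b%:C & st (q o3) o0 = b%:C] /\
  [/\ st (q o1) (q o1) = e%:C, st (q o1) (q o2) = f%:C, st (q o1) (q o3) = f%:C &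
   [/\ st (q o2) (q o3) = w^*, st (q o3) (q o3) = w, w + w^* = u%:C & w * w^* = m%:C]].
Proof.
have [a aE] := real_complexP (dim_conj unitary_NST (q o1)).
have [b bE] := real_complexP (dim_conj unitary_NST (q o2)).
have [e eE] : exists e : R, st (q o1) (q o1) = e%:C by apply: real_complexP; rewrite -st_hat hat1.
have [f fE] : exists f : R, st (q o1) (q o2) = f%:C.
  by apply: real_complexP; rewrite stC -st_hat hat1.
have [u uE] : exists u : R, w + w^* = u%:C.
  by apply: real_complexP; rewrite rmorphD /= conjCK addrC.
have [m mE] : exists m : R, w * w^* = m%:C.
  by apply: real_complexP; rewrite rmorphM /= conjCK mulrC.
exists a, b, e, f, u, m; split; split=> //.
- by rewrite stC -hat2 st_hat stC bE conj_realC.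
- by rewrite -hat2 st_hat fE conj_realC.
split=> //; first by rewrite -hat2 st_hat.
by rewrite -{2}hat2 st_hat stC -hat2 st_hat conjCK.
Qed.

(** The entry [w] is not real, since otherwise the rows of the two dual labels would be equal,
    against orthogonality. Hence these rows differ in the columns of the dual labels. *)
Lemma non_self_dual_column_neq k : st (q o2) k / st k o0 = st (q o3) k / st k o0 ->
  k = o0 \/ k = q o1.
Proof.
have [a [b [e [f [u [m [[aE bE cE] [eE fE gE [yE zE uE mE]]]]]]]]] := non_self_dual_entries.
have w_real : w != w^*.
  apply/eqP => wE; have := st_orth unitary_NST (q o2) (q o2); rewrite eqxx mulr1 => n2.
  have := st_orth unitary_NST (q o2) (q o3).
  rewrite (inj_eq (@perm_inj _ q)) mulr0 => n3.
  have : (\sum_k st k o0 ^+ 2) = 0.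
    rewrite -n2 -[RHS]n3 !sumq bE cE (stC (q o2) (q o1)) (stC (q o3) (q o1)) fE gE yE.
    by rewrite (stC (q o3) (q o2)) yE zE -!wE.
  by apply/eqP; rewrite gt_eqF; last exact: D2_gt0 unitary_NST.
have d2 := dim_neq0 unitary_NST (q o2); have d3 := dim_neq0 unitary_NST (q o3).
rewrite -(permKV q k); move: (q^-1%g k); apply: ord4_ind.
- by left; rewrite q0.
- by right.
- by move=> /(mulIf (invr_neq0 d2)) /eqP; rewrite (stC (q o3)) yE (negPf w_real).
- by move=> /(mulIf (invr_neq0 d3)) /eqP; rewrite yE zE eq_sym (negPf w_real).
Qed.

Lemma non_self_dual_classified : classified st.
Proof.
have [a [b [e [f [u [m [[aE bE cE] [eE fE gE [yE zE uE mE]]]]]]]]] := non_self_dual_entries.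
have s00 := d0 unitary_NST.
have D2E : \sum_k st k o0 ^+ 2 = (1 + a * a + 2 * (b * b))%:C.
  by rewrite sumq s00 aE bE cE; ring.
have ga : 1 <= a by rewrite -lecR -aE (dim_ge1 unitary_NST).
have gb : 1 <= b by rewrite -lecR -bE (dim_ge1 unitary_NST).
have orth0 i : i != o0 -> \sum_k st o0 k * (st (q i) k)^* = 0.
  move=> i0; rewrite (st_orth unitary_NST) (_ : (o0 == q i) = false) ?mulr0 //.
  by apply/negbTE; rewrite -{1}q0 (inj_eq (@perm_inj _ q)) eq_sym.
have r1 : a + a * e + 2 * (b * f) = 0.
  apply: complexI; have := orth0 o1 isT.
  rewrite sumq !(stC o0) s00 aE bE cE eE fE gE !conj_realC.
  by move=> h; transitivity (0 : R[i]); [rewrite -[RHS]h; ring | rewrite rmorph0].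
have r2 : b + a * f + b * u = 0.
  apply: complexI; have := orth0 o2 isT.
  rewrite sumq !(stC o0) (stC (q o2) (q o1)) s00 aE bE cE fE yE.
  rewrite !conj_realC conjCK => h; transitivity (0 : R[i]); last by rewrite rmorph0.
  rewrite -[RHS]h; transitivity (b%:C + a%:C * f%:C + b%:C * u%:C); first by ring.
  by rewrite -uE; ring.
have n1 : a * a + e * e + 2 * (f * f) = 1 + a * a + 2 * (b * b).
  apply: complexI; have := st_orth unitary_NST (q o1) (q o1).
  by rewrite eqxx mulr1 D2E sumq aE eE fE gE !conj_realC => <-; ring.
have n2 : b * b + f * f + 2 * m = 1 + a * a + 2 * (b * b).
  apply: complexI; have := st_orth unitary_NST (q o2) (q o2).
  rewrite eqxx mulr1 D2E sumq (stC (q o2) (q o1)) bE fE yE !conj_realC conjCK => <-.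
  transitivity (b%:C * b%:C + f%:C * f%:C + 2 * m%:C); first by ring.
  by rewrite -mE; ring.
(* Agreement of the two dual rows in a column is an integral relation, so a Galois permutation
   preserves the pair of columns 0 and [q o1]. *)
have col_fixed t i : galois_perm (lam S) t -> st (q o2) i = st (q o3) i -> t i = o0 \/ t i = q o1.
  move=> gal_t h; apply: non_self_dual_column_neq.
  by apply: (galois_perm_var (i := q o2) (j := q o3) gal_t); rewrite /lam h.
have [fix0|] := pselect (forall t, galois_perm (lam S) t -> t o0 = o0).
  have dim1 := pointed_dims_one unitary_NST fix0.
  have a1 : a = 1 by apply: complexI; rewrite -aE dim1.
  have b1 : b = 1 by apply: complexI; rewrite -bE dim1.
  have bnd i j (v : R) : st i j = v%:C -> `|v| <= 1.
    move=> vE; have := st_bound unitary_NST i j; rewrite !dim1 mulr1 vE norm_realC.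
    by rewrite -[1]/(1%:C) lecR.
  subst a b; have [] := pointed_non_self_dual (e := e) (f := f) (u := u) (N := m).
  - exact: bnd eE.
  - exact: bnd fE.
  - by lra.
  - by lra.
  - by lra.
  - by lra.
  move=> e1 f1 u0 m1; subst e f u m.
  have wc : w^* = - w by apply/eqP; rewrite -addr_eq0 addrC uE rmorph0.
  have wi : w = 'i \/ w = - 'i.
    apply: sqr_eqP; rewrite sqrCi expr2; apply: oppr_inj.
    by rewrite opprK -mulrN -wc mE rmorph1.
  exists q; split=> //; left; exists w; split=> //.
  apply/matrixP; apply: ord4_ind; apply: ord4_ind; rewrite [LHS]mxE [RHS]mxE /= ?q0;
    rewrite ?(stC o0) ?(stC (q o2) (q o1)) ?(stC (q o3) (q o1)) ?(stC (q o3) (q o2));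
    by rewrite ?s00 ?aE ?bE ?cE ?eE ?fE ?gE ?yE ?zE ?rmorphN ?rmorph1.
move=> /existsNP[t /not_implyP[gal_t /eqP t0]].
have tI i j : (t i == t j) = (i == j) by rewrite (inj_eq (@perm_inj _ t)).
have t0E : t o0 = q o1.
  by have [t0'|//] := col_fixed t o0 gal_t (etrans bE (esym cE)); move: t0; rewrite t0' eqxx.
have t1E : t (q o1) = o0.
  have [//|t1E] := col_fixed t (q o1) gal_t (etrans (stC _ _) (etrans fE (etrans (esym gE) (stC _ _)))).
  by have := tI o0 (q o1); rewrite t0E t1E eqxx -{1}q0 (inj_eq (@perm_inj _ q)).
have sq := galois_perm_sqr unitary_NST _ _ gal_t.
have ee : e * e = 1.
  apply: complexI; have := sq (q o1) o0; rewrite t0E t1E s00 expr1n eE expr2 => h.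
  by rewrite rmorphM rmorph1.
have ff : f * f = b * b.
  have t2 : t (q o2) = q o2 \/ t (q o2) = q o3.
    have := tI (q o2) o0; have := tI (q o2) (q o1); rewrite t0E t1E (inj_eq (@perm_inj _ q)).
    rewrite -{2}q0 (inj_eq (@perm_inj _ q)) /=.
    rewrite -(permKV q (t (q o2))); move: (q^-1%g (t (q o2))).
    by apply: ord4_ind; rewrite ?q0 ?eqxx //; [left|right].
  apply: complexI; rewrite !rmorphM /= -!expr2 -fE stC -t0E sq.
  by case: t2 => ->; rewrite ?bE ?cE.
pose n := fusion_coef unitary_NST (q o2) (q o2) (q o2).
have a0 : a != 0 by rewrite gt_eqF //; lra.
have b0 : b != 0 by rewrite gt_eqF //; lra.
have nE : n%:R * (1 + a * a + 2 * (b * b)) = b * b * b + f * f * f / a + m * u / b.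
  apply: complexI; have := fusion_coefE unitary_NST (q o2) (q o2) (q o2).
  rewrite D2E sumq (stC (q o2) (q o1)) s00 aE bE cE fE yE !conj_realC conjCK => h.
  rewrite rmorphM rmorph_nat h.
  transitivity (b%:C * b%:C * b%:C + f%:C * f%:C * f%:C / a%:C + m%:C * u%:C / b%:C).
    by rewrite -uE -mE; field; rewrite !fmorph_eq0 a0 b0.
  by rewrite !rmorphD /= !fmorph_div !rmorphM.
have th3 : T (q o3) (q o3) = T (q o2) (q o2).
  by rewrite -hat2 (ms_theta_hat unitary_NST.1).
have [] := @swapping_non_self_dual R a b e f u m (T (q o1) (q o1)) (T (q o2) (q o2)) (Dplus S T) n.
- exact: ga.
- exact: gb.
- exact: ee.
- exact: ff.
- exact: r1.
- exact: r2.
- exact: n2.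
- exact: nE.
- exact: twist_norm unitary_NST _.
- exact: twist_norm unitary_NST _.
- by rewrite (Dplus_norm unitary_NST).
- have := STS unitary_NST o0 (q o1).
  rewrite sumq !(stC o0) (twist0 unitary_NST) s00 aE bE cE eE fE gE th3 mul1r !mul1r mulr1 => <-.
  by ring.
(* The value 1 of the character at row [q o2], column 0 must persist in column [q o1], where it is
   [f / a = -1]. *)
move=> b1 f1 a1; have := galois_perm_one (i := q o2) (a := o0) gal_t.
rewrite /lam bE s00 b1 divr1 t0E stC fE f1 aE a1 divr1 => /(_ erefl)/complexI; lra.
Qed.

End NonSelfDual.

Theorem theorem4p1 (R : realType) (hat : 'I_4 -> 'I_4)
    (N : 'I_4 -> 'M[rat]_4) (S T : 'M[R[i]]_4) :
  label_involution hat ->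
  unitary_modular_symbol hat N S T ->
  exists s : 'S_4, s ord0 = ord0 /\
    let St : 'M[R[i]]_4 := mxsub s s (normalized_S S) in
    (exists w : R[i], (w = 'i \/ w = - 'i) /\ St = St1 w) \/
    St = St2 R[i] \/
    St = St3 R[i] \/
    St = St4 R[i] \/
    St = St5 R[i] \/
    (exists d : R, largest_real_root ('X^3 - 3 *: 'X - 1) d /\
       St = St6 (d%:C)%C).
Proof.
move=> [hatK hat_0] US; have hat0 : hat o0 = o0 := hat_0; change (classified (normalized_S S)).
have [hat_id|] := pselect (forall i, hat i = i); first exact: self_dual_classified US hat_id.
move=> /existsNP[i /eqP hi].
have hatI j k : (hat j == hat k) = (j == k) by rewrite (inj_eq (can_inj hatK)).
have i0 : i != o0 by apply: contraNneq hi => ->; rewrite hat0.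
have h0 : hat i != o0 by rewrite -[o0]hat0 hatI.
(* Besides 0, [i] and [hat i] a single label remains, and [hat] must fix it. *)
have [j [j0 ji jh]] : exists j, [/\ j != o0, j != i & j != hat i].
  by move: (hat i) => k; move: i k {hi i0 h0}; apply: ord4_ind; apply: ord4_ind;
    first [by exists o1|by exists o2|by exists o3].
have ih : i != hat i by rewrite eq_sym.
have [q [q0 q1 q2 q3]] := perm4_exists j0 i0 h0 ji jh ih.
have hat1 : hat (q o1) = q o1.
  have := hatI j i; have := hatI j (hat i); have := hatI j o0.
  rewrite hatK hat0 q1 (negPf j0) (negPf ji) (negPf jh) -(permKV q (hat j)).
  move: (q^-1%g (hat j)).
  by apply: ord4_ind; rewrite ?q0 ?q1 ?q2 ?q3 ?eqxx.
by apply: (non_self_dual_classified US q0 hat1); rewrite q2 q3.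
Qed.
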